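(* Let $j^{*}:G_{1}\rightarrow\pi_{1}(HA,(0,0))$ be the epimorphism induced by the inclusion $j:Y_{1}\hookrightarrow HA$, and let $K=\ker j^{*}$. Then $(w_{1},w_{2},\dots)\in K$ if and only if there exists $N$ such that the following holds: for each $n\geq N$, if each occurrence of $x_{i}$ in $w_{n}$, for each $i\leq N$, is replaced by $x_{N}$, creating a (non-reduced) word $v_{n}$ on the letters $\{x_{N},x_{N+1},\dots,x_{n}\}$, then $v_{n}$ reduces to the trivial element of $F_{N,n}$.
   Context: For $n\geq1$ let $X_{n}\subset\mathbb{R}^{2}$ be the circle of radius $\frac1n$ centered at $(\frac1n,0)$, $Y_{n}=\bigcup_{i\geq n}X_{i}$; $Y_1$ is the Hawaiian earring. Let $A_{n}\subset\mathbb{R}^2$ be the closed pinched annulus bounded by $X_{n}\cup X_{n+1}$ and $Y^{n}=Y_{1}\cup A_{1}\cup\dots\cup A_{n}$ with the Euclidean subspace topology. The harmonic archipelago $HA$ has underlying set $\bigcup_{n}Y^{n}$, with a topology such that each $Y^{n}$ inherits its usual topology and: (1) there is a sequence $z_{n}\in\operatorname{int}(A_{n})$ such that $\{z_{1},z_{2},\dots\}$ has no subsequential limit, and (2) if $p\in HA$ is a subsequential limit of a sequence $(y_n)$ with $y_{n}\in\operatorname{int}(A_{n})$ for all $n$, then $p=(0,0)$. Let $x_i$ denote the loop going once around $X_i$ from $(0,0)$. For $n\ge N$, $F_{N,n}$ is the free group on $x_N,\dots,x_n$, and $\phi_{N,n}:F_{N,n+1}\to F_{N,n}$ fixes $x_i$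 ($N\le i\le n$) and kills $x_{n+1}$. The retractions $r_{1,n}:Y_1\to X_1\cup\dots\cup X_n$ collapsing $X_i$ ($i>n$) to $(0,0)$ induce an injective homomorphism $\psi_1:\pi_1(Y_1,(0,0))\to\varprojlim F_{1,n}$; elements of the inverse limit are written as canonical sequences $(w_1,w_2,\dots)$ with $w_n\in F_{1,n}$ a reduced word and $\phi_{1,n}(w_{n+1})=w_n$. $G_1$ is the image of $\psi_1$ (those canonical sequences such that for each $i$ there is $M_i$ with $x_i$ appearing at most $M_i$ times in every $w_n$), and $\pi_1(Y_1,(0,0))$ is identified with $G_1$. *)

(* Defs.v *)
From Stdlib Require Import Reals.
From mathcomp Require Import all_boot all_order all_algebra.
From mathcomp Require Import all_classical all_reals all_analysis.
From mathcomp Require Import Rstruct Rstruct_topology.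

Set Implicit Arguments.
Unset Strict Implicit.
Unset Printing Implicit Defensive.

Local Open Scope classical_set_scope.
Local Open Scope R_scope.

Definition pt := (R * R)%type.
Definition origin : pt := (0, 0).

Definition unitI : set R := [set t | 0 <= t <= 1].
Definition unitSq : set (R * R) := unitI `*` unitI.

(* X_i : circle of radius 1/i centred at (1/i, 0)   (used for i >= 1) *)
Definition circleX (i : nat) : set pt :=
  [set p | (p.1 - / INR i) ^ 2 + p.2 ^ 2 = (/ INR i) ^ 2].

(* Y_n = union of X_i, i >= n   (used for n >= 1); Y 1 is the Hawaiian earring *)
Definition Yearr (n : nat) : set pt := [set p | exists i, (n <= i)%N /\ circleX i p].

Definition Wfin (n : nat) : set pt :=
  [set p | exists i, (1 <= i <= n)%N /\ circleX i p].

Definition annulus (n : nat) : set pt :=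
  [set p | (p.1 - / INR n) ^ 2 + p.2 ^ 2 <= (/ INR n) ^ 2 /\
           (/ INR n.+1) ^ 2 <= (p.1 - / INR n.+1) ^ 2 + p.2 ^ 2].

Definition Yup (n : nat) : set pt :=
  Yearr 1 `|` [set p | exists k, (1 <= k <= n)%N /\ annulus k p].

Definition HAset : set pt := [set p | exists n, Yup n p].

Definition retract (n : nat) (p : pt) : pt :=
  if pselect (Wfin n p) then p else origin.

(* words: a letter (i, true) is x_i, (i, false) is x_i^{-1} *)
Definition letter := (nat * bool)%type.

Definition inverse_letters (a b : letter) : bool :=
  (a.1 == b.1) && (a.2 != b.2).

Fixpoint reduced (w : seq letter) : bool :=
  match w with
  | a :: ((b :: _) as t) => ~~ inverse_letters a b && reduced t
  | _ => true
  end.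

Definition freered (w : seq letter) : seq letter :=
  foldr (fun a acc => match acc with
                      | b :: t => if inverse_letters a b then t else a :: acc
                      | [::] => [:: a]
                      end) [::] w.

Definition substN (N : nat) (w : seq letter) : seq letter :=
  map (fun a => if (a.1 <= N)%N then (N, a.2) else a) w.

Definition circ (i : nat) (u : R) : pt :=
  (/ INR i - / INR i * cos (2 * PI * u), / INR i * sin (2 * PI * u)).

(* the loop spelled by a word: the concatenation of its letters, the k-th
   letter being traversed on [k/L, (k+1)/L]  (L = length of the word) *)
Definition wordloop (w : seq letter) (t : R) : pt :=
  let L := size w in
  if L is 0 then origin else
  let k := minn (Z.to_nat (Z.pred (up (INR L * t)))) L.-1 in
  let u := INR L * t - INR k in
  let a := nth (0%N, true) w k in
  circ a.1 (if a.2 then u else 1 - u).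

Definition homotopic_in (S : set pt) (f g : R -> pt) : Prop :=
  exists H : R * R -> pt,
    {within unitSq, continuous H} /\
    (forall st, unitSq st -> S (H st)) /\
    (forall s, unitI s -> H (s, 0) = f s /\ H (s, 1) = g s) /\
    (forall t, unitI t -> H (0, t) = origin /\ H (1, t) = origin).

(* the loop j o gamma is null-homotopic rel base point in the space T
   (the harmonic archipelago, with e : T -> R^2 the identification of its
   points, b the base point (0,0)) *)
Definition nullhomotopic_HA (T : topologicalType) (e : T -> pt) (b : T)
  (gamma : R -> pt) : Prop :=
  exists H : R * R -> T,
    {within unitSq, continuous H} /\
    (forall s, unitI s -> e (H (s, 0)) = gamma s /\ H (s, 1) = b) /\
    (forall t, unitI t -> H (0, t) = b /\ H (1, t) = b).

(* Main.v *)
(* As a set, the archipelago is the closed disc bounded by X_1, foliated by the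
   circles tangent to the vertical axis at the origin.

   If gamma bounds a homotopy H in HA, then by (1) and compactness H misses the
   points z_n for n >= N, and by (2) H is continuous for the Euclidean topology.
   The disc punctured at those z_n maps to X_N, ..., X_n: the rays from the
   origin squeeze the annuli A_k, k < N, onto X_N, each punctured A_k retracts
   onto its boundary, and the disc inside X_n beyond its puncture goes to the
   origin. The letters read by H when it crosses the points opposite to the
   origin show that v_n, read along the boundary, is trivial.

   Conversely the squeezed loop, in Y_N, is trivial in every F_{N,n}, hence lifts
   to a closed path in the Cayley tree of every F_{N,n}. Give the edges x_i a
   length l_i so small that the total length over all the crossings of gamma is
   finite, whatever n is. The distances to the root along the lifts are then
   equicontinuous in n, and a limit along an ultrafilter is the height function h
   of a real tree: a barrier argument in the Cayley trees shows that
   h(s) = h(t) = min_[s,t] h forces the loop to agree at s and t. So the loop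
   factors through this tree, and contracting the tree contracts the loop. *)
Require Import Defs.
From Stdlib Require Import Reals.
From mathcomp Require Import all_boot all_order all_algebra.
From mathcomp Require Import all_classical all_reals all_analysis.
From mathcomp Require Import Rstruct Rstruct_topology.
From Stdlib Require Import Lra Lia Psatz.

Local Open Scope classical_set_scope.

(** * Free reduction of words *)

Section Words.

Implicit Types (a b : letter) (u v w r : seq letter) (i : nat).

(** Free groups enter only through holonomy: a path in a wedge of unit circles becomes a word by
    integrating the local cocycle [cross], and homotopy invariance is the integration of this
    cocycle over the square. The letters are read opposite to the base point because infinitely many
    circles meet at the origin: a path may pass there infinitely often, while by continuity it makes
    only finitely many excursions to the far part of a given circle. Both implications use the same
    coordinates [wA], [wB], with the punctures at points missed by the homotopy in one case and
    arbitrary in the other. In the converse a developing map takes values in finite words, so it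
    exists at finite levels only. The Cayley trees of different levels are compared through their
    height functions alone, whose modulus of continuity does not depend on the level. An ultrafilter
    gives a limit at all parameters at once. The limit tree is never built as a space: it is coded
    by [h], and maps out of it are functions compatible with [h]. *)

Definition linv a : letter := (a.1, ~~ a.2).

(** Left multiplication by a letter in the free group, acting on reduced words; [freered] iterates
    it. *)
Definition step a r : seq letter :=
  if r is b :: t then (if inverse_letters a b then t else a :: r) else [:: a].

Lemma inverse_lettersE a b : inverse_letters a b = (b == linv a).
Proof.
case: a b => [i x] [j y]; rewrite /inverse_letters /linv /= xpair_eqE eq_sym.
by case: x; case: y.
Qed.

Lemma linvK a : linv (linv a) = a.
Proof. by case: a => i x; rewrite /linv /= negbK. Qed.

Lemma freered_cons a u : freered (a :: u) = step a (freered u).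
Proof. by []. Qed.

Lemma reduced_cons a r : reduced (a :: r) -> reduced r.
Proof. by case: r => // b r /andP[]. Qed.

Lemma reduced_step a r : reduced r -> reduced (step a r).
Proof.
case: r => // b r /= hr; case: ifP => [_|hab]; first exact: reduced_cons hr.
by rewrite /= hab.
Qed.

Lemma reduced_freered u : reduced (freered u).
Proof. by elim: u => // a u IH; rewrite freered_cons reduced_step. Qed.

Lemma step_cases a r :
  step a r = a :: r \/ r = linv a :: step a r.
Proof.
case: r => [|b r] /=; first by left.
by rewrite inverse_lettersE; case: eqP => [->|_]; [right | left].
Qed.

Lemma stepK a r : reduced r -> step (linv a) (step a r) = r.
Proof.
case: r => [|b r] hr /=.
  by rewrite inverse_lettersE linvK eqxx.
rewrite inverse_lettersE; case: eqP => [hb|_] /=; last first.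
  by rewrite inverse_lettersE linvK eqxx.
case: r hr => [|c r] /=; first by rewrite hb.
by rewrite -hb => /andP[/negbTE-> _].
Qed.

Lemma freered_cat u v : freered (u ++ v) = foldr step (freered v) u.
Proof. by rewrite /freered foldr_cat. Qed.

Lemma foldr_step_freered u r :
  reduced r -> foldr step r (freered u) = foldr step r u.
Proof.
move=> hr.
have hf w : reduced (foldr step r w).
  by elim: w => //= a w IH; rewrite reduced_step.
elim: u => // a u IH; rewrite freered_cons [RHS]/= -IH.
have [->|E] := step_cases a (freered u); first by [].
by rewrite [in RHS]E /= -[X in step X](linvK a) stepK.
Qed.

Lemma freered_catr u v v' :
  freered v = freered v' -> freered (u ++ v) = freered (u ++ v').
Proof. by rewrite !freered_cat => ->. Qed.

Lemma freered_catl u u' v :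
  freered u = freered u' -> freered (u ++ v) = freered (u' ++ v).
Proof.
move=> E; rewrite !freered_cat -(foldr_step_freered u) ?reduced_freered //.
by rewrite E foldr_step_freered ?reduced_freered.
Qed.

Lemma freered_linv a u : freered (linv a :: a :: u) = freered u.
Proof. by rewrite !freered_cons stepK ?reduced_freered. Qed.

(** An idempotent of a group is trivial; [inv] is a left inverse. This makes a cocycle trivial on
    the diagonal. *)
Lemma freered_idem u : freered (u ++ u) = freered u -> freered u = [::].
Proof.
move=> uu.
pose inv := fix inv v := if v is a :: v then inv v ++ [:: linv a] else [::].
have invK v : freered (inv v ++ v) = [::].
  elim: v => //= a v IH; rewrite -catA -[RHS]IH.
  by apply: freered_catr; exact: freered_linv.
rewrite -[LHS]/(freered ([::] ++ u)) (freered_catl _ (inv u ++ u)) ?invK //.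
by rewrite -catA (freered_catr _ _ u).
Qed.

Definition occ i u : nat := count (fun a : letter => a.1 == i) (freered u).

Lemma occ_cons i a u :
  if a.1 == i then occ i (a :: u) = (occ i u).+1 \/ occ i u = (occ i (a :: u)).+1
  else occ i (a :: u) = occ i u.
Proof.
rewrite /occ freered_cons; have [->|E] := step_cases a (freered u).
  by rewrite /=; case: eqP => _; [left|].
have -> : count (fun b : letter => b.1 == i) (freered u) =
  ((linv a).1 == i) + count (fun b : letter => b.1 == i) (step a (freered u)).
  by rewrite {1}E.
by rewrite /=; case: eqP => _; [right|].
Qed.

Lemma occ_cat_notin i u v :
  all (fun a : letter => a.1 != i) u -> occ i (u ++ v) = occ i v.
Proof.
elim: u => //= a u IH /andP[/negbTE hai /IH <-].
by have := occ_cons i a (u ++ v); rewrite hai.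
Qed.

Lemma occ_cat_le i u v : (occ i (u ++ v) <= size u + occ i v)%N.
Proof.
elim: u => //= a u IH; apply: leq_trans (_ : (occ i (u ++ v)).+1 <= _)%N; last first.
  by rewrite addSn.
have := occ_cons i a (u ++ v); rewrite /=; case: ifP => _; last by move->.
by case=> ->; rewrite // -addn2 leq_addr.
Qed.

Lemma occ_freered i u v : freered u = freered v -> occ i u = occ i v.
Proof. by rewrite /occ => ->. Qed.

End Words.

(** * Compactness of the unit square *)

Section Compactness.
Local Open Scope R_scope.

Definition near2 (d : R) (x y : R * R) : Prop :=
  Rabs (x.1 - y.1) < d /\ Rabs (x.2 - y.2) < d.

Lemma near2_sym d x y : near2 d x y -> near2 d y x.
Proof. by case=> *; split; rewrite Rabs_minus_sym. Qed.

Lemma near2_refl d x : 0 < d -> near2 d x x.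
Proof. by move=> d0; split; rewrite Rminus_diag Rabs_R0. Qed.

Lemma near2_trans d e x y z : near2 d x y -> near2 e y z -> near2 (d + e) x z.
Proof.
case=> h1 h2 [h3 h4]; split.
- have -> : x.1 - z.1 = (x.1 - y.1) + (y.1 - z.1) by ring.
  by apply: Rle_lt_trans (Rabs_triang _ _) _; lra.
- have -> : x.2 - z.2 = (x.2 - y.2) + (y.2 - z.2) by ring.
  by apply: Rle_lt_trans (Rabs_triang _ _) _; lra.
Qed.

Lemma near2_le d e x y : d <= e -> near2 d x y -> near2 e x y.
Proof. by move=> h [*]; split; lra. Qed.

Lemma nbhs_near2 (x : R * R) (P : set (R * R)) :
  nbhs x P <-> exists d, 0 < d /\ forall y, near2 d x y -> P y.
Proof.
split.
  move=> /nbhs_ballP[d /RltP d0 hd]; exists d; split => // y [h1 h2]; apply: hd.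
  by split; apply/RltP; rewrite -RabsE.
move=> [d [/RltP d0 hd]]; apply/nbhs_ballP; exists d => // y [h1 h2]; apply: hd.
by split; rewrite RabsE; apply/RltP.
Qed.

Lemma nbhs_Rabs (x : R) (P : set R) :
  nbhs x P <-> exists d, 0 < d /\ forall y, Rabs (x - y) < d -> P y.
Proof.
split.
  move=> /nbhs_ballP[d /RltP d0 hd]; exists d; split => // y h1; apply: hd.
  by apply/RltP; rewrite -RabsE.
move=> [d [/RltP d0 hd]]; apply/nbhs_ballP; exists d => // y h1; apply: hd.
by rewrite RabsE; apply/RltP.
Qed.

(** The parameter filter for the near-covering form of compactness: what holds at all small enough
    scales. *)
Definition small_filter : set_system R :=
  [set A | exists d0, 0 < d0 /\ forall d, 0 < d -> d <= d0 -> A d].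

Instance small_filter_filter : Filter small_filter.
Proof.
constructor.
- by exists 1; split; [lra|].
- move=> P Q [d [d0 hP]] [e [e0 hQ]]; exists (Rmin d e); split.
    exact: Rmin_pos.
  move=> r r0 hr; split; [apply: hP|apply: hQ] => //.
    exact: Rle_trans hr (Rmin_l _ _).
  exact: Rle_trans hr (Rmin_r _ _).
- by move=> P Q PQ [d [d0 hP]]; exists d; split => // r r0 /(hP _ r0)/PQ.
Qed.

Lemma unitI_itv : unitI = [set` `[0%R : R, 1%R : R]%R].
Proof.
apply/seteqP; split=> t /=; rewrite /unitI /= in_itv /=.
  by move=> [/RleP -> /RleP ->].
by move=> /andP[/RleP ? /RleP ?].
Qed.

Lemma compact_unitSq : compact unitSq.
Proof.
by rewrite /unitSq unitI_itv; apply: compact_setX; exact: segment_compact.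
Qed.

(** The Lebesgue number argument in general form: uniform continuity, boundedness and the avoidance
    of the points [z_n] are all instances. *)
Lemma unitSq_cover (P : R -> R * R -> Prop) :
  (forall d e x, 0 < d -> d <= e -> P e x -> P d x) ->
  (forall x, unitSq x ->
    exists d, 0 < d /\ forall y, unitSq y -> near2 d x y -> P d y) ->
  exists d, 0 < d /\ forall y, unitSq y -> P d y.
Proof.
move=> Pmono Ploc.
have /compact_near_coveringP hK := compact_unitSq.
have : \forall d \near small_filter, unitSq `<=` (fun x => unitSq x -> P d x).
  apply: hK => x Sx; have [d [d_gt0 hd]] := Ploc _ Sx.
  exists ([set y | near2 d x y], [set e | 0 < e /\ e <= d]) => /=.
    split.
      by apply/nbhs_near2; exists d.
    by exists d.
  move=> [y e] /= [hy [e0 he]] Sy.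
  exact: Pmono he (hd _ Sy hy).
move=> [d0 [d0_gt0 hd0]].
by exists d0; split => // y Sy; apply: (hd0 d0) => //; lra.
Qed.

Lemma unitI_cover (P : R -> R -> Prop) :
  (forall d e x, 0 < d -> d <= e -> P e x -> P d x) ->
  (forall x, unitI x ->
    exists d, 0 < d /\ forall y, unitI y -> Rabs (x - y) < d -> P d y) ->
  exists d, 0 < d /\ forall y, unitI y -> P d y.
Proof.
move=> Pmono Ploc.
have [d e x|x|d [d0 hd]] := unitSq_cover (fun d x => P d x.1).
- exact: Pmono.
- move=> [Sx _]; have [d [d0 hd]] := Ploc _ Sx.
  by exists d; split => // y [Sy _] [hy _]; apply: hd.
- exists d; split=> // y Sy.
  by apply: (hd (y, 0)); split => //=; rewrite /unitI /=; lra.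
Qed.

Definition conton (S : set (R * R)) (f : R * R -> R) : Prop :=
  forall x, S x -> forall e, 0 < e ->
  exists d, 0 < d /\ forall y, S y -> near2 d x y -> Rabs (f x - f y) < e.

Definition contI (f : R -> R) : Prop :=
  forall x, unitI x -> forall e, 0 < e ->
  exists d, 0 < d /\ forall y, unitI y -> Rabs (x - y) < d -> Rabs (f x - f y) < e.

Lemma Rabs_sub_triang a b c d e :
  Rabs (a - b) < d -> Rabs (a - c) < e -> Rabs (b - c) < d + e.
Proof.
move=> h1 h2; have -> : b - c = - (a - b) + (a - c) by ring.
by apply: Rle_lt_trans (Rabs_triang _ _) _; rewrite Rabs_Ropp; lra.
Qed.

Lemma conton_unif f : conton unitSq f -> forall e, 0 < e ->
  exists d, 0 < d /\ forall x y, unitSq x -> unitSq y -> near2 d x y ->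
    Rabs (f x - f y) < e.
Proof.
move=> fc e e0.
have [|x Sx|d [d0 hd]] := unitSq_cover
  (fun d x => forall y, unitSq y -> near2 d x y -> Rabs (f x - f y) < e).
- by move=> d d' x d0 dd' hx y Sy xy; apply: hx => //; exact: near2_le xy.
- have [|d [d0 hd]] := fc _ Sx (e / 2); first lra.
  exists (d / 2); split; first lra.
  move=> y Sy xy z Sz yz.
  have -> : e = e / 2 + e / 2 by field.
  apply: (@Rabs_sub_triang (f x)); apply: hd => //.
    by apply: near2_le xy; lra.
  have -> : d = d / 2 + d / 2 by field.
  exact: near2_trans xy yz.
- by exists d; split => // x y Sx Sy; exact: hd.
Qed.

Lemma contI_unif f : contI f -> forall e, 0 < e ->
  exists d, 0 < d /\ forall x y, unitI x -> unitI y -> Rabs (x - y) < d ->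
    Rabs (f x - f y) < e.
Proof.
move=> fc e e0.
have [|d [d0 hd]] := conton_unif (fun x => f x.1) _ e e0.
  move=> x [Sx _] e' e'0; have [d [d0 hd]] := fc _ Sx _ e'0.
  by exists d; split => // y [Sy _] [h _]; exact: hd.
exists d; split => // x y Sx Sy xy.
have I0 : unitI 0 by rewrite /unitI /=; lra.
by apply: (hd (x, 0) (y, 0)) => //; split => //=; rewrite Rminus_diag Rabs_R0.
Qed.

Lemma conton_contI (f : R * R -> R) t :
  unitI t -> conton unitSq f -> contI (fun s => f (s, t)).
Proof.
move=> It fc x Ix e e0.
have [|d [d0 hd]] := fc (x, t) _ _ e0; first by split.
exists d; split => // y Iy xy; apply: hd; split => //=.
by rewrite Rminus_diag Rabs_R0.
Qed.

End Compactness.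

(** * Developing maps of paths in a wedge of circles *)

Section Holonomy.
Local Open Scope R_scope.

Definition eqw (u v : seq letter) : Prop := freered u = freered v.

Lemma eqw_catl u u' v : eqw u u' -> eqw (u ++ v) (u' ++ v).
Proof. exact: freered_catl. Qed.

Lemma eqw_catr u v v' : eqw v v' -> eqw (u ++ v) (u ++ v').
Proof. exact: freered_catr. Qed.

Definition isneg (r : R) : bool := if Rlt_dec r 0 then true else false.

Lemma isnegP r : reflect (r < 0) (isneg r).
Proof. by rewrite /isneg; case: Rlt_dec => h; constructor. Qed.

Lemma isneg_neq r s : isneg r != isneg s -> Rabs r <= Rabs (r - s).
Proof.
case: isnegP; case: isnegP => // h1 h2 _; rewrite /Rabs;
  case: Rcase_abs => ?; case: Rcase_abs => ?; lra.
Qed.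

Lemma archi_inv e : 0 < e -> exists m : nat, 0 < INR m /\ 1 / INR m < e.
Proof.
move=> e0; have [m [hm m0]] := archimed_cor1 _ e0.
exists m; split; first exact: lt_0_INR.
by rewrite /Rdiv Rmult_1_l.
Qed.

Section Cross.
Context {X : Type}.
Implicit Types (A B : nat -> X -> R) (x y z : X) (i n : nat).

(* [A i x], [B i x] are the coordinates of the [i]-th component of a point of a
   wedge of unit circles centred at (1, 0); the base point is (0, 0) and the
   point opposite to it is (2, 0). *)
Definition wedge A B : Prop :=
  (forall i x, (A i x - 1) ^ 2 + B i x ^ 2 = 1) /\
  (forall i j x, A i x <> 0 -> A j x <> 0 -> i = j).

(** Zero counts as nonnegative. Passing from the nonnegative to the negative side reads [x_i], in
    accordance with [circ], on which the sine is positive first. *)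
Definition side_cross B i x y : seq letter :=
  if isneg (B i x) == isneg (B i y) then [::] else [:: (i, isneg (B i y))].

(** Only the far half [1 < A i] counts, so a change of sign at the base point reads nothing. The
    default 0 of [xget] is harmless: the test that follows then fails. *)
Definition cross A B x y : seq letter :=
  let i := xget 0%N [set i | 1 < A i x] in
  if pselect (1 < A i x /\ 1 < A i y) then side_cross B i x y else [::].

Lemma side_cross_cocycle B i x y z :
  eqw (side_cross B i x y ++ side_cross B i y z) (side_cross B i x z).
Proof.
rewrite /side_cross /eqw.
by case: (isneg (B i x)); case: (isneg (B i y)); case: (isneg (B i z));
  rewrite //= /inverse_letters /= eqxx.
Qed.

Variables A B : nat -> X -> R.
Hypothesis wAB : wedge A B.

Lemma wedge_range i x : 0 <= A i x <= 2.
Proof. by have := wAB.1 i x; nra. Qed.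

Lemma wedge_B0 i x : A i x = 0 -> B i x = 0.
Proof. by move=> h; have := wAB.1 i x; rewrite h; nra. Qed.

Lemma cross_index i x y : 1 < A i x -> 1 < A i y ->
  cross A B x y = side_cross B i x y.
Proof.
move=> hx hy; rewrite /cross.
have -> : xget 0%N [set i | 1 < A i x] = i.
  apply: xget_unique => //= j hj.
  by apply: (wAB.2 _ _ x); lra.
by case: pselect => // -[].
Qed.

Lemma cross_cases x y :
  (exists i, [/\ 1 < A i x, 1 < A i y & cross A B x y = side_cross B i x y]) \/
  ((forall i, A i x <= 1 \/ A i y <= 1) /\ cross A B x y = [::]).
Proof.
have [[i [hx hy]]|h] := pselect (exists i, 1 < A i x /\ 1 < A i y).
  by left; exists i; split => //; exact: cross_index.
right; split.
  move=> i; have [?|?] := Rle_lt_dec (A i x) 1; first by left.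
  have [?|?] := Rle_lt_dec (A i y) 1; first by right.
  by case: h; exists i.
rewrite /cross; case: pselect => // hh; case: h.
by exists (xget 0%N [set i | 1 < A i x]).
Qed.

Lemma cross_nil x y : (forall i, A i x <= 1) -> cross A B x y = [::].
Proof. by move=> h; have [[i []]|[]//] := cross_cases x y; have := h i; lra. Qed.

Lemma cross_notin i x y : A i x <= 1 ->
  all (fun a : letter => a.1 != i) (cross A B x y).
Proof.
move=> hx; have [[j [hjx _ ->]]|[_ ->]//] := cross_cases x y.
rewrite /side_cross; case: ifP => //= _; rewrite andbT.
by apply/eqP => ji; move: hjx; rewrite ji; lra.
Qed.

Definition wclose x y : Prop :=
  forall i, Rabs (A i x - A i y) < 1 / 2 /\ Rabs (B i x - B i y) < 1 / 2.

(** A sign change between close points makes both second coordinates smaller than 1/2, and on the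
    far half this gives first coordinates above 3/2. The margin of 1/2 keeps the third vertex of a
    small triangle on the far half. *)
Lemma cross_far x y : wclose x y -> cross A B x y <> [::] ->
  exists i, 3 / 2 < A i x /\ 3 / 2 < A i y.
Proof.
move=> hxy; have [[i [hx hy ->]]|[_ ->]//] := cross_cases x y.
rewrite /side_cross; case: ifP => // /negbT hB _; exists i.
have [h1 h2] := hxy i.
have h3 := isneg_neq _ _ hB.
have h4 : Rabs (B i y) <= Rabs (B i x - B i y).
  by rewrite Rabs_minus_sym; apply: isneg_neq; rewrite eq_sym.
have cx := wAB.1 i x; have cy := wAB.1 i y.
have [] : Rabs (B i x) < 1/2 /\ Rabs (B i y) < 1/2 by split; lra.
move=> /Rabs_def2[? ?] /Rabs_def2[? ?].
by split; nra.
Qed.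

Lemma cross_cocycle x y z : wclose x y -> wclose y z -> wclose x z ->
  eqw (cross A B x y ++ cross A B y z) (cross A B x z).
Proof.
move=> xy yz xz.
have [[i [hx hy hz]]|h] :=
  pselect (exists i, [/\ 1 < A i x, 1 < A i y & 1 < A i z]).
  by rewrite !(cross_index i) //; exact: side_cross_cocycle.
have -> : cross A B x y = [::].
  apply: contrapT => /(cross_far _ _ xy)[i [hx hy]]; case: h; exists i.
  by have [/Rabs_def2[? ?] _] := xz i; split; lra.
have -> : cross A B y z = [::].
  apply: contrapT => /(cross_far _ _ yz)[i [hx hy]]; case: h; exists i.
  by have [/Rabs_def2[? ?] _] := xz i; split; lra.
have -> // : cross A B x z = [::].
apply: contrapT => /(cross_far _ _ xz)[i [hx hy]]; case: h; exists i.
by have [/Rabs_def2[? ?] _] := yz i; split; lra.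
Qed.

End Cross.

(** Collapses the components beyond [n] to the base point, as [r_{1,n}] does; since finitely many
    components remain, they have a common modulus of continuity. *)
Definition level {X : Type} (n : nat) (A : nat -> X -> R) (i : nat) (x : X) : R :=
  if (i <= n)%N then A i x else 0.

Lemma wedge_level {X : Type} n (A B : nat -> X -> R) :
  wedge A B -> wedge (level n A) (level n B).
Proof.
rewrite /level; move=> [h1 h2]; split => [i x|i j x]; case: ifP => // _.
- by rewrite /=; lra.
- by case: ifP => // _; exact: h2.
Qed.

Lemma level_unif n (A : nat -> R * R -> R) :
  (forall i, conton unitSq (A i)) -> forall e, 0 < e ->
  exists d, 0 < d /\ forall x y, unitSq x -> unitSq y -> near2 d x y ->
    forall i, Rabs (level n A i x - level n A i y) < e.
Proof.
move=> Ac e e0.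
have [d [d0 hd]] : exists d, 0 < d /\ forall x y, unitSq x -> unitSq y ->
    near2 d x y -> forall i, (i < n.+1)%N -> Rabs (A i x - A i y) < e.
  elim: n.+1 => [|m [d [d0 hd]]]; first by exists 1; split; [lra|].
  have [d' [d'0 hd']] := conton_unif _ (Ac m) e e0.
  exists (Rmin d d'); split; first exact: Rmin_pos.
  move=> x y Sx Sy xy i; rewrite ltnS leq_eqVlt => /orP[/eqP->|im].
    apply: hd' => //; apply: near2_le xy; exact: Rmin_r.
  apply: hd => //; apply: near2_le xy; exact: Rmin_l.
exists d; split => // x y Sx Sy xy i; rewrite /level.
case: ifP => [|_]; first by rewrite -ltnS; exact: hd.
by rewrite Rminus_diag Rabs_R0.
Qed.

(** Integration of a local cocycle over a convex domain: [D x] is the product of [c] along the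
    subdivided segment from [x] to [x0]. *)
Lemma develop (c : R * R -> R * R -> seq letter) (e : R) (x0 : R * R) :
  0 < e -> unitSq x0 ->
  (forall x y z, unitSq x -> unitSq y -> unitSq z ->
    near2 e x y -> near2 e y z -> near2 e x z -> eqw (c x y ++ c y z) (c x z)) ->
  exists D : R * R -> seq letter, eqw (D x0) [::] /\
    exists d, 0 < d /\ forall x y, unitSq x -> unitSq y -> near2 d x y ->
      eqw (D x) (c x y ++ D y).
Proof.
move=> e0 Sx0 cc.
(* Two neighbouring segments cut out quadrilaterals with sides below [e / 3], whose diagonals are
   then below [e], the range of the cocycle identity. *)
have [|m [m0 hm]] := archi_inv (e / 3); first lra.
pose q (k : nat) (x : R * R) : R * R :=
  (x0.1 + INR k / INR m * (x.1 - x0.1), x0.2 + INR k / INR m * (x.2 - x0.2)).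
have m1 : (1 <= m)%N by case: (m) m0 => //=; lra.
have km k : (k <= m)%N -> 0 <= INR k / INR m <= 1.
  move=> /leP/le_INR kk; have k0 := pos_INR k; split.
    by apply: Rmult_le_pos k0 (Rlt_le _ _ (Rinv_0_lt_compat _ m0)).
  by apply: (Rmult_le_reg_r (INR m)) => //; rewrite Rmult_1_l /Rdiv Rmult_assoc
    Rinv_l; lra.
have qS k x : (k <= m)%N -> unitSq x -> unitSq (q k x).
  move=> /km hk; move: Sx0 x; rewrite /unitSq /unitI /= => -[? ?] x [? ?].
  by split; split; nra.
have q0 x : q 0%N x = x0.
  by rewrite /q /Rdiv !Rmult_0_l !Rplus_0_r; case: (x0).
have qm x : q m x = x.
  have E : INR m / INR m = 1 by apply: Rinv_r; lra.
  rewrite /q E; case: x => a b /=; congr (_, _); ring.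
have qk k x : (k < m)%N -> unitSq x -> near2 (e / 3) (q k.+1 x) (q k x).
  move=> _; move: Sx0; rewrite /unitSq /unitI /= => -[[? ?] [? ?]] [[? ?] [? ?]].
  have E (a b : R) : 0 <= a <= 1 -> 0 <= b <= 1 ->
    Rabs (a + INR k.+1 / INR m * (b - a) - (a + INR k / INR m * (b - a))) < e / 3.
    move=> ? ?; rewrite S_INR.
    have -> : a + (INR k + 1) / INR m * (b - a) - (a + INR k / INR m * (b - a)) =
      1 / INR m * (b - a) by field; lra.
    have : 0 < 1 / INR m by apply: Rdiv_lt_0_compat; lra.
    by move=> ?; apply: Rabs_def1; nra.
  by split; exact: E.
have qxy k x y : (k <= m)%N -> near2 (e / 3) x y -> near2 (e / 3) (q k x) (q k y).
  move=> /km hk [hx hy].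
  have E (a b b' : R) : Rabs (b - b') < e / 3 ->
    Rabs (a + INR k / INR m * (b - a) - (a + INR k / INR m * (b' - a))) < e / 3.
    move=> hb; have -> : a + INR k / INR m * (b - a) - (a + INR k / INR m * (b' - a))
      = INR k / INR m * (b - b') by ring.
    have := Rabs_pos (b - b').
    rewrite Rabs_mult (Rabs_pos_eq (INR k / INR m)); [nra|lra].
  by split; exact: E.
pose G := fix G (k : nat) (x : R * R) {struct k} : seq letter :=
  if k is k'.+1 then c (q k x) (q k' x) ++ G k' x else [::].
have cxx x : unitSq x -> eqw (c x x) [::].
  move=> Sx; have N := near2_refl e x e0.
  exact/freered_idem/(cc _ _ _ Sx Sx Sx N N N).
exists (G m); split.
  have : forall k, (k <= m)%N -> eqw (G k x0) [::].
    elim=> // k IH km1; rewrite /=; apply: eq_trans (IH (ltnW km1)).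
    rewrite -[RHS]/(freered ([::] ++ G k x0)); apply: eqw_catl.
    have qx0 j : q j x0 = x0.
      by rewrite /q !Rminus_diag !Rmult_0_r !Rplus_0_r; case: (x0).
    by rewrite !qx0; exact: cxx.
  exact.
exists (e / 3); split; first lra.
move=> x y Sx Sy xy.
suff H k : (k <= m)%N -> eqw (G k x) (c (q k x) (q k y) ++ G k y).
  by have := H m (leqnn m); rewrite !qm.
elim: k => [|k IH] km1.
  by rewrite /= !q0 cats0; apply/esym/cxx.
have xk := qS _ _ (ltnW km1) Sx; have yk := qS _ _ (ltnW km1) Sy.
have xk1 := qS _ _ km1 Sx; have yk1 := qS _ _ km1 Sy.
have near3 a b d : near2 (e / 3) a b -> near2 (e / 3) b d -> near2 e a d.
  by move=> h1 h2; apply: near2_le (near2_trans _ _ _ _ _ h1 h2); lra.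
have near1 a b : near2 (e / 3) a b -> near2 e a b.
  by apply: near2_le; lra.
have n1 := qk _ _ km1 Sx; have n2 := qk _ _ km1 Sy.
have n3 := qxy _ _ _ km1 xy; have n4 := qxy _ _ _ (ltnW km1) xy.
have s1 : eqw (c (q k.+1 x) (q k x) ++ c (q k x) (q k y)) (c (q k.+1 x) (q k y)).
  by apply: cc => //; [exact: near1|exact: near1|exact: near3 n4].
have s2 : eqw (c (q k.+1 x) (q k.+1 y) ++ c (q k.+1 y) (q k y)) (c (q k.+1 x) (q k y)).
  by apply: cc => //; [exact: near1|exact: near1|exact: near3 n2].
rewrite /=; apply: (eq_trans (eqw_catr _ _ _ (IH (ltnW km1)))).
rewrite !catA; apply: (eq_trans (eqw_catl _ _ _ s1)).
by apply/esym/eqw_catl.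
Qed.

(* The convention is that of left translation: the developing map at [s] is
   the word read along the path from [s] to the base parameter. *)
Definition developing (A B : nat -> R -> R) (D : R -> seq letter) : Prop :=
  exists d, 0 < d /\ forall s t, unitI s -> unitI t -> Rabs (s - t) < d ->
    eqw (D s) (cross A B s t ++ D t).

(** Induction along a subdivision of the interval; it takes the place of connectedness arguments. *)
Lemma chain (Q : R -> R -> Prop) a b :
  (forall r s t, Q r s -> Q s t -> Q r t) -> a <= b ->
  (exists d, 0 < d /\ forall s t, a <= s <= b -> a <= t <= b -> s <= t ->
     t - s < d -> Q s t) ->
  Q a b.
Proof.
move=> Qtr ab [d [d0 hd]].
have [|m [m0 hm]] := archi_inv (d / (b - a + 1)).
  by apply: Rdiv_lt_0_compat; lra.
have h1 : (b - a) / INR m < d.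
  have : 1 / INR m * (b - a + 1) < d / (b - a + 1) * (b - a + 1).
    by apply: Rmult_lt_compat_r; lra.
  have -> : d / (b - a + 1) * (b - a + 1) = d by field; lra.
  have : 0 < 1 / INR m by apply: Rdiv_lt_0_compat; lra.
  have -> : (b - a) / INR m = 1 / INR m * (b - a) by field; lra.
  nra.
have h0 : 0 <= (b - a) / INR m.
  by apply: Rmult_le_pos (Rlt_le _ _ (Rinv_0_lt_compat _ m0)); lra.
pose p (k : nat) := a + INR k * ((b - a) / INR m).
have pm : p m = b by rewrite /p; field; lra.
have pk k : (k <= m)%N -> a <= p k <= b.
  move=> /leP/le_INR hk; have k0 := pos_INR k.
  by move: pm h0; rewrite /p; set h := (b - a) / INR m => pm h0; nra.
suff H k : (k <= m)%N -> Q a (p k) by rewrite -pm; exact: H.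
elim: k => [|k IH] hk.
  by rewrite /p /= Rmult_0_l Rplus_0_r; apply: hd; lra.
apply: Qtr (IH (ltnW hk)) _.
have h2 := pk _ hk; have h3 := pk _ (ltnW hk).
by apply: hd => //; rewrite /p S_INR; lra.
Qed.

Section Developing.
Variables (A B : nat -> R -> R) (D : R -> seq letter).
Hypotheses (wAB : wedge A B) (dev : developing A B D).

Lemma developing_const s t : unitI s -> unitI t -> s <= t ->
  (forall i r, s <= r <= t -> A i r <= 1) -> eqw (D s) (D t).
Proof.
rewrite /unitI /= => Is It st hA; have [d [d0 hd]] := dev.
apply: (chain (fun s t => eqw (D s) (D t))) => //.
  by move=> r r' r'' ? ?; apply: eq_trans; eassumption.
exists d; split => // r r' hr hr' rr' hd'.
have := hd r r'; rewrite cross_nil /unitI /=; last 2 first.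
- exact: wAB.
- by move=> i; exact: hA.
by apply; [lra|lra|apply: Rabs_def1; lra].
Qed.

Lemma developing_notin i s t : unitI s -> unitI t -> s <= t ->
  (forall r, s <= r <= t -> A i r <= 1) ->
  exists u, all (fun a : letter => a.1 != i) u /\ eqw (D s) (u ++ D t).
Proof.
rewrite /unitI /= => Is It st hA; have [d [d0 hd]] := dev.
apply: (chain (fun s t =>
  exists u, all (fun a : letter => a.1 != i) u /\ eqw (D s) (u ++ D t))) => //.
  move=> r r' r'' [u [hu E]] [v [hv E']]; exists (u ++ v).
  rewrite all_cat hu; split => //; rewrite -catA.
  exact: eq_trans E (eqw_catr _ _ _ E').
exists d; split => // r r' hr hr' rr' hd'.
exists (cross A B r r'); split; first by apply: cross_notin => //; exact: hA.
by apply: hd; rewrite /unitI /=; [lra|lra|apply: Rabs_def1; lra].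
Qed.

(** Away from the base point [B i] changes sign only near the opposite point, so the letters read on
    the way cancel down to what the two ends show. *)
Lemma developing_far i tau s t : contI (B i) -> 0 < tau ->
  unitI s -> unitI t -> s <= t ->
  (forall r, s <= r <= t -> tau < A i r) ->
  eqw (D s) (side_cross B i s t ++ D t).
Proof.
rewrite /unitI /= => Bc tau0 Is It st hA; have [d [d0 hd]] := dev.
apply: (chain (fun s t => eqw (D s) (side_cross B i s t ++ D t))) => //.
  move=> r r' r'' E E'; apply: (eq_trans E).
  apply: (eq_trans (eqw_catr _ _ _ E')); rewrite catA.
  by apply: eqw_catl; exact: side_cross_cocycle.
(* If [B i] varies by less than [tau], a sign change gives [|B| < tau]; with [A <= 1] this would
   contradict [B ^ 2 = A (2 - A) >= A ^ 2 > tau ^ 2]. *)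
have [d' [d'0 hd']] := contI_unif _ Bc _ tau0.
exists (Rmin d d'); split; first exact: Rmin_pos.
move=> r r' hr hr' rr' hdd.
have hd1 : r' - r < d := Rlt_le_trans _ _ _ hdd (Rmin_l _ _).
have hd2 : r' - r < d' := Rlt_le_trans _ _ _ hdd (Rmin_r _ _).
have Ir : unitI r by rewrite /unitI /=; lra.
have Ir' : unitI r' by rewrite /unitI /=; lra.
have E : eqw (D r) (cross A B r r' ++ D r').
  by apply: hd => //; apply: Rabs_def1; lra.
apply: (eq_trans E).
congr (freered (_ ++ _)).
have hB : Rabs (B i r - B i r') < tau by apply: hd' => //; apply: Rabs_def1; lra.
have hAr := hA _ hr; have hAr' := hA _ hr'.
have [[j [h1 h2 ->]]|[h ->]] := cross_cases A B wAB r r'.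
  by congr side_cross; apply: (wAB.2 _ _ r); lra.
rewrite /side_cross; case: ifP => // /negbT hneg.
have h3 := isneg_neq _ _ hneg.
have h4 : Rabs (B i r') <= Rabs (B i r - B i r').
  by rewrite Rabs_minus_sym; apply: isneg_neq; rewrite eq_sym.
have c1 := wAB.1 i r; have c2 := wAB.1 i r'.
have [/Rabs_def2[? ?] /Rabs_def2[? ?]] :
  Rabs (B i r) < tau /\ Rabs (B i r') < tau by split; lra.
by exfalso; case: (h i) => ?; nra.
Qed.

End Developing.

End Holonomy.

(** * Functions on the Cayley tree along a path *)

Section Hat.
Local Open Scope R_scope.

Lemma Rabs_bounds x a : Rabs x <= a -> - a <= x /\ x <= a.
Proof. by rewrite /Rabs; case: Rcase_abs => ? ?; split; lra. Qed.

Definition unif1 (A B : nat -> R -> R) (i : nat) (e d : R) : Prop :=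
  forall s t, unitI s -> unitI t -> Rabs (s - t) < d ->
    Rabs (A i s - A i t) < e /\ Rabs (B i s - B i t) < e.

Section HatDef.
Variables (A B : nat -> R -> R) (D : R -> seq letter).

(** [D] records what remains to be read: crossing from the nonnegative side removes [x_i] from its
    front, so the other end of the edge is [x_i ^ -1] times [D x]. As [A] is at most 2, the weight
    [A / 4] in [hat] is 1/2 exactly at the opposite point, where the descriptions from both sides
    agree. *)
Definition arm (i : nat) (x : R) : letter := (i, isneg (B i x)).

(* The pair ([D x], position of [x]) is a point of the Cayley tree: it lies on
   the edge from [D x] to [arm i x :: D x]; [hat chi] extends a function on the
   vertices linearly along the edges. *)
Definition hat (chi : seq letter -> R) (x : R) : R :=
  let i := xget 0%N [set i | A i x <> 0] in
  chi (D x) + A i x / 4 * (chi (arm i x :: D x) - chi (D x)).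

Hypothesis wAB : wedge A B.
Hypothesis dev : developing A B D.

Lemma hat_index chi i x : A i x <> 0 ->
  hat chi x = chi (D x) + A i x / 4 * (chi (arm i x :: D x) - chi (D x)).
Proof.
move=> hx; rewrite /hat.
have -> // : xget 0%N [set i | A i x <> 0] = i.
  by apply: (@xget_unique _ _ [set i | A i x <> 0] i hx) => j hj; exact: (wAB.2 _ _ x).
Qed.

Lemma hat_cases chi x :
  (exists i, A i x <> 0 /\
     hat chi x = chi (D x) + A i x / 4 * (chi (arm i x :: D x) - chi (D x))) \/
  ((forall i, A i x = 0) /\ hat chi x = chi (D x)).
Proof.
have [[i hi]|h] := pselect (exists i, A i x <> 0).
  by left; exists i; split => //; exact: hat_index.
have h0 i : A i x = 0 by apply: contrapT => ?; apply: h; exists i.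
by right; split => //; rewrite /hat h0; lra.
Qed.

Definition occR (i : nat) (u : seq letter) : R := INR (occ i u).

(** Edges with another label do not change the count of [x_i], so only the [i]-th component matters,
    even while the path is on another circle. *)
Lemma hat_occ i x : hat (occR i) x =
  occR i (D x) + A i x / 4 * (occR i (arm i x :: D x) - occR i (D x)).
Proof.
have [hi|hi] := pselect (A i x = 0); last exact: hat_index.
have [[j [hj ->]]|[_ ->]] := hat_cases (occR i) x; rewrite hi; last lra.
have [ji|/eqP ji] := pselect (j = i); first by case: hj; rewrite ji.
have := occ_cons i (arm j x) (D x); rewrite /= (negbTE ji) /occR => ->; lra.
Qed.

(** A 1-Lipschitz function on the vertices of the Cayley tree. *)
Definition word_lip (chi : seq letter -> R) : Prop :=
  (forall u v, eqw u v -> chi u = chi v) /\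
  (forall a u, Rabs (chi (a :: u) - chi u) <= 1).

Lemma word_lip_occ i : word_lip (occR i).
Proof.
split=> [u v /occ_freered h|a u]; first by rewrite /occR (h i).
rewrite /occR; have := occ_cons i a u; case: ifP => _; last first.
  by move=> ->; rewrite Rminus_diag Rabs_R0; lra.
by case=> ->; rewrite S_INR; apply: Rabs_le; lra.
Qed.

(** On one side of the opposite point the edge is fixed and [hat] is linear in [A i]. Across it the
    two ends of the edge are exchanged, but then both points satisfy [2 - A i <= e], hence are close
    to the midpoint. *)
Lemma hat_far chi i e s t : word_lip chi -> contI (B i) ->
  0 < e <= 1 / 2 -> unitI s -> unitI t -> s <= t ->
  (forall r, s <= r <= t -> e < A i r) ->
  Rabs (A i s - A i t) < e -> Rabs (B i s - B i t) < e ->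
  Rabs (hat chi s - hat chi t) <= e.
Proof.
move=> [chiE chi1] Bc e0 Is It st hA hAst hBst.
have hs : e < A i s by apply: hA; lra.
have ht : e < A i t by apply: hA; lra.
rewrite !(hat_index chi i); [|lra|lra].
have E : eqw (D s) (side_cross B i s t ++ D t).
  by apply: developing_far hA => //; lra.
move: E; rewrite /side_cross; case: eqP => [hB|/eqP hB] /= E.
  have Ea : arm i s = arm i t by rewrite /arm hB.
  rewrite (chiE _ _ E) (chiE (arm i s :: D s) (arm i t :: D t)); last first.
    by rewrite Ea; exact: (eqw_catr [:: _] _ _ E).
  have := chi1 (arm i t) (D t); set C := chi (_ :: _) - _ => hC.
  have -> : chi (D t) + A i s / 4 * C - (chi (D t) + A i t / 4 * C) =
    (A i s - A i t) * C / 4 by field.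
  have [h1 h2] := Rabs_def2 _ _ hAst.
  have [h3 h4] := Rabs_bounds _ _ hC.
  by apply: Rabs_le; nra.
have Ea : arm i s = linv (i, isneg (B i t)).
  by rewrite /arm /linv /=; move: hB; case: isneg; case: isneg.
have Eb : arm i t = (i, isneg (B i t)) by [].
have E1 : chi (arm i s :: D s) = chi (D t).
  apply: chiE; rewrite Ea; apply: eq_trans (freered_linv (i, isneg (B i t)) _).
  exact: (eqw_catr [:: _] _ _ E).
have E2 : chi (arm i t :: D t) = chi (D s) by rewrite Eb; apply/esym/chiE.
have hC : Rabs (chi (D s) - chi (D t)) <= 1 by rewrite -E2; exact: chi1.
rewrite E1 E2.
have -> : chi (D s) + A i s / 4 * (chi (D t) - chi (D s)) -
   (chi (D t) + A i t / 4 * (chi (D s) - chi (D t))) =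
   (chi (D s) - chi (D t)) * ((2 - A i s) / 4 + (2 - A i t) / 4) by field.
have h3 := isneg_neq _ _ hB.
have h4 : Rabs (B i t) <= Rabs (B i s - B i t).
  by rewrite Rabs_minus_sym; apply: isneg_neq; rewrite eq_sym.
have [/Rabs_def2[? ?] /Rabs_def2[? ?]] :
  Rabs (B i s) < e /\ Rabs (B i t) < e by split; lra.
have c1 := wAB.1 i s; have c2 := wAB.1 i t.
have r1 := wedge_range A B wAB i s; have r2 := wedge_range A B wAB i t.
have aux a b : (a - 1) ^ 2 + b ^ 2 = 1 -> e < a -> a <= 2 -> - e < b -> b < e ->
  2 - a <= e.
  move=> c ea a2 b1 b2.
  have bb : b ^ 2 <= e ^ 2 by nra.
  have a1 : 1 <= a by apply: Rnot_lt_le => a1; nra.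
  nra.
have s1 : 2 - A i s <= e by apply: (aux _ (B i s)); lra.
have s2 : 2 - A i t <= e by apply: (aux _ (B i t)); lra.
rewrite Rabs_mult (Rabs_pos_eq ((2 - A i s) / 4 + (2 - A i t) / 4)); last lra.
have := Rabs_pos (chi (D s) - chi (D t)); nra.
Qed.

Lemma hat_near chi i e s t : word_lip chi -> 0 <= A i s <= e -> 0 <= A i t <= e ->
  chi (D s) = chi (D t) ->
  Rabs (A i s / 4 * (chi (arm i s :: D s) - chi (D s)) -
        A i t / 4 * (chi (arm i t :: D t) - chi (D t))) <= e.
Proof.
move=> [_ chi1] hs ht E.
have [h1 h2] := Rabs_bounds _ _ (chi1 (arm i s) (D s)).
have [h3 h4] := Rabs_bounds _ _ (chi1 (arm i t) (D t)).
by apply: Rabs_le; nra.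
Qed.

(* The modulus depends neither on [D] nor on the other components: this makes
   the heights at all levels equicontinuous. *)
Lemma hat_occ_modulus i e d s t : contI (B i) -> 0 < e <= 1 / 2 ->
  unif1 A B i e d -> unitI s -> unitI t -> Rabs (s - t) < d ->
  Rabs (hat (occR i) s - hat (occR i) t) <= 2 * e.
Proof.
move=> Bc e0 U.
wlog st : s t / s <= t.
  move=> W Is It st; have [?|?] := Rle_lt_dec s t; first exact: W.
  by rewrite Rabs_minus_sym; apply: W => //; [lra|rewrite Rabs_minus_sym].
move=> Is It std.
have Ir r : s <= r <= t -> unitI r by move: Is It; rewrite /unitI /=; lra.
have [h|h] := pselect (forall r, s <= r <= t -> e < A i r).
  have [h1 h2] := U _ _ Is It std.
  by have := hat_far (occR i) i e s t (word_lip_occ i) Bc e0 Is It st h h1 h2; lra.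
have [r0 [hr0 hA0]] : exists r, s <= r <= t /\ A i r <= e.
  apply: contrapT => hn; apply: h => r hr; apply: Rnot_le_lt => hh.
  by apply: hn; exists r.
have hA r : s <= r <= t -> A i r <= 2 * e.
  move=> hr; have [|hh _] := U r r0 (Ir _ hr) (Ir _ hr0).
    by move: std; rewrite Rabs_minus_sym Rabs_pos_eq; [|lra] => ?;
       apply: Rabs_def1; lra.
  by have [] := Rabs_def2 _ _ hh; lra.
have [u [hu E]] : exists u, all (fun a : letter => a.1 != i) u /\ eqw (D s) (u ++ D t).
  by apply: (developing_notin _ _ _ wAB dev) => // r hr; have := hA r hr; lra.
have E' : occR i (D s) = occR i (D t).
  by rewrite /occR (occ_freered i _ _ E) occ_cat_notin.
rewrite !hat_occ.
have := hat_near (occR i) i (2 * e) s t (word_lip_occ i) _ _ E'.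
set X := A i s / 4 * _; set Y := A i t / 4 * _ => H.
have -> : occR i (D s) + X - (occR i (D t) + Y) = X - Y by rewrite E'; ring.
have r1 := wedge_range A B wAB i s; have r2 := wedge_range A B wAB i t.
by apply: H; split; try lra; apply: hA; lra.
Qed.

(** A general [chi] sees every component, unlike a counting function. With a modulus common to all
    of them, either the path stays on one arm or all components stay small together and the class of
    [D] is the same at both ends. *)
Lemma hat_cont chi : word_lip chi -> (forall i, contI (B i)) ->
  (forall e, 0 < e -> exists d, 0 < d /\ forall i, unif1 A B i e d) ->
  contI (hat chi).
Proof.
move=> lip Bc UU x Ix e' e'0.
pose e := Rmin (1 / 2) (e' / 3).
have e0 : 0 < e <= 1 / 2.
  by split; [apply: Rmin_pos; lra | exact: Rmin_l].
have ee' : e <= e' / 3 by exact: Rmin_r.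
have [|d [d0 U]] := UU e; first lra.
exists d; split => // y Iy xy.
suff: Rabs (hat chi x - hat chi y) <= 2 * e by lra.
move: x y Ix Iy xy => s t.
wlog st : s t / s <= t.
  move=> W Is It st; have [?|?] := Rle_lt_dec s t; first exact: W.
  by rewrite Rabs_minus_sym; apply: W => //; [lra|rewrite Rabs_minus_sym].
move=> Is It std.
have Ir r : s <= r <= t -> unitI r by move: Is It; rewrite /unitI /=; lra.
have [[i h]|h] := pselect (exists i, forall r, s <= r <= t -> e < A i r).
  have [h1 h2] := U i _ _ Is It std.
  by have := hat_far chi i e s t lip (Bc i) e0 Is It st h h1 h2; lra.
have hA i r : s <= r <= t -> A i r <= 2 * e.
  move=> hr.
  have [r0 [hr0 hA0]] : exists r, s <= r <= t /\ A i r <= e.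
    apply: contrapT => hn; apply: h; exists i => r' hr'; apply: Rnot_le_lt => hh.
    by apply: hn; exists r'.
  have [|hh _] := U i r r0 (Ir _ hr) (Ir _ hr0).
    by move: std; rewrite Rabs_minus_sym Rabs_pos_eq; [|lra] => ?;
       apply: Rabs_def1; lra.
  by have [] := Rabs_def2 _ _ hh; lra.
have E : chi (D s) = chi (D t).
  apply: lip.1; apply: (developing_const _ _ _ wAB dev) => // i r hr.
  by have := hA i r hr; lra.
have bnd r : s <= r <= t -> Rabs (hat chi r - chi (D r)) <= e / 2.
  move=> hr; have [[i [_ ->]]|[_ ->]] := hat_cases chi r; last first.
    by rewrite Rminus_diag Rabs_R0; lra.
  have := lip.2 (arm i r) (D r); set C := _ - _ => hC.
  have -> : chi (D r) + A i r / 4 * C - chi (D r) = A i r / 4 * C by ring.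
  have := hA i r hr; have := wedge_range A B wAB i r => r1 r2.
  rewrite Rabs_mult Rabs_pos_eq; last lra.
  by have := Rabs_pos C; nra.
have hs : s <= s <= t by lra.
have ht : s <= t <= t by lra.
have [a1 a2] := Rabs_bounds _ _ (bnd s hs); have [a3 a4] := Rabs_bounds _ _ (bnd t ht).
by apply: Rabs_le; lra.
Qed.

(** This yields the bounds [M_i] of canonical sequences. Going backwards from the end, where the
    count is 0, each piece of length at most [1 / m] adds at most one; [m] depends only on the
    modulus of the [i]-th component. *)
Lemma occ_bound i d (m : nat) : contI (B i) -> unif1 A B i (1 / 4) d ->
  0 < INR m -> 1 / INR m < d -> eqw (D 1) [::] ->
  forall s, unitI s -> (occ i (D s) <= m)%N.
Proof.
move=> Bc U m0 hm D1.
have step s t : unitI s -> unitI t -> s <= t -> t - s < d ->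
    (occ i (D s) <= (occ i (D t)).+1)%N.
  move=> Is It st std.
  have Ir r : s <= r <= t -> unitI r by move: Is It; rewrite /unitI /=; lra.
  have [h|h] := pselect (forall r, s <= r <= t -> 1 / 4 < A i r).
    have E : eqw (D s) (side_cross B i s t ++ D t).
      by apply: developing_far h => //; lra.
    rewrite (occ_freered i _ _ E); apply: leq_trans (occ_cat_le _ _ _) _.
    by rewrite -add1n leq_add2r /side_cross; case: ifP.
  have [r0 [hr0 hA0]] : exists r, s <= r <= t /\ A i r <= 1 / 4.
    apply: contrapT => hn; apply: h => r hr; apply: Rnot_le_lt => hh.
    by apply: hn; exists r.
  have [u [hu E]] : exists u, all (fun a : letter => a.1 != i) u /\ eqw (D s) (u ++ D t).
    apply: (developing_notin _ _ _ wAB dev) => // r hr.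
    have [|hh _] := U r r0 (Ir _ hr) (Ir _ hr0); first by apply: Rabs_def1; lra.
    by have [] := Rabs_def2 _ _ hh; lra.
  by rewrite (occ_freered i _ _ E) occ_cat_notin.
have im0 : 0 < 1 / INR m by apply: Rdiv_lt_0_compat; lra.
have H : forall k, forall s, unitI s -> 1 - INR k * (1 / INR m) <= s -> (occ i (D s) <= k)%N.
  elim=> [|k IH] s Is hs.
    have -> : s = 1 by move: Is hs; rewrite /unitI /=; lra.
    by rewrite (occ_freered i _ _ D1).
  pose t := Rmin 1 (s + 1 / INR m).
  have ht : t <= 1 /\ s <= t /\ t <= s + 1 / INR m /\ 1 - INR k * (1 / INR m) <= t.
    move: Is hs; rewrite /unitI /= -/(INR k.+1) S_INR /t; have := pos_INR k.
    by rewrite /Rmin; case: Rle_dec => ? *; repeat split; nra.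
  have It : unitI t by move: Is; rewrite /unitI /=; lra.
  apply: leq_trans (step s t Is It _ _) _; [lra|lra|].
  by rewrite ltnS; apply: IH => //; lra.
move=> s Is; apply: H => //.
have -> : INR m * (1 / INR m) = 1 by field; lra.
by move: Is; rewrite /unitI /=; lra.
Qed.

End HatDef.
End Hat.

(** * Barriers in the weighted Cayley tree *)

Section Barrier.
Local Open Scope R_scope.

Definition between (r s t : R) : Prop := s <= r <= t \/ t <= r <= s.

Lemma contI_gap f c s t : contI f -> 0 < c -> unitI s -> unitI t ->
  c <= f s -> f t < c -> exists r, between r s t /\ 0 < f r < c.
Proof.
move=> fc c0 Is It hs ht; apply: contrapT => hn.
have hr r : between r s t -> f r <= 0 \/ c <= f r.
  move=> hr; have [?|?] := Rle_lt_dec (f r) 0; first by left.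
  have [?|?] := Rle_lt_dec c (f r); first by right.
  by case: hn; exists r.
have [d [d0 hd]] := contI_unif f fc c c0.
have [st|st] := Rle_lt_dec s t.
  suff : c <= f s -> c <= f t by lra.
  apply: (chain (fun s t => c <= f s -> c <= f t)) => //; first by move=> ? ? ?; auto.
  exists d; split => // r r' h h' rr' hrr' hc.
  have Ir : unitI r by move: Is It; rewrite /unitI /=; lra.
  have Ir' : unitI r' by move: Is It; rewrite /unitI /=; lra.
  have [|h1 h2] := Rabs_def2 _ _ (hd r r' Ir Ir' _); first by apply: Rabs_def1; lra.
  by case: (hr r'); [left|lra|].
suff : c <= f s -> c <= f t by lra.
apply: (chain (fun s t => c <= f t -> c <= f s)) => //; [by move=> ? ? ?; auto|lra|].
exists d; split => // r r' h h' rr' hrr' hc.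
have Ir : unitI r by move: Is It; rewrite /unitI /=; lra.
have Ir' : unitI r' by move: Is It; rewrite /unitI /=; lra.
have [|h1 h2] := Rabs_def2 _ _ (hd r r' Ir Ir' _); first by apply: Rabs_def1; lra.
by case: (hr r); [right|lra|].
Qed.

Section SuffixIndicator.
Variables (b : letter) (lo : seq letter).

(** Words grow on the left, so for a reduced [b :: lo] this is the indicator of the branch of the
    Cayley tree beyond the edge from [lo] to [b :: lo]. *)
Definition sfx (u : seq letter) : R := if suffix (b :: lo) (freered u) then 1 else 0.

Lemma sfx01 u : sfx u = 0 \/ sfx u = 1.
Proof. by rewrite /sfx; case: ifP; [right|left]. Qed.

(** In a tree a branch is entered or left only through its root edge. *)
Lemma sfx_edge c u :
  sfx u = sfx (c :: u) \/
  [/\ sfx u = 0, sfx (c :: u) = 1, freered u = lo, freered (c :: u) = b :: lo & c = b] \/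
  [/\ sfx u = 1, sfx (c :: u) = 0, freered u = b :: lo, freered (c :: u) = lo & linv c = b].
Proof.
have E r x : suffix (b :: lo) (x :: r) = (x :: r == b :: lo) || suffix (b :: lo) r.
  apply/suffixP/orP.
    case=> -[|y p] /=; first by move=> ->; left.
    by case=> _ ->; right; apply/suffixP; exists p.
  case=> [/eqP->|/suffixP[p ->]]; first by exists [::].
  by exists (x :: p).
have nself r x : suffix (b :: lo) r -> (x :: r == b :: lo) = false.
  move=> /suffixP[p ->]; apply/eqP => -[_ /(congr1 size)].
  by rewrite size_cat /= -{2}[size lo]add0n => /eqP; rewrite addnS -addSn eqn_add2r.
rewrite /sfx freered_cons; have [->|] := step_cases c (freered u).
  rewrite E; case: (suffix _ (freered u)); first by left; rewrite orbT.
  rewrite orbF; case: eqP => [[-> ->]|_]; last by left.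
  by right; left.
set r' := step c _ => ->; rewrite E; case: (suffix _ r').
  by rewrite orbT; left.
rewrite orbF; case: eqP => [[-> ->]|_]; last by left.
by right; right.
Qed.

Lemma word_lip_sfx : word_lip sfx.
Proof.
split=> [u v E|a u]; first by rewrite /sfx E.
by apply: Rabs_le; case: (sfx01 u) => ->; case: (sfx01 (a :: u)) => ->; lra.
Qed.

End SuffixIndicator.

Section Heights.
Variables (ell : nat -> R) (n : nat).
Hypothesis ell0 : forall i, 0 < ell i.

(** Distance to the root of the Cayley tree in which the edges labelled [x_i] have length
    [ell i]. *)
Definition wlen (r : seq letter) : R :=
  sum_f_R0 (fun i => ell i * INR (count (fun a : letter => a.1 == i) r)) n.

Lemma wlen_cat_ge p r : wlen r <= wlen (p ++ r).
Proof.
rewrite /wlen; apply: sum_Rle => i _; apply: Rmult_le_compat_l.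
  exact/Rlt_le.
by apply/le_INR/leP; rewrite count_cat leq_addl.
Qed.

Lemma wlen_cons b r : (b.1 <= n)%N -> wlen (b :: r) = wlen r + ell b.1.
Proof.
have cE i : INR (count (fun a : letter => a.1 == i) (b :: r)) =
    (if b.1 == i then 1 else 0) + INR (count (fun a : letter => a.1 == i) r).
  by rewrite [count _ (b :: r)]/= plus_INR; case: eqP.
have H m : sum_f_R0 (fun i => ell i * INR (count (fun a : letter => a.1 == i) (b :: r))) m
   = sum_f_R0 (fun i => ell i * INR (count (fun a : letter => a.1 == i) r)) m
     + (if (b.1 <= m)%N then ell b.1 else 0).
  elim: m => [|m IH].
    by rewrite /sum_f_R0 cE leqn0; case: eqP => [->|_]; lra.
  rewrite !tech5 IH cE (leq_eqVlt b.1 m.+1) ltnS.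
  by case: eqP => [->|_] /=; rewrite ?ltnn; lra.
by rewrite /wlen H => ->.
Qed.

Variables (A B : nat -> R -> R) (D : R -> seq letter).
Hypotheses (wAB : wedge A B) (dev : developing A B D).

Definition height (s : R) : R :=
  sum_f_R0 (fun i => ell i * hat A B D (occR i) s) n.

Lemma height_index j x : A j x <> 0 ->
  height x = wlen (freered (D x)) +
    A j x / 4 * (wlen (freered (arm B j x :: D x)) - wlen (freered (D x))).
Proof.
move=> hj; rewrite /height /wlen.
elim: n => [|m IH].
  by rewrite /sum_f_R0 (hat_index _ _ _ wAB _ j) // /occR /occ; ring.
by rewrite !tech5 IH (hat_index _ _ _ wAB _ j) // /occR /occ; ring.
Qed.

Lemma height_zero x : (forall j, A j x = 0) -> height x = wlen (freered (D x)).
Proof.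
move=> h; rewrite /height /wlen; apply: PartSum.sum_eq => i _.
rewrite (hat_occ _ _ _ wAB) h /occR /occ; lra.
Qed.

(** A coordinate on the [i]-th circle increasing from 0 to 1 in the direction of [x_i]; unlike [A],
    it separates all points other than the base point. *)
Definition upos (i : nat) (x : R) : R :=
  if isneg (B i x) then 1 - A i x / 4 else A i x / 4.

Lemma height_edge b lo x : (b.1 <= n)%N ->
  let c := hat A B D (sfx b lo) x in
  [\/ c = 0, c = 1 /\ wlen (b :: lo) <= height x |
      [/\ A b.1 x <> 0, c = (if b.2 then 1 - upos b.1 x else upos b.1 x) &
         height x = wlen lo + c * ell b.1]].
Proof.
move=> bn c.
have ge u : sfx b lo u = 1 -> wlen (b :: lo) <= wlen (freered u).
  by rewrite /sfx; case: ifP => [/suffixP[p ->] _|_ ?]; [exact: wlen_cat_ge|lra].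
have [[j [hj E]]|[h E]] := hat_cases _ _ D wAB (sfx b lo) x; last first.
  rewrite height_zero //; case: (sfx01 b lo (D x)) => hs.
    by constructor 1; rewrite /c E.
  by constructor 2; rewrite /c E; split => //; exact: ge.
have := wedge_range _ _ wAB j x => rg.
rewrite (height_index _ _ hj).
case: (sfx_edge b lo (arm B j x) (D x)) => [Es|[[s0 s1 -> -> ab]|[s0 s1 -> -> ab]]].
- have Ec : c = sfx b lo (D x) by rewrite /c E -Es; lra.
  case: (sfx01 b lo (D x)) => hs; first by constructor 1; rewrite Ec.
  constructor 2; rewrite Ec; split => //.
  have g1 := ge _ hs; have g2 := ge (arm B j x :: D x).
  move: g2; rewrite -Es => /(_ hs) g2; nra.
- have jb : j = b.1 by rewrite -ab.
  have nb : isneg (B j x) = b.2 by rewrite -ab.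
  constructor 3; rewrite -jb; split => //.
    by rewrite /c E s0 s1 /upos nb; case: (b.2); lra.
  by rewrite wlen_cons // -jb /c E s0 s1; lra.
- have jb : j = b.1 by rewrite -ab.
  have nb : ~~ isneg (B j x) = b.2 by rewrite -ab.
  constructor 3; rewrite -jb; split => //.
    by rewrite /c E s0 s1 /upos -nb; case: isneg => /=; lra.
  by rewrite wlen_cons // -jb /c E s0 s1; lra.
Qed.

Lemma upos_inj i s t : 0 < A i s -> 0 < A i t -> upos i s = upos i t ->
  A i s = A i t /\ B i s = B i t.
Proof.
have := wedge_range _ _ wAB i s; have := wedge_range _ _ wAB i t.
have := wAB.1 i s; have := wAB.1 i t.
rewrite /upos; case: isnegP => h1; case: isnegP => h2 c1 c2 r1 r2 a1 a2 E.
- have EA : A i s = A i t by lra.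
  by split => //; rewrite EA in c2; nra.
- have EA : A i s = 2 by lra.
  by rewrite EA in c2; nra.
- have EA : A i t = 2 by lra.
  by rewrite EA in c1; nra.
- have EA : A i s = A i t by lra.
  by split => //; rewrite EA in c2; nra.
Qed.

(** The edge carrying the lift of [s] is a barrier: to reach the root side the path must come down
    along it. The branch beyond is higher, and on the edge the heights differ by the distance. *)
Lemma height_barrier i s t delta : (i <= n)%N -> unitI s -> unitI t ->
  (forall j, contI (B j)) ->
  (forall e, 0 < e -> exists d, 0 < d /\ forall j, unif1 A B j e d) ->
  0 < A i s ->
  delta <= ell i * (A i s / 8) ->
  (0 < A i t -> delta <= ell i * Rabs (upos i s - upos i t)) ->
  delta <= Rabs (height s - height t) \/
  exists r, between r s t /\ height r <= height s - delta.
Proof.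
move=> iin Is It Bc UU As d1 d2.
have [b [lo [bi cs01]]] : exists b lo, b.1 = i /\
    0 < hat A B D (sfx b lo) s < 1.
  have rg := wedge_range _ _ wAB i s.
  pose a := arm B i s.
  have nsuf (x : letter) r : suffix (x :: r) r = false.
    by apply/negP => /size_suffix; rewrite ltnn.
  have [E|E] := step_cases a (freered (D s)).
    exists a, (freered (D s)); split => //.
    rewrite (hat_index _ _ _ wAB _ i); last lra.
    rewrite /sfx -/a freered_cons E nsuf suffix_refl; lra.
  exists (linv a), (step a (freered (D s))); split => //.
  rewrite (hat_index _ _ _ wAB _ i); last lra.
  rewrite /sfx -/a freered_cons; move: E; move: (step a _) => r' ->.
  by rewrite nsuf suffix_refl; lra.
have bn : (b.1 <= n)%N by rewrite bi.
set c := hat A B D (sfx b lo) s in cs01.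
have rg := wedge_range _ _ wAB i s.
have li := ell0 i.
have [||[_ cs hs]] := height_edge b lo s bn; rewrite -/c; [lra|lra|].
rewrite -/c bi in cs hs.
have cw : A i s / 4 <= c /\ A i s / 4 <= 1 - c.
  by rewrite cs /upos; case: (b.2); case: isneg; lra.
have [ct|[ct ht]|[At ct ht]] := height_edge b lo t bn.
- right.
  (* A value strictly between 0 and [c / 2] is taken on the same edge, at a height lower by at least
     [c / 2] of its length; as [c >= A i s / 4], this is where the 8 comes from. *)
  have [|||||r [rst hr]] := contI_gap _ (c / 2) s t
      (hat_cont _ _ _ wAB dev _ (word_lip_sfx b lo) Bc UU); [lra|done|done|rewrite -/c; lra|lra|].
  exists r; split => //.
  have [|[]|[_ _ ->]] := height_edge b lo r bn; [lra|lra|].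
  by rewrite bi hs; nra.
- left; rewrite wlen_cons // bi in ht.
  rewrite Rabs_minus_sym; apply: Rle_trans (Rle_abs _); nra.
- left; rewrite bi in At ct ht.
  have At0 : 0 < A i t.
    have [h0 _] := wedge_range _ _ wAB i t.
    by case: (Rle_lt_or_eq_dec _ _ h0) => // h; case: At.
  move: (d2 At0); rewrite hs ht.
  have -> : wlen lo + c * ell i - (wlen lo + hat A B D (sfx b lo) t * ell i) =
    (c - hat A B D (sfx b lo) t) * ell i by ring.
  rewrite Rabs_mult (Rabs_pos_eq (ell i)); last lra.
  rewrite ct cs; case: (b.2); last lra.
  have -> : 1 - upos i s - (1 - upos i t) = - (upos i s - upos i t) by ring.
  rewrite Rabs_Ropp; lra.
Qed.

End Heights.
End Barrier.

(** * Contraction along a tree *)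

Section TreeContraction.
Local Open Scope R_scope.

(** [f] factors through the real tree coded by [h], where two times are identified when [h] takes at
    both of them its minimum over the interval between them. *)
Definition tree_compatible (h f : R -> R) : Prop :=
  forall s t, unitI s -> unitI t -> s <= t -> h s = h t ->
    (forall r, s <= r <= t -> h s <= h r) -> f s = f t.

(** Uniform continuity of the factored map for the tree distance. If [f] takes distant values at
    [u <= v], then [h] dips between them, and the dip persists for all nearby pairs. *)
Lemma tree_modulus h f : contI h -> contI f -> tree_compatible h f ->
  forall e, 0 < e -> exists d, 0 < d /\ forall u v, unitI u -> unitI v -> u <= v ->
    (forall r, u <= r <= v -> Rmax (h u) (h v) - d <= h r) -> Rabs (f u - f v) < e.
Proof.
move=> hc fc hf e e0.
have [||d [d0 hd]] := unitSq_cover (fun d x => x.1 <= x.2 ->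
  (forall r, x.1 <= r <= x.2 -> Rmax (h x.1) (h x.2) - d <= h r) ->
  Rabs (f x.1 - f x.2) < e).
- move=> d e' [u v] /= d0 de hx uv hr; apply: hx => // r /hr; lra.
- move=> [u v] [/= Iu Iv].
  have [huv|huv] := Rlt_le_dec (Rabs (f u - f v)) (e / 2).
    have [|d [d0 hd]] := contI_unif f fc (e / 4); first lra.
    exists d; split => // -[u' v'] [/= Iu' Iv'] [/= uu vv] _ _.
    have /Rabs_def2[? ?] := hd _ _ Iu Iu' uu; have /Rabs_def2[? ?] := hd _ _ Iv Iv' vv.
    by move: huv => /Rabs_def2[? ?]; apply: Rabs_def1; lra.
  have [uv|uv] := Rle_lt_dec u v; last first.
    exists ((u - v) / 2); split; first lra.
    by move=> [u' v'] _ [/= /Rabs_def2[? ?] /Rabs_def2[? ?]]; lra.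
  have [r [hr hg]] : exists r, u <= r <= v /\ h r < Rmax (h u) (h v).
    apply: contrapT => hn.
    have hge r : u <= r <= v -> Rmax (h u) (h v) <= h r.
      by move=> hr; apply: Rnot_lt_le => hh; apply: hn; exists r.
    have h1 := hge u; have h2 := hge v.
    have := Rmax_l (h u) (h v); have := Rmax_r (h u) (h v) => h3 h4.
    have E : f u = f v.
      apply: hf => //; first lra.
      move=> r hr; have := hge r hr; lra.
    by move: huv; rewrite E Rminus_diag Rabs_R0; lra.
  pose g := Rmax (h u) (h v) - h r.
  have g0 : 0 < g by rewrite /g; lra.
  have [|d [d0 hd]] := contI_unif h hc (g / 4); first lra.
  exists (Rmin d (g / 4)); split; first by apply: Rmin_pos; lra.
  move=> [u' v'] [/= Iu' Iv'] [/= uu vv] uv'.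
  have uu' := Rlt_le_trans _ _ _ uu (Rmin_l _ _).
  have vv' := Rlt_le_trans _ _ _ vv (Rmin_l _ _).
  (* The bottom of the dip, clamped to the perturbed interval; this moves it by less than [d]. *)
  pose r' := Rmax u' (Rmin r v').
  have r'b : u' <= r' <= v'.
    by rewrite /r' /Rmax /Rmin; case: Rle_dec; case: Rle_dec; lra.
  move=> /(_ _ r'b); have := Rmin_r d (g / 4).
  have Ir : unitI r by move: Iu Iv; rewrite /unitI /=; lra.
  have Ir' : unitI r' by move: Iu' Iv'; rewrite /unitI /=; lra.
  have rr : Rabs (r - r') < d.
    move: uu' vv' => /Rabs_def2[? ?] /Rabs_def2[? ?].
    by rewrite /r' /Rmax /Rmin; case: Rle_dec; case: Rle_dec => *; apply: Rabs_def1; lra.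
  have /Rabs_def2[? ?] := hd _ _ Ir Ir' rr.
  have /Rabs_def2[? ?] := hd _ _ Iu Iu' uu'.
  have /Rabs_def2[? ?] := hd _ _ Iv Iv' vv'.
  have : Rmax (h u) (h v) - g / 4 < Rmax (h u') (h v').
    by rewrite /Rmax; case: Rle_dec; case: Rle_dec; lra.
  by have gE : g = Rmax (h u) (h v) - h r; [|lra].
- exists d; split=> // u v Iu Iv uv hr.
  exact: (hd (u, v)).
Qed.

Lemma contI_bounded h : contI h -> exists M, 0 < M /\ forall s, unitI s -> h s <= M.
Proof.
move=> hc; have [||d [d0 hd]] := unitI_cover (fun d s => h s <= 1 / d).
- move=> d e s d0 de hs; apply: Rle_trans hs _.
  by rewrite /Rdiv !Rmult_1_l; apply: Rinv_le_contravar.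
- move=> s Is; have [|d [d0 hd]] := hc s Is 1; first lra.
  pose m := Rabs (h s) + 1.
  have m0 : 0 < m by rewrite /m; have := Rabs_pos (h s); lra.
  exists (Rmin d (1 / m)); split.
    by apply: Rmin_pos => //; apply: Rdiv_lt_0_compat; lra.
  move=> t It st.
  have /Rabs_def2[? ?] := hd _ It (Rlt_le_trans _ _ _ st (Rmin_l _ _)).
  have hm : h t <= m by rewrite /m; have := Rle_abs (h s); lra.
  apply: Rle_trans hm _.
  have {1}-> : m = 1 / (1 / m) by field; lra.
  have m1 : 0 < 1 / m by apply: Rdiv_lt_0_compat; lra.
  have := Rinv_le_contravar (Rmin d (1 / m)) (1 / m) (Rmin_pos _ _ d0 m1) (Rmin_r _ _).
  by rewrite /Rdiv; lra.
exists (1 / d); split => //; apply: Rdiv_lt_0_compat; lra.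
Qed.

(** In the coded tree [u] represents the ancestor of [s] at height [tau], or [s] itself if it is not
    higher. *)
Lemma last_below h s tau : contI h -> unitI s -> h 0 <= tau ->
  exists u, [/\ 0 <= u <= s, h u = Rmin (h s) tau & forall v, u < v <= s -> tau < h v].
Proof.
move=> hc Is h0.
pose E u := 0 <= u <= s /\ h u <= tau.
have [||u [ub lub]] := completeness E.
- by exists s => u [[? ?] _].
- by exists 0; split=> //; move: Is; rewrite /unitI /=; lra.
have u0 : 0 <= u by apply: ub; split => //; move: Is; rewrite /unitI /=; lra.
have us : u <= s by apply: lub => v [[? ?] _].
have Iu : unitI u by move: Is; rewrite /unitI /=; lra.
have above v : u < v <= s -> tau < h v.
  move=> [uv vs]; apply: Rnot_le_lt => hv.
  have : v <= u by apply: ub; split => //; lra.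
  lra.
have hu : h u <= tau.
  apply: Rnot_lt_le => hu; have [|d [d0 hd]] := hc u Iu (h u - tau); first lra.
  have : u <= u - d; last lra.
  apply: lub => v [vs hv]; apply: Rnot_lt_le => dv.
  have vu : v <= u by apply: ub.
  have Iv : unitI v by move: Is; rewrite /unitI /=; lra.
  by have [|? ?] := Rabs_def2 _ _ (hd v Iv _); [apply: Rabs_def1|]; lra.
exists u; split => //.
have [us'|us'] := Rle_lt_or_eq_dec _ _ us; last first.
  by rewrite -us' Rmin_left.
rewrite Rmin_right; last by apply/Rlt_le/above; lra.
apply: Rle_antisym => //; apply: Rnot_lt_le => hu'.
have [|d [d0 hd]] := hc u Iu (tau - h u); first lra.
pose v := Rmin s (u + d / 2).
have hv : u < v <= s /\ v <= u + d / 2.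
  by rewrite /v /Rmin; case: Rle_dec; lra.
have Iv : unitI v by move: Is; rewrite /unitI /=; lra.
have := above v (proj1 hv).
by have [|? ?] := Rabs_def2 _ _ (hd v Iv _); [apply: Rabs_def1|]; lra.
Qed.

(* Contraction of the tree coded by the excursion [h]: at time [t] the point
   coded by [s] has moved to its ancestor at height at most [M (1 - t)]. *)
Lemma tree_contraction h : contI h -> (forall s, unitI s -> 0 <= h s) ->
  h 0 = 0 -> h 1 = 0 ->
  exists sigma : R * R -> R,
    (forall x, unitSq x -> unitI (sigma x)) /\
    forall f, contI f -> tree_compatible h f ->
      conton unitSq (fun x => f (sigma x)) /\
      (forall s, unitI s -> f (sigma (s, 0)) = f s /\ f (sigma (s, 1)) = f 0) /\
      (forall t, unitI t -> f (sigma (0, t)) = f 0 /\ f (sigma (1, t)) = f 0).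
Proof.
move=> hc hpos h0 h1.
have [M [M0 hM]] := contI_bounded h hc.
have I0 : unitI 0 by rewrite /unitI /=; lra.
have I1 : unitI 1 by rewrite /unitI /=; lra.
pose tau (t : R) := M * (1 - t).
have tau0 t : unitI t -> 0 <= tau t by rewrite /unitI /= /tau => ?; nra.
have /choice[sigma hs] : forall x : R * R, exists u, unitSq x ->
    [/\ 0 <= u <= x.1, h u = Rmin (h x.1) (tau x.2) &
        forall v, u < v <= x.1 -> tau x.2 < h v].
  move=> x; have [[Is It]|h'] := pselect (unitSq x); last by exists 0 => /h'.
  have [|u hu] := last_below h x.1 (tau x.2) hc Is; last by exists u.
  by rewrite h0; exact: tau0.
have sI x : unitSq x -> unitI (sigma x).
  by move=> Sx; have [? _ _] := hs _ Sx; move: Sx.1; rewrite /unitI /=; lra.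
(* [sigma] may jump between times that code the same point of the tree; only its composites with
   compatible functions are continuous. It is chosen before [f], so that both coordinates of a loop
   share it. *)
exists sigma; split => // f fc hf.
have fbase u : unitI u -> h u = 0 -> f u = f 0.
  move=> Iu hu; apply/esym/hf => //; [by move: Iu; rewrite /unitI /=; lra|lra|].
  by move=> r hr; rewrite h0; apply: hpos; move: Iu; rewrite /unitI /=; lra.
split; last first.
  split.
    move=> s Is; have Is0 : unitSq (s, 0) by []; have Is1 : unitSq (s, 1) by [].
    split.
      have [/= hu E hab] := hs _ Is0; congr f.
      apply: Rle_antisym; first lra.
      apply: Rnot_lt_le => lt; have /= := hab s.
      by have := hM s Is; rewrite /tau; lra.
    have [hu E hab] := hs _ Is1; apply: fbase; first exact: sI.
    rewrite E /= /tau Rminus_diag Rmult_0_r Rmin_right //; exact: hpos.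
  move=> t It; have I0t : unitSq (0, t) by []; have I1t : unitSq (1, t) by [].
  split.
    by have [/= hu _ _] := hs _ I0t; congr f; lra.
  have [hu E hab] := hs _ I1t; apply: fbase; first exact: sI.
  by rewrite E /= h1 Rmin_left //; exact: tau0.
suff H e : 0 < e -> exists d, 0 < d /\ forall x y, unitSq x -> unitSq y -> near2 d x y ->
    Rabs (f (sigma x) - f (sigma y)) < e.
  move=> x Sx e e0; have [d [d0 hd]] := H e e0.
  by exists d; split => // y Sy; exact: hd.
move=> e0; have [eta [eta0 heta]] := tree_modulus h f hc fc hf e e0.
have [|dh [dh0 hdh]] := contI_unif h hc (eta / 2); first lra.
(* [tau] has Lipschitz constant [M], so this bound moves the cutting height by less than
   [eta / 2]. *)
have dM : 0 < eta / (2 * M) by apply: Rdiv_lt_0_compat; lra.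
exists (Rmin dh (eta / (2 * M))); split; first exact: Rmin_pos.
move=> x y; wlog xy : x y / x.1 <= y.1.
  move=> W Sx Sy nxy; have [?|?] := Rle_lt_dec x.1 y.1; first exact: W.
  by rewrite Rabs_minus_sym; apply: W => //; [lra|exact: near2_sym].
move=> Sx Sy [n1 n2].
have n1' := Rlt_le_trans _ _ _ n1 (Rmin_l _ _).
have n2' := Rlt_le_trans _ _ _ n2 (Rmin_r _ _).
have ht : Rabs (tau x.2 - tau y.2) < eta / 2.
  have -> : tau x.2 - tau y.2 = M * (- (x.2 - y.2)) by rewrite /tau; ring.
  rewrite Rabs_mult Rabs_Ropp (Rabs_pos_eq M); last lra.
  have -> : eta / 2 = M * (eta / (2 * M)) by field; lra.
  exact: Rmult_lt_compat_l.
have Iu := sI _ Sx; have Iu' := sI _ Sy.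
have [hu Eu au] := hs _ Sx; have [hu' Eu' au'] := hs _ Sy.
have tx := tau0 _ Sx.2; have ty := tau0 _ Sy.2.
set u := sigma x in Iu hu Eu au *; set u' := sigma y in Iu' hu' Eu' au' *.
have /Rabs_def2[hs1 hs2] := hdh _ _ Sx.1 Sy.1 n1'.
move: ht => /Rabs_def2[ht1 ht2].
have du : h u - h u' < eta / 2 /\ h u' - h u < eta / 2.
  by rewrite Eu Eu' /Rmin; case: Rle_dec; case: Rle_dec; lra.
have uge r : u <= r <= x.1 -> h u <= h r.
  move=> [[ur|<-] rs]; last by lra.
  by have := au r (conj ur rs); have := Rmin_r (h x.1) (tau x.2); lra.
have uge' r : u' <= r <= y.1 -> h u' <= h r.
  move=> [[ur|<-] rs]; last by lra.
  by have := au' r (conj ur rs); have := Rmin_r (h y.1) (tau y.2); lra.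
have hux : h u <= h x.1 by apply: uge; lra.
(* Between the two ancestors [h] stays above [h u] up to time [x.1], and any later time is within
   [dh] of [x.1]. *)
have [uu|uu] := Rle_lt_dec u u'.
  apply: heta => // r hr.
  have [rx|rx] := Rle_lt_dec r x.1.
    by have := uge r; rewrite /Rmax; case: Rle_dec; lra.
  have Ir : unitI r by move: Iu Iu'; rewrite /unitI /=; lra.
  have [|? ?] := Rabs_def2 _ _ (hdh _ _ Sx.1 Ir _).
    by move: n1' => /Rabs_def2[? ?]; apply: Rabs_def1; lra.
  by rewrite /Rmax; case: Rle_dec; lra.
rewrite Rabs_minus_sym; apply: heta => //; first lra.
move=> r hr; have := uge' r; rewrite /Rmax; case: Rle_dec; lra.
Qed.

End TreeContraction.

(** * Limits of height functions along an ultrafilter *)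

Section UltraLimit.
Local Open Scope R_scope.

Lemma ultra_limit (U : set_system nat) (x : nat -> R) (M : R) :
  UltraFilter U -> (forall k, 0 <= x k <= M) ->
  exists l, 0 <= l <= M /\ forall e, 0 < e -> U [set k | Rabs (x k - l) < e].
Proof.
move=> UU hx; pose E c := U [set k | c <= x k].
have [||l [ub lub]] := completeness E.
- exists M => c Ec; have [k /= hk] := filter_ex Ec; have := hx k; lra.
- by exists 0; apply: filterS filterT => k _ /=; have := hx k; lra.
exists l; split.
  split; first by apply: ub; apply: filterS filterT => k _ /=; have := hx k; lra.
  by apply: lub => c Ec; have [k /= hk] := filter_ex Ec; have := hx k; lra.
move=> e e0.
have [c [Ec hc]] : exists c, E c /\ l - e < c.
  apply: contrapT => hn; have : l <= l - e; last lra.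
  apply: lub => c Ec; apply: Rnot_lt_le => hc; apply: hn; by exists c.
have hnE : ~ E (l + e / 2) by move=> /ub; lra.
have [//|hC] := in_ultra_setVsetC [set k | l + e / 2 <= x k] UU.
apply: filterS (filterI Ec hC) => k [/= h1 h2].
by apply: Rabs_def1; lra.
Qed.

(** Equicontinuity makes the pointwise ultralimit continuous. Separation survives because [delta] is
    the same for all [k]: the dips [r] vary with [k] but have an ultralimit, where equicontinuity
    controls the heights. [k0] allows for a separation visible only from some level on. *)
Lemma height_limit (h : nat -> R -> R) (M : R) :
  (forall k s, unitI s -> 0 <= h k s <= M) ->
  (forall e, 0 < e -> exists d, 0 < d /\ forall k s t, unitI s -> unitI t ->
     Rabs (s - t) < d -> Rabs (h k s - h k t) < e) ->
  exists H : R -> R,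
    [/\ contI H, (forall s, unitI s -> 0 <= H s),
        (forall s, unitI s -> (forall k, h k s = 0) -> H s = 0) &
        forall s t delta k0, unitI s -> unitI t -> 0 < delta ->
          (forall k, (k0 <= k)%N -> delta <= Rabs (h k s - h k t) \/
             exists r, between r s t /\ h k r <= h k s - delta) ->
          H s <> H t \/ exists r, between r s t /\ H r < H s].
Proof.
move=> hM equi.
have [U [UU hU]] := ultraFilterLemma eventually_filter.
have /choice[H hH] : forall s, exists l, unitI s ->
    0 <= l <= M /\ forall e, 0 < e -> U [set k | Rabs (h k s - l) < e].
  move=> s; have [Is|nI] := pselect (unitI s); last by exists 0 => /nI.
  by have [|l hl] := ultra_limit U (h^~ s) M UU; [move=> k; exact: hM | exists l].
exists H; split.
- move=> s Is e e0; have [|d [d0 hd]] := equi (e / 2); first lra.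
  exists d; split => // t It st.
  have e40 : 0 < e / 4 by lra.
  have [k [/= h1 h2]] := filter_ex (filterI (proj2 (hH s Is) _ e40) (proj2 (hH t It) _ e40)).
  have /Rabs_def2[? ?] := hd k _ _ Is It st.
  by move: h1 h2 => /Rabs_def2[? ?] /Rabs_def2[? ?]; apply: Rabs_def1; lra.
- by move=> s Is; have [[]] := hH s Is.
- move=> s Is h0; have [_ hl] := hH s Is.
  apply: contrapT => Hs; have p : 0 < Rabs (H s) by exact: Rabs_pos_lt.
  have [k /=] := filter_ex (hl _ p).
  by rewrite h0 Rminus_0_l Rabs_Ropp; lra.
move=> s t delta k0 Is It delta0 hk.
have [Hst|] := pselect (H s = H t); last by left.
right.
have Ib r : between r s t -> unitI r.
  by move: Is It; rewrite /unitI /= /between; lra.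
have /choice[r hr] : forall k, exists r, between r s t /\
    ((exists r, between r s t /\ h k r <= h k s - delta) -> h k r <= h k s - delta).
  move=> k; have [[r [h1 h2]]|hn] :=
    pselect (exists r, between r s t /\ h k r <= h k s - delta); first by exists r.
  exists s; split; first by rewrite /between; lra.
  by move=> /hn.
have rI k : 0 <= r k <= 1 by have /Ib := (hr k).1; rewrite /unitI.
have [l [lI hl]] := ultra_limit U r 1 UU rI.
have lb : between l s t.
  have lo e : 0 < e -> Rmin s t - e < l /\ l < Rmax s t + e.
    move=> e0; have [k /= /Rabs_def2[? ?]] := filter_ex (hl e e0).
    have := (hr k).1; rewrite /between /Rmin /Rmax.
    by case: Rle_dec => ? [|]; lra.
  have h1 : Rmin s t <= l.
    apply: Rnot_lt_le => hh; have [|? _] := lo (Rmin s t - l); lra.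
  have h2 : l <= Rmax s t.
    apply: Rnot_lt_le => hh; have [|_ ?] := lo (l - Rmax s t); lra.
  by move: h1 h2; rewrite /between /Rmin /Rmax; case: Rle_dec; lra.
exists l; split => //.
have d8 : 0 < delta / 8 by lra.
have [d [d0 hd]] := equi _ d8.
have k0U : U [set k | (k0 <= k)%N] by apply: hU; exists k0.
have [k [[[/= a1 a2] [/= a3 a4]] /= kk0]] := filter_ex (filterI (filterI
  (filterI (proj2 (hH s Is) _ d8) (proj2 (hH t It) _ d8))
  (filterI (proj2 (hH l (Ib _ lb)) _ d8) (hl _ d0))) k0U).
move: a1 a2 a3 => /Rabs_def2[? ?] /Rabs_def2[? ?] /Rabs_def2[? ?].
have /Rabs_def2[? ?] := hd k _ _ (Ib _ (hr k).1) lI a4.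
have [hh|/(hr k).2 hh] := hk k kk0; last lra.
have : Rabs (h k s - h k t) < delta by apply: Rabs_def1; lra.
lra.
Qed.

End UltraLimit.

(** * Shape injectivity of the Hawaiian earring *)

Section Excursion.
Local Open Scope R_scope.

Lemma finite_modulus (P : nat -> R -> Prop) (n : nat) :
  (forall i d e, 0 < d -> d <= e -> P i e -> P i d) ->
  (forall i, exists d, 0 < d /\ P i d) ->
  exists d, 0 < d /\ forall i, (i <= n)%N -> P i d.
Proof.
move=> Pm hP; elim: n => [|n [d [d0 hd]]].
  by have [d [d0 hd]] := hP 0%N; exists d; split => // i; rewrite leqn0 => /eqP->.
have [e [e0 he]] := hP n.+1.
have m0 := Rmin_pos _ _ d0 e0.
exists (Rmin d e); split => // i; rewrite leq_eqVlt => /orP[/eqP->|].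
  by apply: Pm he => //; exact: Rmin_r.
by rewrite ltnS => /hd; apply: Pm => //; exact: Rmin_l.
Qed.

Lemma half_pow_pos i : 0 < (1 / 2) ^ i.
Proof. by apply: pow_lt; lra. Qed.

Lemma half_pow_small e : 0 < e -> exists n : nat, (1 / 2) ^ n < e.
Proof.
move=> e0; have [|n hn] := pow_lt_1_zero (1 / 2) _ e e0.
  by rewrite Rabs_pos_eq; lra.
exists n; have := hn n (le_n n).
by rewrite Rabs_pos_eq //; exact/Rlt_le/half_pow_pos.
Qed.

Lemma geom_sum_le (x : nat -> R) n : (forall i, x i <= (1 / 2) ^ i) ->
  sum_f_R0 x n <= 2 - (1 / 2) ^ n.
Proof.
move=> hx; elim: n => [|n IH]; first by have := hx 0%N; rewrite /=; lra.
by rewrite tech5; have := hx n.+1; rewrite -tech_pow_Rmult; lra.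
Qed.

(** Finitely many terms are small by continuity, the tail by the geometric majorant; the bound does
    not involve the number of terms. *)
Lemma geom_sum_small (x : nat -> R) eta (m n : nat) : 0 <= eta ->
  (forall i, Rabs (x i) <= (1 / 2) ^ i) ->
  (forall i, (i <= m)%N -> Rabs (x i) <= (1 / 2) ^ i * eta) ->
  Rabs (sum_f_R0 x n) <= 2 * eta + (1 / 2) ^ m.
Proof.
move=> eta0 hx hm.
have low k : (k <= m)%N -> Rabs (sum_f_R0 x k) <= (2 - (1 / 2) ^ k) * eta.
  elim: k => [|k IH] km; first by have := hm 0%N km; rewrite /=; lra.
  rewrite tech5; apply: Rle_trans (Rabs_triang _ _) _.
  have := hm _ km; have := IH (ltnW km); rewrite -tech_pow_Rmult; lra.
have high k : Rabs (sum_f_R0 x (m + k)) <= 2 * eta + (1 / 2) ^ m - (1 / 2) ^ (m + k).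
  elim: k => [|k IH].
    by rewrite addn0; have := low m (leqnn m); have := half_pow_pos m; nra.
  rewrite addnS tech5; apply: Rle_trans (Rabs_triang _ _) _.
  have := hx (m + k).+1; rewrite -tech_pow_Rmult; lra.
have [nm|mn] := leqP n m.
  by have := low n nm; have := half_pow_pos n; have := half_pow_pos m; nra.
have := high (n - m)%N; rewrite subnKC ?(ltnW mn) //.
by have := half_pow_pos n; lra.
Qed.

Lemma unif1_mono A B i e d d' : d <= d' -> unif1 A B i e d' -> unif1 A B i e d.
Proof. by move=> dd U s t Is It st; apply: U => //; lra. Qed.

Lemma unif1_level n A B i e d : 0 < e -> unif1 A B i e d ->
  unif1 (level n A) (level n B) i e d.
Proof.
move=> e0 U s t Is It st; rewrite /level; case: ifP => _; first exact: U.
by rewrite Rminus_diag Rabs_R0.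
Qed.

Lemma unif1_exists A B i e : contI (A i) -> contI (B i) -> 0 < e ->
  exists d, 0 < d /\ unif1 A B i e d.
Proof.
move=> Ac Bc e0; have [d [d0 hd]] := contI_unif _ Ac e e0.
have [d' [d'0 hd']] := contI_unif _ Bc e e0.
exists (Rmin d d'); split; first exact: Rmin_pos.
move=> s t Is It st; split; [apply: hd|apply: hd'] => //.
  exact: Rlt_le_trans st (Rmin_l _ _).
exact: Rlt_le_trans st (Rmin_r _ _).
Qed.

Lemma contI_level n (A : nat -> R -> R) i : contI (A i) -> contI (level n A i).
Proof.
move=> Ac; rewrite /level; case: (i <= n)%N => // x Ix e e0.
by exists 1; split => [|y *]; [lra|rewrite /= Rminus_diag Rabs_R0].
Qed.

Lemma hat_occ_range A B D i s (m : nat) : wedge A B -> (occ i (D s) <= m)%N ->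
  0 <= hat A B D (occR i) s <= INR m + 1.
Proof.
move=> wAB /leP/le_INR hm; rewrite hat_occ //.
have rg := wedge_range _ _ wAB i s.
have [_ L] := word_lip_occ i.
have [l1 l2] := Rabs_bounds _ _ (L (arm B i s) (D s)).
have p1 : 0 <= occR i (arm B i s :: D s) by exact: pos_INR.
have p2 : 0 <= occR i (D s) by exact: pos_INR.
rewrite -/(occR i (D s)) in hm.
by split; nra.
Qed.

(** [h] is an ultralimit of weighted distances to the root. It vanishes at both ends because the
    lifts close up, and two times that it identifies have equal coordinates, since a difference in
    component [i] is seen by the barrier at every level from [i] on. *)
Lemma excursion (A B : nat -> R -> R) (D : nat -> R -> seq letter) (N : nat) :
  wedge A B -> (forall i, contI (A i)) -> (forall i, contI (B i)) ->
  (forall n, (N <= n)%N -> [/\ developing (level n A) (level n B) (D n),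
     eqw (D n 0) [::] & eqw (D n 1) [::]]) ->
  (forall i, A i 0 = 0 /\ A i 1 = 0) ->
  exists h : R -> R,
    [/\ contI h, forall s, unitI s -> 0 <= h s, h 0 = 0, h 1 = 0 &
        forall f, (forall s t, unitI s -> unitI t ->
             (forall i, A i s = A i t /\ B i s = B i t) -> f s = f t) ->
          tree_compatible h f].
Proof.
move=> wAB Ac Bc hD A01.
have I0 : unitI 0 by rewrite /unitI /=; lra.
have I1 : unitI 1 by rewrite /unitI /=; lra.
have /choice[m hm] : forall i, exists m : nat, forall n s, (N <= n)%N -> unitI s ->
    (occ i (D n s) <= m)%N.
  move=> i; have [|d [d0 hd]] := unif1_exists A B i (1 / 4) (Ac i) (Bc i); first lra.
  have [m [m0 hm]] := archi_inv d d0; exists m => n s Nn.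
  have [dev _ D1] := hD n Nn.
  apply: (occ_bound _ _ _ (wedge_level n _ _ wAB) dev i d m) => //.
    exact: contI_level.
  by apply: unif1_level => //; lra.
(* [m i] bounds the count at all levels and the added 1 covers a partial edge, so the [i]-th term of
   every height is at most [(1 / 2) ^ i]. *)
pose ell i := (1 / 2) ^ i / (INR (m i) + 1).
have mi i : 0 < INR (m i) + 1 by have := pos_INR (m i); lra.
have ell0 i : 0 < ell i by apply: Rdiv_lt_0_compat => //; exact: half_pow_pos.
have ellm i : ell i * (INR (m i) + 1) = (1 / 2) ^ i.
  by rewrite /ell; field; have := mi i; lra.
pose h k := height ell (N + k) (level (N + k) A) (level (N + k) B) (D (N + k)%N).
have Nk k : (N <= N + k)%N by rewrite leq_addr.
have rg k i s : unitI s ->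
   0 <= ell i * hat (level (N + k) A) (level (N + k) B) (D (N + k)%N) (occR i) s
     <= (1 / 2) ^ i.
  move=> Is; have [|r1 r2] := hat_occ_range _ _ (D (N + k)%N) i s (m i)
    (wedge_level (N + k) _ _ wAB); first exact: hm.
  by rewrite -ellm; have := ell0 i; nra.
have hb k s : unitI s -> 0 <= h k s <= 2.
  move=> Is; split.
    by apply: cond_pos_sum => i; have [] := rg k i s Is.
  have := geom_sum_le (fun i => ell i *
    hat (level (N + k) A) (level (N + k) B) (D (N + k)%N) (occR i) s) (N + k).
  move=> /(_ (fun i => proj2 (rg k i s Is))).
  by have := half_pow_pos (N + k); rewrite /h /height; lra.
have hequi e : 0 < e -> exists d, 0 < d /\ forall k s t, unitI s -> unitI t ->
     Rabs (s - t) < d -> Rabs (h k s - h k t) < e.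
  move=> e0; have [|p hp] := half_pow_small (e / 2); first lra.
  (* 1/2 is required by [hat_occ_modulus], which gives [2 * e1] per component; the low terms then
     sum to at most [e / 4] and the tail to less than [e / 2]. *)
  pose e1 := Rmin (1 / 2) (e / 16).
  have e1p : 0 < e1 <= 1 / 2.
    by split; [apply: Rmin_pos; lra | exact: Rmin_l].
  have e1e : e1 <= e / 16 by exact: Rmin_r.
  have [||d [d0 hd]] := finite_modulus (fun i d => unif1 A B i e1 d) p.
  - by move=> i d d' _; exact: unif1_mono.
  - by move=> i; apply: unif1_exists => //; lra.
  exists d; split => // k s t Is It st.
  rewrite /h /height -minus_sum.
  apply: Rle_lt_trans (geom_sum_small _ (2 * e1) p _ _ _ _) _; [lra| | |lra].
  - move=> i; have := rg k i s Is; have := rg k i t It.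
    by move=> *; apply: Rabs_le; lra.
  - move=> i ip; rewrite -Rmult_minus_distr_l Rabs_mult.
    have [dev _ _] := hD _ (Nk k).
    apply: Rmult_le_compat; try exact: Rabs_pos.
      rewrite Rabs_pos_eq; last by have := ell0 i; lra.
      by rewrite -ellm; have := ell0 i; have := pos_INR (m i); nra.
    apply: (hat_occ_modulus _ _ _ (wedge_level _ _ _ wAB) dev i e1 d) => //.
      exact: contI_level.
    by apply: unif1_level; [lra|exact: hd].
have hend k s : unitI s -> (forall i, A i s = 0) -> eqw (D (N + k)%N s) [::] -> h k s = 0.
  move=> Is A0 E; rewrite /h (height_zero _ _ _ _ _ (wedge_level _ _ _ wAB)); last first.
    by move=> j; rewrite /level A0; case: ifP.
  by rewrite E /wlen; apply: sum_eq_R0 => i _ /=; rewrite Rmult_0_r.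
have [H [Hc Hpos H0 Hsep]] := height_limit h 2 hb hequi.
exists H; split => //.
- apply: H0 => // k; apply: hend => // [i|]; first by have [] := A01 i.
  by have [] := hD _ (Nk k).
- apply: H0 => // k; apply: hend => // [i|]; first by have [] := A01 i.
  by have [] := hD _ (Nk k).
move=> f hf.
have sep i s t : unitI s -> unitI t -> 0 < A i s ->
    A i s <> A i t \/ B i s <> B i t ->
    H s <> H t \/ exists r, between r s t /\ H r < H s.
  move=> Is It As hne.
  (* The second bound is a constraint only when [t] is also off the base point of circle [i]; 1 is a
     dummy value. *)
  pose delta := Rmin (ell i * (A i s / 8))
    (if Rlt_dec 0 (A i t) then ell i * Rabs (upos A B i s - upos A B i t) else 1).
  have li := ell0 i.
  apply: (Hsep s t delta i) => //.
    apply: Rmin_pos; first by nra.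
    destruct (Rlt_dec 0 (A i t)) as [At|nAt]; rewrite /=; last lra.
    apply: Rmult_lt_0_compat => //; apply: Rabs_pos_lt => E.
    have [EA EB] := upos_inj A B wAB i s t As At (Rminus_diag_uniq _ _ E).
    by case: hne => hne; exact: hne.
  move=> k ik; have [dev _ _] := hD _ (Nk k).
  have iN : (i <= N + k)%N by apply: leq_trans ik (leq_addl _ _).
  have lE x : level (N + k) A i x = A i x by rewrite /level iN.
  have lE' x : level (N + k) B i x = B i x by rewrite /level iN.
  apply: (height_barrier ell (N + k) ell0 _ _ _ (wedge_level _ _ _ wAB) dev i) => //.
  - by move=> j; exact: contI_level.
  - move=> e e0; have [||d [d0 hd]] := finite_modulus (fun i d => unif1 A B i e d) (N + k).
    + by move=> j d d' _; exact: unif1_mono.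
    + by move=> j; exact: unif1_exists.
    exists d; split => // j; have [jn|jn] := leqP j (N + k).
      by apply: unif1_level => //; exact: hd.
    by move=> x y _ _ _; rewrite /level leqNgt jn /= Rminus_diag Rabs_R0.
  - by rewrite lE.
  - by rewrite lE; exact: Rmin_l.
  - rewrite lE /upos !lE !lE' => At.
    apply: Rle_trans (Rmin_r _ _) _; by destruct (Rlt_dec 0 (A i t)) => //=; exact: Rle_refl.
move=> s t Is It st Hst Hge; apply: contrapT => fst.
have [i hi] : exists i, A i s <> A i t \/ B i s <> B i t.
  apply: contrapT => hn; apply: fst; apply: hf => // i.
  by split; apply: contrapT => hh; apply: hn; exists i; [left|right].
have rs := wedge_range _ _ wAB i s; have rt := wedge_range _ _ wAB i t.
have [As|As] := Rlt_le_dec 0 (A i s).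
  case: (sep i s t Is It As hi) => // -[r [[hr|hr] hlt]].
    by have := Hge r hr; lra.
  have E : r = s by lra.
  by rewrite E in hlt; lra.
have [At|At] := Rlt_le_dec 0 (A i t).
  have hi' : A i t <> A i s \/ B i t <> B i s by case: hi => hh; [left|right] => /esym.
  case: (sep i t s It Is At hi'); first by rewrite Hst.
  move=> [r [hr hlt]]; have hr' : s <= r <= t by move: hr; rewrite /between; lra.
  by have := Hge r hr'; lra.
have As0 : A i s = 0 by lra.
have At0 : A i t = 0 by lra.
have Bs0 := wedge_B0 _ _ wAB i s As0; have Bt0 := wedge_B0 _ _ wAB i t At0.
by case: hi; rewrite ?As0 ?At0 ?Bs0 ?Bt0.
Qed.

End Excursion.

(** * The loop of a word *)

Section Trigonometry.
Local Open Scope R_scope.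

Lemma infinite_sum_series (f : nat -> R) (l l' : R) :
  infinite_sum f l -> (series f : nat -> R) @ \oo --> l' -> l = l'.
Proof.
move=> hf hs.
have hl : (series f : nat -> R) @ \oo --> l.
  move=> A /nbhs_Rabs[e [e0 hA]]; have [N hN] := hf e e0.
  exists N.+1 => // -[//|n] /= nN; apply: hA; rewrite Rabs_minus_sym.
  have := hN n; rewrite sum_f_R0E; apply; exact/ssrnat.leP.
exact: (cvg_unique (@norm_hausdorff R R^o) hl hs).
Qed.

(** [circ] is written with [trigo.cos], while the facts used about [PI] concern [Rtrigo_def.cos];
    both are sums of the same power series. *)
Lemma RcosE (x : R) : trigo.cos x = Rtrigo_def.cos x.
Proof.
rewrite /Rtrigo_def.cos; case: exist_cos => l hl; apply/esym.
apply: (infinite_sum_series _ _ _ hl).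
suff E : cos_coeff' x = (fun i => cos_n i * x² ^ i).
  by rewrite -E; exact: cvg_cos_coeff'.
apply/funext => n; rewrite /cos_coeff' /cos_n.
have -> : Factorial.fact (2 * n) = (n.*2)`! by rewrite factE -mul2n.
rewrite !RealsE /Rsqr /exprz -mul2n GRing.exprM GRing.expr2.
by rewrite -[RHS]GRing.mulrA [X in _ = (_ * X)%R]GRing.mulrC GRing.mulrA.
Qed.

Lemma RsinE (x : R) : trigo.sin x = Rtrigo_def.sin x.
Proof.
rewrite /Rtrigo_def.sin; case: exist_sin => l hl; apply/esym.
have hl' : infinite_sum (fun i => (sin_n i * x² ^ i) * x) (x * l).
  move=> e e0; have x1 : 0 < Rabs x + 1 by have := Rabs_pos x; lra.
  have [|N hN] := hl (e / (Rabs x + 1)); first exact: Rdiv_lt_0_compat.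
  exists N => n /hN; rewrite /Rdist -scal_sum -Rmult_minus_distr_l Rabs_mult.
  set a := Rabs (_ - _) => ha; have a0 : 0 <= a by exact: Rabs_pos.
  have : a * (Rabs x + 1) < e / (Rabs x + 1) * (Rabs x + 1).
    exact: Rmult_lt_compat_r.
  have -> : e / (Rabs x + 1) * (Rabs x + 1) = e by field; lra.
  lra.
apply: (infinite_sum_series _ _ _ hl').
suff E : sin_coeff' x = (fun i => (sin_n i * x² ^ i) * x).
  by rewrite -E; exact: cvg_sin_coeff'.
apply/funext => n; rewrite /sin_coeff' /sin_n.
have -> : Factorial.fact (2 * n + 1) = (n.*2.+1)`! by rewrite factE -mul2n addn1.
rewrite !RealsE /Rsqr /exprz -mul2n GRing.exprS GRing.exprM GRing.expr2.
by rewrite [(x * (x * x) ^+ n)%R]GRing.mulrC GRing.mulrAC GRing.mulrA.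
Qed.

Lemma circE (i : nat) (u : R) :
  circ i u = (/ INR i - / INR i * Rtrigo_def.cos (2 * PI * u),
              / INR i * Rtrigo_def.sin (2 * PI * u)).
Proof. by rewrite /circ RcosE RsinE. Qed.

End Trigonometry.

(** * Holonomy of homotopies and of spelled words *)

Section Spelling.
Local Open Scope R_scope.

Lemma developing_unique A B D D' : developing A B D -> developing A B D' ->
  eqw (D 1) (D' 1) -> forall s, unitI s -> eqw (D s) (D' s).
Proof.
move=> [d [d0 hd]] [d' [d'0 hd']] E s; rewrite /unitI /= => Is; move: E.
apply: (chain (fun s t => eqw (D t) (D' t) -> eqw (D s) (D' s))); [|lra|].
  by move=> r r' r'' h1 h2 /h2/h1.
exists (Rmin d d'); split; first exact: Rmin_pos.
move=> r t hr ht rt rtd E.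
have Ir : unitI r by rewrite /unitI /=; lra.
have It : unitI t by rewrite /unitI /=; lra.
have h1 : Rabs (r - t) < d by apply: Rabs_def1; have := Rmin_l d d'; lra.
have h2 : Rabs (r - t) < d' by apply: Rabs_def1; have := Rmin_r d d'; lra.
apply: (eq_trans (hd _ _ Ir It h1)); apply: (eq_trans (eqw_catr _ _ _ E)).
exact/esym/hd'.
Qed.

(** Homotopy invariance of holonomy: one developing map of the square restricts to both horizontal
    edges and is constant on the vertical ones, which sit at the base point. *)
Lemma square_develop (n : nat) (A B : nat -> R * R -> R) : wedge A B ->
  (forall i, conton unitSq (A i)) -> (forall i, conton unitSq (B i)) ->
  (forall i t, unitI t -> A i (0, t) = 0 /\ A i (1, t) = 0) ->
  exists D0 D1 : R -> seq letter,
    [/\ developing (level n (fun i s => A i (s, 0))) (level n (fun i s => B i (s, 0))) D0,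
        developing (level n (fun i s => A i (s, 1))) (level n (fun i s => B i (s, 1))) D1,
        eqw (D0 1) [::], eqw (D1 1) [::] & eqw (D0 0) (D1 0)].
Proof.
move=> wAB Ac Bc A01.
have I0 : unitI 0 by rewrite /unitI /=; lra.
have I1 : unitI 1 by rewrite /unitI /=; lra.
have [|d [d0 hd]] := level_unif n A Ac (1 / 2); first lra.
have [|d' [d'0 hd']] := level_unif n B Bc (1 / 2); first lra.
have wL := wedge_level n _ _ wAB.
have [||x y z Sx Sy Sz xy yz xz|D [D10 [e [e0 dev]]]] :=
  develop (cross (level n A) (level n B)) (Rmin d d') (1, 0).
- exact: Rmin_pos.
- by [].
- have cl p q : unitSq p -> unitSq q -> near2 (Rmin d d') p q ->
      wclose (level n A) (level n B) p q.
    move=> Sp Sq pq i; split; [apply: hd|apply: hd'] => //.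
      by apply: near2_le pq; exact: Rmin_l.
    by apply: near2_le pq; exact: Rmin_r.
  by apply: cross_cocycle => //; exact: cl.
have devs t : unitI t -> developing (level n (fun i s => A i (s, t)))
    (level n (fun i s => B i (s, t))) (fun s => D (s, t)).
  move=> It; exists e; split => // r s Ir Is rs.
  apply: (dev (r, t) (s, t)) => //; split => //=.
  by rewrite Rminus_diag Rabs_R0.
have side r : unitI r -> (forall i t, unitI t -> A i (r, t) = 0) ->
    eqw (D (r, 0)) (D (r, 1)).
  move=> Ir A0; apply: (chain (fun s t => eqw (D (r, s)) (D (r, t)))); [|lra|].
    by move=> ? ? ? h1 h2; exact: eq_trans h1 h2.
  exists e; split => // s t hs ht st ste.
  have := dev (r, s) (r, t); rewrite (cross_nil _ _ wL); last first.
    move=> i; rewrite /level; case: ifP => _; last lra.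
    by rewrite A0; [lra|rewrite /unitI /=; lra].
  apply => //; split => //=; first by rewrite Rminus_diag Rabs_R0.
  by apply: Rabs_def1; lra.
exists (fun s => D (s, 0)), (fun s => D (s, 1)); split => //.
- exact: devs.
- exact: devs.
- apply: eq_trans D10; apply/esym; apply: side => // i t It.
  by have [] := A01 i t It.
- by apply: side => // i t It; have [] := A01 i t It.
Qed.

Lemma cos_quarter u : 0 <= u <= 1 / 4 -> 0 <= Rtrigo_def.cos (2 * PI * u).
Proof. by move=> hu; have p := PI_RGT_0; apply: cos_ge_0; nra. Qed.

Lemma cos_middle u : 1 / 4 <= u <= 3 / 4 -> Rtrigo_def.cos (2 * PI * u) <= 0.
Proof. by move=> hu; have p := PI_RGT_0; apply: cos_le_0; nra. Qed.

Lemma cos_last u : 3 / 4 <= u <= 1 -> 0 <= Rtrigo_def.cos (2 * PI * u).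
Proof.
move=> hu; have -> : 2 * PI * u = - (2 * PI * (1 - u)) + 2 * INR 1 * PI.
  by rewrite /=; ring.
by rewrite cos_period cos_neg; apply: cos_quarter; lra.
Qed.

Section Spelled.
Variables (A B : nat -> R -> R) (D : R -> seq letter) (w : seq letter).
Hypotheses (wAB : wedge A B) (dev : developing A B D) (Bc : forall i, contI (B i)).

Definition spelled : Prop := forall (k : nat) (u : R), (k < size w)%N -> 0 <= u <= 1 ->
  let a := nth (0%N, true) w k in let t := (INR k + u) / INR (size w) in
  [/\ A a.1 t = 1 - Rtrigo_def.cos (2 * PI * u),
      B a.1 t = (if a.2 then 1 else -1) * Rtrigo_def.sin (2 * PI * u) &
      forall j, j <> a.1 -> A j t = 0].

Hypothesis sp : spelled.

(** The letter is read on the middle half of its interval, where [A >= 1] and the sine goes from 1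
    to -1 up to orientation; on the outer quarters [A <= 1] and nothing is read. *)
Lemma spelled_letter (k : nat) : (k < size w)%N ->
  eqw (D (INR k / INR (size w)))
      (nth (0%N, true) w k :: D (INR k.+1 / INR (size w))).
Proof.
move=> kw; set a := nth _ w k.
have L0 : 0 < INR (size w) by apply: lt_0_INR; apply/ltP; apply: leq_ltn_trans kw.
have kL : INR k + 1 <= INR (size w) by rewrite -S_INR; apply: le_INR; apply/leP.
have k0 := pos_INR k.
pose T u := (INR k + u) / INR (size w).
have TI u : 0 <= u <= 1 -> unitI (T u).
  move=> hu; rewrite /unitI /= /T; split.
    by apply: Rmult_le_pos; [lra|exact/Rlt_le/Rinv_0_lt_compat].
  by apply: (Rmult_le_reg_r (INR (size w))) => //; rewrite /Rdiv Rmult_assoc Rinv_l; lra.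
have Tle u v : T u <= T v -> u <= v.
  move=> h; have : T u * INR (size w) <= T v * INR (size w).
    by apply: Rmult_le_compat_r; lra.
  by rewrite /T /Rdiv !Rmult_assoc Rinv_l; lra.
have leT u v : u <= v -> T u <= T v.
  by move=> h; apply: Rmult_le_compat_r; [exact/Rlt_le/Rinv_0_lt_compat|lra].
have Tinv r : r = T (r * INR (size w) - INR k) by rewrite /T; field; lra.
have spT u : 0 <= u <= 1 -> _ := sp k u kw.
have flat u v : 0 <= u -> u <= v -> v <= 1 ->
    (forall x, u <= x <= v -> 0 <= Rtrigo_def.cos (2 * PI * x)) -> eqw (D (T u)) (D (T v)).
  move=> u0 uv v1 hcos; apply: (developing_const _ _ _ wAB dev);
    [apply: TI; lra|apply: TI; lra|exact: leT|].
  move=> i r; rewrite (Tinv r); set x := _ - _ => -[/Tle h1 /Tle h2].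
  have [|E1 _ E2] := spT x; first lra.
  have [->|/eqP ia] := eqVneq i a.1; first by rewrite E1; have := hcos x; lra.
  by rewrite E2 //; lra.
have s1 : eqw (D (T 0)) (D (T (1 / 4))).
  by apply: flat; [lra|lra|lra|exact: cos_quarter].
have s3 : eqw (D (T (3 / 4))) (D (T 1)).
  by apply: flat; [lra|lra|lra|exact: cos_last].
have s2 : eqw (D (T (1 / 4))) (side_cross B a.1 (T (1 / 4)) (T (3 / 4)) ++ D (T (3 / 4))).
  apply: (developing_far _ _ _ wAB dev a.1 (1 / 2)) => //;
    [lra|apply: TI; lra|apply: TI; lra|apply: leT; lra|].
  move=> r; rewrite (Tinv r); set x := _ - _ => -[/Tle h1 /Tle h2].
  have [|E1 _ _] := spT x; first lra.
  by rewrite E1; have := cos_middle x; lra.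
have side : side_cross B a.1 (T (1 / 4)) (T (3 / 4)) = [:: a].
  have [|_ E1 _] := spT (1 / 4); first lra.
  have [|_ E2 _] := spT (3 / 4); first lra.
  have q1 : Rtrigo_def.sin (2 * PI * (1 / 4)) = 1.
    by have -> : 2 * PI * (1 / 4) = PI / 2 by [field]; exact: sin_PI2.
  have q3 : Rtrigo_def.sin (2 * PI * (3 / 4)) = -1.
    by have -> : 2 * PI * (3 / 4) = 3 * (PI / 2) by [field]; exact: sin_3PI2.
  rewrite /side_cross; rewrite -/a -/(T _) q1 in E1; rewrite -/a -/(T _) q3 in E2.
  rewrite E1 E2; case: (a) => i [] /=.
    by case: isnegP => ?; case: isnegP => ? //=; lra.
  by case: isnegP => ?; case: isnegP => ? //=; lra.
have T0 : T 0 = INR k / INR (size w) by rewrite /T Rplus_0_r.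
have T1 : T 1 = INR k.+1 / INR (size w) by rewrite /T S_INR.
rewrite -T0 -T1; apply: (eq_trans s1); apply: (eq_trans s2).
by rewrite side; exact: (eqw_catr [:: a] _ _ s3).
Qed.

Lemma spelled_develop : (0 < size w)%N -> eqw (D 0) (w ++ D 1).
Proof.
move=> w0; have L0 : 0 < INR (size w) by apply: lt_0_INR; apply/ltP.
have H m : (m <= size w)%N -> eqw (D (INR (size w - m) / INR (size w)))
    (drop (size w - m) w ++ D 1).
  elim: m => [|m IH] mw.
    by rewrite subn0 drop_size /= /Rdiv Rinv_r; [|lra].
  have kw : (size w - m.+1 < size w)%N by rewrite ltn_subrL w0.
  have Ek : (size w - m.+1).+1 = (size w - m)%N by rewrite subnSK.
  rewrite (drop_nth (0%N, true)) // Ek cat_cons.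
  apply: (eq_trans (spelled_letter _ kw)); rewrite Ek.
  exact: (eqw_catr [:: _] _ _ (IH (ltnW mw))).
have := H (size w) (leqnn _).
by rewrite subnn drop0 /= /Rdiv Rmult_0_l.
Qed.

End Spelled.

(** [Z.pred (up x)] is the integer part, so at [u = 1] the definition has passed to the next letter,
    or is clamped to the last one; the formula persists because all letters start and end at the
    origin. *)
Lemma wordloopE w (k : nat) u : (k < size w)%N -> 0 <= u <= 1 ->
  let a := nth (0%N, true) w k in
  wordloop w ((INR k + u) / INR (size w)) = circ a.1 (if a.2 then u else 1 - u).
Proof.
have circ0 i : circ i 0 = origin.
  by rewrite circE Rmult_0_r cos_0 sin_0 /origin; congr (_, _); ring.
have circ1 i : circ i 1 = origin.
  by rewrite circE Rmult_1_r cos_2PI sin_2PI /origin; congr (_, _); ring.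
have circb i (b : bool) : circ i (if b then 0 else 1 - 0) = origin /\
    circ i (if b then 1 else 1 - 1) = origin.
  by case: b; rewrite ?Rminus_0_r ?Rminus_diag.
move=> kw hu a; have L0 : 0 < INR (size w).
  by apply: lt_0_INR; apply/ltP; apply: leq_ltn_trans kw.
have upE (j : nat) v : 0 <= v < 1 -> Z.to_nat (Z.pred (up (INR j + v))) = j.
  move=> hv; have -> : up (INR j + v) = Z.add (Z.of_nat j) 1.
    by apply/esym/tech_up; rewrite plus_IZR -INR_IZR_INZ; lra.
  by lia.
have LE v : INR (size w) * ((INR k + v) / INR (size w)) = INR k + v by field; lra.
rewrite /wordloop; case E: (size w) kw L0 LE => [//|L] kw L0 LE.
rewrite -!E in kw L0 LE *; rewrite LE.
have [u1|u1] := Rle_lt_or_eq_dec _ _ (proj2 hu).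
  rewrite upE; last lra.
  have -> : minn k (size w).-1 = k.
    by apply/minn_idPl; rewrite -ltnS prednK // E.
  by have -> : INR k + u - INR k = u by ring.
rewrite u1; have -> : INR k + 1 = INR k.+1 + 0 by rewrite S_INR; ring.
rewrite upE; last lra.
have [kL|kL] := ltnP k.+1 (size w).
  have -> : minn k.+1 (size w).-1 = k.+1.
    by apply/minn_idPl; rewrite -ltnS prednK // E.
  have -> : INR k.+1 + 0 - INR k.+1 = 0 by ring.
  by rewrite (circb (nth (0%N, true) w k.+1).1 _).1 (circb a.1 a.2).2.
have kE : (size w).-1 = k.
  have sk : size w = k.+1 by apply/eqP; rewrite eqn_leq kL kw.
  by rewrite sk.
have -> : minn k.+1 (size w).-1 = k by rewrite kE; apply/minn_idPr.
by have -> : INR k.+1 + 0 - INR k = 1 by [rewrite S_INR; ring].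
Qed.

End Spelling.

(** * Circles tangent at the origin *)

Section ContinuityAt.
Local Open Scope R_scope.
Variable S : set (R * R).

Definition contat (f : R * R -> R) (p : R * R) : Prop :=
  forall e, 0 < e -> exists d, 0 < d /\
    forall q, S q -> near2 d p q -> Rabs (f p - f q) < e.

Lemma contatP f p : contat f p <-> f @ within S (nbhs p) --> (f p : R).
Proof.
split=> [fc A /nbhs_Rabs[e [e0 hA]]|fc e e0].
  have [d [d0 hd]] := fc e e0; apply/nbhs_near2; exists d; split => // q pq Sq.
  by apply: hA; exact: hd.
have /nbhs_near2[d [d0 hd]] := fc [set r | Rabs (f p - r) < e]
  ((nbhs_Rabs _ _).2 (ex_intro _ e (conj e0 (fun y h => h)))).
by exists d; split => // q Sq pq; exact: hd.
Qed.

Lemma contat_cst c p : contat (fun=> c) p.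
Proof. by move=> e e0; exists 1; split => [|*]; [lra|rewrite Rminus_diag Rabs_R0]. Qed.

Lemma contat_fst p : contat (fun q => q.1) p.
Proof. by move=> e e0; exists e; split => // q _ []. Qed.

Lemma contat_snd p : contat (fun q => q.2) p.
Proof. by move=> e e0; exists e; split => // q _ []. Qed.

Lemma contat_plus f g p : contat f p -> contat g p -> contat (fun q => f q + g q) p.
Proof. by move=> /contatP fc /contatP gc; apply/contatP; exact: (@cvgD R R^o _ _ _ f g). Qed.

Lemma contat_mult f g p : contat f p -> contat g p -> contat (fun q => f q * g q) p.
Proof. by move=> /contatP fc /contatP gc; apply/contatP; exact: (@cvgM R _ _ _ f g). Qed.

Lemma contat_opp f p : contat f p -> contat (fun q => - f q) p.
Proof. by move=> /contatP fc; apply/contatP; exact: (@cvgN R R^o _ _ _ f). Qed.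

Lemma contat_minus f g p : contat f p -> contat g p -> contat (fun q => f q - g q) p.
Proof. by move=> fc gc; apply: contat_plus => //; exact: contat_opp. Qed.

Lemma contat_inv f p : f p <> 0 -> contat f p -> contat (fun q => / f q) p.
Proof.
by move=> /eqP f0 /contatP fc; apply/contatP; exact: (@cvgV R _ _ _ f).
Qed.

Lemma contat_div f g p : g p <> 0 -> contat f p -> contat g p ->
  contat (fun q => f q / g q) p.
Proof. by move=> g0 fc gc; apply: contat_mult => //; exact: contat_inv. Qed.

Lemma contat_max f g p : contat f p -> contat g p ->
  contat (fun q => Rmax (f q) (g q)) p.
Proof.
move=> fc gc e e0; have [d [d0 hd]] := fc e e0; have [d' [d'0 hd']] := gc e e0.
exists (Rmin d d'); split; first exact: Rmin_pos.
move=> q Sq pq.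
have /Rabs_def2[? ?] := hd q Sq (near2_le _ _ _ _ (Rmin_l _ _) pq).
have /Rabs_def2[? ?] := hd' q Sq (near2_le _ _ _ _ (Rmin_r _ _) pq).
by apply: Rabs_def1; rewrite /Rmax; case: Rle_dec; case: Rle_dec; lra.
Qed.

Lemma contat_min f g p : contat f p -> contat g p ->
  contat (fun q => Rmin (f q) (g q)) p.
Proof.
move=> fc gc e e0; have [d [d0 hd]] := fc e e0; have [d' [d'0 hd']] := gc e e0.
exists (Rmin d d'); split; first exact: Rmin_pos.
move=> q Sq pq.
have /Rabs_def2[? ?] := hd q Sq (near2_le _ _ _ _ (Rmin_l _ _) pq).
have /Rabs_def2[? ?] := hd' q Sq (near2_le _ _ _ _ (Rmin_r _ _) pq).
by apply: Rabs_def1; rewrite /Rmin; case: Rle_dec; case: Rle_dec; lra.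
Qed.

Lemma contat_ext_near f g p : contat f p -> f p = g p ->
  (exists d, 0 < d /\ forall q, S q -> near2 d p q -> f q = g q) -> contat g p.
Proof.
move=> fc fg [d' [d'0 hd']] e e0; have [d [d0 hd]] := fc e e0.
exists (Rmin d d'); split; first exact: Rmin_pos.
move=> q Sq pq; rewrite -fg -hd' //; last exact: near2_le (Rmin_r _ _) pq.
by apply: hd => //; exact: near2_le (Rmin_l _ _) pq.
Qed.

Lemma contat_lt f c p : contat f p -> f p < c ->
  exists d, 0 < d /\ forall q, S q -> near2 d p q -> f q < c.
Proof.
move=> fc h; have [|d [d0 hd]] := fc (c - f p); first lra.
by exists d; split => // q Sq pq; have /Rabs_def2[? ?] := hd q Sq pq; lra.
Qed.

Lemma contat_gt f c p : contat f p -> c < f p ->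
  exists d, 0 < d /\ forall q, S q -> near2 d p q -> c < f q.
Proof.
move=> fc h; have [|d [d0 hd]] := fc (f p - c); first lra.
by exists d; split => // q Sq pq; have /Rabs_def2[? ?] := hd q Sq pq; lra.
Qed.

End ContinuityAt.

(** * Retraction of the punctured disc onto the circles *)

Section Geometry.
Local Open Scope R_scope.

Definition disc : set pt := [set p | p.1 ^ 2 + p.2 ^ 2 <= 2 * p.1].

(* The circle through [p] tangent to the vertical axis at the origin has
   radius [rad p] (and [rad] is 0 at the origin). *)
Definition rad (p : pt) : R := (p.1 ^ 2 + p.2 ^ 2) / (2 * p.1).

Lemma disc_cases p : disc p -> p = origin \/ 0 < p.1.
Proof.
case: p => x y /= h.
have [x0|x0] := Rle_lt_dec x 0; last by right.
have x2 : x = 0 by rewrite /disc /= in h; nra.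
have y2 : y = 0 by rewrite /disc /= in h; nra.
by left; rewrite x2 y2.
Qed.

Lemma rad_mult p : 0 < p.1 -> rad p * (2 * p.1) = p.1 ^ 2 + p.2 ^ 2.
Proof. by move=> p0; rewrite /rad; field; lra. Qed.

Lemma rad_disc p : disc p -> 0 < p.1 -> 0 < rad p <= 1.
Proof.
move=> h p0; have := rad_mult p p0; rewrite /disc /= in h => E.
have h2 : 0 < p.1 ^ 2 + p.2 ^ 2 by nra.
split; nra.
Qed.

Lemma rad_scale k p : 0 < p.1 -> k <> 0 -> rad (k * p.1, k * p.2) = k * rad p.
Proof. by move=> p0 k0; rewrite /rad /=; field; split => //; lra. Qed.

Section Coordinates.
Variable N : nat.
Hypothesis N0 : (0 < N)%N.

Let IN0 : 0 < INR N. Proof. by apply: lt_0_INR; apply/ltP. Qed.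

Definition squeeze (p : pt) : R := Rmin 1 (/ (INR N * rad p)).

(* The retraction of the disc onto the disc bounded by the [N]-th circle, along
   the rays from the origin. *)
Definition sigma (p : pt) : pt := (squeeze p * p.1, squeeze p * p.2).

Lemma sigma_origin : sigma origin = origin.
Proof. by rewrite /sigma /origin /= !Rmult_0_r. Qed.

Lemma squeeze_range p : disc p -> 0 < p.1 -> 0 < squeeze p <= 1.
Proof.
move=> dp p0; have [r0 _] := rad_disc p dp p0; split; last exact: Rmin_l.
apply: Rmin_pos; first lra.
by apply: Rinv_0_lt_compat; exact: Rmult_lt_0_compat.
Qed.

Lemma rad_sigma p : disc p -> 0 < p.1 -> rad (sigma p) = Rmin (rad p) (/ INR N).
Proof.
move=> dp p0; have [s0 _] := squeeze_range p dp p0; have [r0 _] := rad_disc p dp p0.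
rewrite /sigma rad_scale //; last lra.
have E : / (INR N * rad p) * rad p = / INR N by field; lra.
rewrite /squeeze /Rmin; case: Rle_dec => h; case: Rle_dec => h' //.
- by rewrite Rmult_1_l.
- by exfalso; nra.
- by exfalso; apply: h; nra.
Qed.

Lemma sigma_id p : disc p -> rad p <= / INR N -> sigma p = p.
Proof.
move=> dp; have [->|p0] := disc_cases p dp; first by rewrite sigma_origin.
have [r0 _] := rad_disc p dp p0 => h.
have -> : sigma p = (1 * p.1, 1 * p.2); last by rewrite !Rmult_1_l -surjective_pairing.
rewrite /sigma /squeeze Rmin_left // -[X in X <= _]Rinv_1.
apply: Rinv_le_contravar; first exact: Rmult_lt_0_compat.
have -> : 1 = INR N * / INR N by field; lra.
by apply: Rmult_le_compat_l => //; lra.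
Qed.

Lemma sigma1_le p : disc p -> 0 <= (sigma p).1 <= p.1.
Proof.
move=> dp; have [->|p0] := disc_cases p dp; first by rewrite sigma_origin /=; lra.
have [s0 s1] := squeeze_range p dp p0; rewrite /sigma /=; nra.
Qed.

Lemma contat_rad p : 0 < p.1 -> contat disc rad p.
Proof.
move=> p0; apply: contat_div; first lra.
- by rewrite /=; apply: contat_plus; do ?[apply: contat_mult|exact: contat_cst|
    exact: contat_fst|exact: contat_snd].
- by apply: contat_mult; [exact: contat_cst|exact: contat_fst].
Qed.

Lemma contat_squeeze p : disc p -> 0 < p.1 -> contat disc squeeze p.
Proof.
move=> dp p0; have [r0 _] := rad_disc p dp p0.
apply: contat_min; first exact: contat_cst.
apply: contat_inv; first by nra.
by apply: contat_mult; [exact: contat_cst|exact: contat_rad].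
Qed.

Lemma contat_sigma p : disc p ->
  contat disc (fun q => (sigma q).1) p /\ contat disc (fun q => (sigma q).2) p.
Proof.
move=> dp; have [->|p0] := disc_cases p dp.
  have small (q : pt) : disc q -> Rabs (sigma q).1 <= Rabs q.1 /\ Rabs (sigma q).2 <= Rabs q.2.
    move=> dq; have [->|q0] := disc_cases q dq.
      by rewrite sigma_origin; split; exact: Rle_refl.
    have [s0 s1] := squeeze_range q dq q0.
    by rewrite /sigma /= !Rabs_mult (Rabs_pos_eq (squeeze q)); [split; have := Rabs_pos q.1;
      have := Rabs_pos q.2; nra|lra].
  split=> e e0; exists e; split => // q dq [h1 h2]; have [k1 k2] := small q dq;
    cbv beta; rewrite sigma_origin Rminus_0_l Rabs_Ropp.
    by move: h1; rewrite Rminus_0_l Rabs_Ropp; lra.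
  by move: h2; rewrite Rminus_0_l Rabs_Ropp; lra.
have sc := contat_squeeze p dp p0.
by split; apply: contat_mult => //; [exact: contat_fst|exact: contat_snd].
Qed.

Variables rho mu : nat -> R.
Hypothesis rho0 : 1 < rho 0%N.
Hypothesis rhoS : forall k, (0 < k)%N -> / INR k.+1 < rho k < / INR k.

(** Radius and slope serve as coordinates off the origin. For [k > 0] the puncture lies between
    [X_{k+1}] and [X_k]; [rho 0 > 1] is a fictitious radius outside [X_1]. *)
Definition puncture (k : nat) (p : pt) : Prop :=
  [/\ 0 < p.1, rad p = rho k & p.2 = mu k * p.1].

(* On [X_k], [vec k p] is a positive multiple of [p]; its first component is
   nonzero exactly between the radii of the punctures of the two annuli
   adjacent to [X_k], and it only vanishes at punctures inside this range.
   Hence its direction retracts the punctured annuli radially onto [X_k]. *)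
Definition vec1 (k : nat) (p : pt) : R :=
  Rmax 0 (Rmin (rad p - rho k) (rho k.-1 - rad p)) * p.1.

Definition vec2 (k : nat) (p : pt) : R :=
  Rmax 0 (Rmin (rad p - rho k) (rho k.-1 - rad p)) * p.2 +
  Rmax 0 (/ INR k - rad p) * (p.2 - mu k * p.1) +
  Rmax 0 (rad p - / INR k) * (p.2 - mu k.-1 * p.1).

(** With [wB], the second intersection of the line through the origin directed by [vec] with the
    unit circle centred at (1, 0). Where [vec1] vanishes this is the base point. *)
Definition wA (k : nat) (p : pt) : R := let q := sigma p in
  2 * vec1 k q ^ 2 / (vec1 k q ^ 2 + vec2 k q ^ 2).

Definition wB (k : nat) (p : pt) : R := let q := sigma p in
  2 * (vec1 k q * vec2 k q) / (vec1 k q ^ 2 + vec2 k q ^ 2).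

Lemma rho_decr j k : (j < k)%N -> rho k < rho j.
Proof.
have step i : rho i.+1 < rho i.
  have [_ h1] := rhoS i.+1 isT; case: i h1 => [|i] h1.
    by move: h1; rewrite Rinv_1; lra.
  by have [h2 _] := rhoS i.+1 isT; lra.
elim: k => // k IH; rewrite ltnS leq_eqVlt => /orP[/eqP->|/IH]; first exact: step.
by have := step k; lra.
Qed.

Lemma vec1_neq0 k p : vec1 k p <> 0 -> rho k < rad p < rho k.-1.
Proof.
move=> h; have h' : Rmax 0 (Rmin (rad p - rho k) (rho k.-1 - rad p)) <> 0.
  by move=> E; apply: h; rewrite /vec1 E Rmult_0_l.
by move: h'; rewrite /Rmax /Rmin; case: Rle_dec; case: Rle_dec; lra.
Qed.

Lemma wA_vec1 k p : wA k p <> 0 -> vec1 k (sigma p) <> 0.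
Proof.
by move=> h E; apply: h; rewrite /wA E /Rdiv /= Rmult_0_l Rmult_0_r Rmult_0_l.
Qed.

(** At most one component leaves the base point because the ranges of radii from [rho k] to
    [rho k.-1] are disjoint. *)
Lemma wedge_wAB : wedge wA wB.
Proof.
split=> [k p|j k p /wA_vec1/vec1_neq0 hj /wA_vec1/vec1_neq0 hk].
  rewrite /wA /wB; set a := vec1 k _; set b := vec2 k _.
  have [ab|ab] := pselect (a ^ 2 + b ^ 2 = 0).
    have -> : a = 0 by nra.
    have -> : b = 0 by nra.
    rewrite /Rdiv /= !Rmult_0_l !Rmult_0_r !Rmult_0_l; ring.
  by field.
apply/eqP; rewrite eqn_leq; apply/andP; split; rewrite leqNgt; apply/negP => jk.
  have kj : (k <= j.-1)%N by rewrite -ltnS prednK //; exact: leq_ltn_trans jk.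
  have : rho j.-1 <= rho k.
    move: kj; rewrite leq_eqVlt => /orP[/eqP->|/rho_decr]; lra.
  lra.
have kj : (j <= k.-1)%N by rewrite -ltnS prednK //; exact: leq_ltn_trans jk.
have : rho k.-1 <= rho j.
  move: kj; rewrite leq_eqVlt => /orP[/eqP->|/rho_decr]; lra.
lra.
Qed.

Lemma wA_origin k : wA k origin = 0.
Proof.
by apply: contrapT => /wA_vec1; rewrite sigma_origin; apply; exact: Rmult_0_r.
Qed.

Lemma wB_origin k : wB k origin = 0.
Proof. exact: (wedge_B0 _ _ wedge_wAB k origin (wA_origin k)). Qed.

Lemma circleX_eq i p : (0 < i)%N -> circleX i p ->
  p.1 ^ 2 + p.2 ^ 2 = 2 * (/ INR i) * p.1.
Proof. by rewrite /circleX /=; nra. Qed.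

Lemma inv_INR_le i j : (0 < i)%N -> (i <= j)%N -> / INR j <= / INR i.
Proof.
move=> i0 ij; apply: Rinv_le_contravar; first by apply: lt_0_INR; apply/ltP.
by apply: le_INR; apply/leP.
Qed.

Lemma circleX_disc i p : (0 < i)%N -> circleX i p -> disc p.
Proof.
move=> i0 hp; have := circleX_eq i p i0 hp; rewrite /disc /= => E.
have i1 := inv_INR_le 1 i isT i0; rewrite Rinv_1 in i1.
have ip : 0 < / INR i by apply/Rinv_0_lt_compat/lt_0_INR/ltP.
have p0 : 0 <= p.1 by nra.
by rewrite E; nra.
Qed.

Lemma circleX_rad i p : (0 < i)%N -> circleX i p -> 0 < p.1 -> rad p = / INR i.
Proof.
move=> i0 hp p0; have := circleX_eq i p i0 hp; rewrite /rad => ->; field; split; last lra.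
by apply: not_0_INR; case: (i) i0.
Qed.

Lemma rho_gt k j : (0 < j)%N -> (k < j)%N -> / INR j < rho k.
Proof.
move=> j0; case: k => [|k] kj.
  have := inv_INR_le 1 j isT j0; rewrite Rinv_1; lra.
have [h _] := rhoS k.+1 isT; have := inv_INR_le k.+2 j isT kj; lra.
Qed.

Lemma rho_lt k j : (0 < j)%N -> (j <= k)%N -> rho k < / INR j.
Proof.
move=> j0 jk; have [_ h] := rhoS k (leq_trans j0 jk); have := inv_INR_le j k j0 jk; lra.
Qed.

Lemma squeeze_circleX i p : (0 < i)%N -> circleX i p -> 0 < p.1 ->
  squeeze p = INR i / INR (maxn i N).
Proof.
move=> i0 hp p0; have dp := circleX_disc i p i0 hp.
have rp := circleX_rad i p i0 hp p0.
have Ii : 0 < INR i by apply/lt_0_INR/ltP.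
have [s0 _] := squeeze_range p dp p0.
have := rad_sigma p dp p0; rewrite /sigma rad_scale // ?rp; last lra.
have -> : Rmin (/ INR i) (/ INR N) = / INR (maxn i N).
  have [iN|Ni] := leqP i N.
    by rewrite Rmin_right //; exact: inv_INR_le.
  by rewrite Rmin_left //; apply: inv_INR_le => //; exact: ltnW.
by move=> E; rewrite /Rdiv -E; field; lra.
Qed.

(** The geometric form of the substitution [x_i := x_N]: a circle with [i <= N] is squeezed onto
    [X_N], whence the index [maxn i N]. On the target circle [vec] is radial, so the coordinates are
    those of the circle rescaled to radius 1. *)
Lemma w_circleX i p : (0 < i)%N -> circleX i p ->
  [/\ wA (maxn i N) p = INR i * p.1, wB (maxn i N) p = INR i * p.2 &
      forall j, j <> maxn i N -> wA j p = 0].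
Proof.
move=> i0 hp; have dp := circleX_disc i p i0 hp.
have [->|p0] := disc_cases p dp.
  by rewrite wA_origin wB_origin /= !Rmult_0_r; split => // j _; exact: wA_origin.
have rp := circleX_rad i p i0 hp p0.
have Ii : 0 < INR i by apply/lt_0_INR/ltP.
set k := maxn i N.
have k0 : (0 < k)%N by rewrite leq_max i0.
have Ik : 0 < INR k by apply/lt_0_INR/ltP.
have sE : squeeze p = INR i / INR k by exact: squeeze_circleX.
have rq : rad (sigma p) = / INR k.
  have [s0 _] := squeeze_range p dp p0.
  by rewrite /sigma rad_scale // ?rp ?sE; [field|]; lra.
have q0 : 0 < (sigma p).1.
  by rewrite /sigma /=; have [] := squeeze_range p dp p0; nra.
have qE := rad_mult (sigma p) q0; rewrite rq in qE.
have y0 : 0 < Rmax 0 (Rmin (rad (sigma p) - rho k) (rho k.-1 - rad (sigma p))).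
  have h1 := rho_lt k k k0 (leqnn k).
  have h2 : / INR k < rho k.-1 by apply: rho_gt => //; rewrite prednK.
  by rewrite rq Rmax_right; [|apply/Rlt_le]; apply: Rmin_pos; lra.
have v2E : vec2 k (sigma p) =
    Rmax 0 (Rmin (rad (sigma p) - rho k) (rho k.-1 - rad (sigma p))) * (sigma p).2.
  have E0 : Rmax 0 0 = 0 by rewrite Rmax_left //; lra.
  by rewrite /vec2 rq Rminus_diag E0; ring.
move: q0 qE; rewrite /wA /wB v2E /vec1.
set y := Rmax 0 _ in y0 *; set q := sigma p => q0 qE.
have nz : q.1 ^ 2 + q.2 ^ 2 <> 0 by nra.
have nz2 : (y * q.1) ^ 2 + (y * q.2) ^ 2 <> 0.
  have -> : (y * q.1) ^ 2 + (y * q.2) ^ 2 = y ^ 2 * (q.1 ^ 2 + q.2 ^ 2) by ring.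
  by apply: Rmult_integral_contrapositive_currified => //; nra.
have E1 : q.1 = INR i / INR k * p.1 by rewrite -sE.
have E2 : q.2 = INR i / INR k * p.2 by rewrite -sE.
have D : (y * q.1) ^ 2 + (y * q.2) ^ 2 = y ^ 2 * (/ INR k * (2 * q.1)).
  by rewrite qE; ring.
split.
- rewrite D; have -> : INR i * p.1 = INR k * q.1 by rewrite E1; field; lra.
  by field; lra.
- rewrite D; have -> : INR i * p.2 = INR k * q.2 by rewrite E2; field; lra.
  by field; lra.
move=> j jk; apply: contrapT => hj; apply: jk; apply: (wedge_wAB.2 _ _ p hj).
rewrite /wA v2E /vec1 -/y -/q D.
have -> : 2 * (y * q.1) ^ 2 / (y ^ 2 * (/ INR k * (2 * q.1))) = INR k * q.1 by field; lra.
nra.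
Qed.

Lemma contat_w_zero k p : disc p ->
  (exists d, 0 < d /\ forall q, disc q -> near2 d p q -> vec1 k (sigma q) = 0) ->
  contat disc (wA k) p /\ contat disc (wB k) p.
Proof.
move=> pd [d [d0 hd]].
have H q : vec1 k (sigma q) = 0 -> 0 = wA k q /\ 0 = wB k q.
  move=> E; have A0 : wA k q = 0 by apply: contrapT => /wA_vec1.
  by rewrite A0 (wedge_B0 _ _ wedge_wAB k q A0).
have [h1 h2] := H p (hd p pd (near2_refl _ _ d0)).
by split; apply: (contat_ext_near _ (fun=> 0) _ _ (contat_cst _ _ _)) => //;
  exists d; split => // q dq pq; have [] := H q (hd q dq pq).
Qed.

(** The denominator vanishes only at a puncture: inside the range [vec1 = 0] forces an extreme
    radius, where [vec2] measures the deviation from the slope of the puncture. After squeezing, the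
    radii [rho j] with [j < N] are out of reach. *)
Lemma contat_w_far k p : disc p -> 0 < p.1 ->
  (forall j, (N <= j)%N -> ~ puncture j p) ->
  contat disc (wA k) p /\ contat disc (wB k) p.
Proof.
move=> dp p0 np.
have [c1 c2] := contat_sigma p dp.
have q0 : 0 < (sigma p).1.
  by rewrite /sigma /=; have [] := squeeze_range p dp p0; nra.
have sq f : contat disc f p -> contat disc (fun q => f q ^ 2) p.
  by move=> fc /=; do ?[apply: contat_mult => //]; exact: contat_cst.
have rc : contat disc (fun q => rad (sigma q)) p.
  apply: (contat_div _ (fun q => (sigma q).1 ^ 2 + (sigma q).2 ^ 2)
    (fun q => 2 * (sigma q).1)); first lra.
    by apply: contat_plus; exact: sq.
  by apply: contat_mult => //; exact: contat_cst.
have rE := rad_sigma p dp p0.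
have [lt1|ge1] := Rlt_le_dec (rad (sigma p)) (rho k).
  apply: contat_w_zero => //; have [d [d0 hd]] := contat_lt _ _ _ _ rc lt1.
  exists d; split => // q dq pq; apply: contrapT => /vec1_neq0.
  by have := hd q dq pq; lra.
have [lt2|ge2] := Rlt_le_dec (rho k.-1) (rad (sigma p)).
  apply: contat_w_zero => //; have [d [d0 hd]] := contat_gt _ _ _ _ rc lt2.
  exists d; split => // q dq pq; apply: contrapT => /vec1_neq0.
  by have := hd q dq pq; lra.
have rN : rad (sigma p) <= / INR N by rewrite rE; exact: Rmin_r.
have punct j : rad (sigma p) = rho j -> (sigma p).2 = mu j * (sigma p).1 -> False.
  move=> E1 E2; have [jN|Nj] := ltnP j N; first by have := rho_gt j N N0 jN; lra.
  have hj := rho_lt j N N0 Nj.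
  have rp : rad p = rad (sigma p).
    by move: rE; rewrite /Rmin; case: Rle_dec; lra.
  have sp : sigma p = p by apply: sigma_id => //; lra.
  by apply: (np j Nj); split; rewrite // ?rp // -sp.
have k0 : (0 < k)%N.
  case: (k) ge1 => // ge1; have := inv_INR_le 1 N isT N0; rewrite Rinv_1; lra.
have hk := rhoS k k0.
have hk1 : / INR k < rho k.-1 by apply: rho_gt => //; rewrite prednK.
have nz : vec1 k (sigma p) ^ 2 + vec2 k (sigma p) ^ 2 <> 0.
  move=> E.
  have v1 : vec1 k (sigma p) = 0 by nra.
  have v2 : vec2 k (sigma p) = 0 by nra.
  have y0 : Rmax 0 (Rmin (rad (sigma p) - rho k) (rho k.-1 - rad (sigma p))) = 0.
    by move: v1; rewrite /vec1 => /Rmult_integral[//|]; lra.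
  move: v2; rewrite /vec2 y0 Rmult_0_l Rplus_0_l.
  have [Er|Er] : rad (sigma p) = rho k \/ rad (sigma p) = rho k.-1.
    by move: y0; rewrite /Rmax /Rmin; case: Rle_dec; case: Rle_dec; lra.
  - rewrite Er (Rmax_right 0 (/ INR k - rho k)); last lra.
    rewrite (Rmax_left 0 (rho k - / INR k)); last lra.
    rewrite Rmult_0_l Rplus_0_r => /Rmult_integral[|h]; first lra.
    by apply: (punct k Er); lra.
  - rewrite Er (Rmax_left 0 (/ INR k - rho k.-1)); last lra.
    rewrite (Rmax_right 0 (rho k.-1 - / INR k)); last lra.
    rewrite Rmult_0_l Rplus_0_l => /Rmult_integral[|h]; first lra.
    by apply: (punct k.-1 Er); lra.
have yc : contat disc (fun q =>
    Rmax 0 (Rmin (rad (sigma q) - rho k) (rho k.-1 - rad (sigma q)))) p.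
  apply: contat_max; first exact: contat_cst.
  by apply: contat_min; apply: contat_minus => //; exact: contat_cst.
have v1c : contat disc (fun q => vec1 k (sigma q)) p by exact: contat_mult.
have lc j : contat disc (fun q => (sigma q).2 - mu j * (sigma q).1) p.
  by apply: contat_minus => //; apply: contat_mult => //; exact: contat_cst.
have v2c : contat disc (fun q => vec2 k (sigma q)) p.
  apply: contat_plus; [apply: contat_plus|]; apply: contat_mult => //.
  - apply: contat_max; first exact: contat_cst.
    by apply: contat_minus => //; exact: contat_cst.
  - apply: contat_max; first exact: contat_cst.
    by apply: contat_minus => //; exact: contat_cst.
have dc := contat_plus _ _ _ _ (sq _ v1c) (sq _ v2c).
split; apply: contat_div => //; apply: contat_mult; do ?exact: contat_cst.
  exact: sq.
exact: contat_mult.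
Qed.

(** All circles meet at the origin and [rad] is discontinuous there. But near the origin a circle of
    radius above [rho k] is steep: its slope exceeds those of both punctures, the three terms of
    [vec2] have the same sign, and [vec2 ^ 2 >= T ^ 2 * vec1 ^ 2]. *)
Lemma w_near_origin k T p : 0 < T -> Rabs (mu k) <= T -> Rabs (mu k.-1) <= T ->
  disc p -> p.1 * (1 + T ^ 2) < 2 * rho k -> wA k p <= 2 / T ^ 2.
Proof.
move=> T0 m1 m2 dp hp.
have T2 : 0 < 2 / T ^ 2 by apply: Rdiv_lt_0_compat; nra.
have [->|/wA_vec1 v1] := pselect (wA k p = 0); first lra.
have [r1 _] := vec1_neq0 _ _ v1.
have [p0|p0] := disc_cases p dp.
  by move: v1; rewrite p0 sigma_origin /vec1 Rmult_0_r.
rewrite /wA; set q := sigma p in v1 r1 *.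
have := sigma1_le p dp; rewrite -/q => -[qs qp].
have q0 : 0 < q.1.
  by rewrite /q /sigma /=; have [] := squeeze_range p dp p0; nra.
have qE := rad_mult q q0.
have rk : 0 < rho k by case: (k) => [|j]; [lra|have [] := rhoS j.+1 isT;
  have : 0 < / INR j.+2 by [apply/Rinv_0_lt_compat/lt_0_INR/ltP]; lra].
have slope : T ^ 2 * q.1 ^ 2 <= q.2 ^ 2.
  have T1 : 0 <= 1 + T ^ 2 by nra.
  have h1 : q.1 * (1 + T ^ 2) <= 2 * rad q.
    have : q.1 * (1 + T ^ 2) <= p.1 * (1 + T ^ 2) by apply: Rmult_le_compat_r.
    lra.
  have h2 : q.1 * (q.1 * (1 + T ^ 2)) <= q.1 * (2 * rad q).
    by apply: Rmult_le_compat_l => //; lra.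
  nra.
have absq : T * q.1 <= q.2 \/ T * q.1 <= - q.2.
  by have [?|?] := Rle_lt_dec 0 q.2; [left|right]; nra.
move: v1; rewrite /vec1 /vec2; set y := Rmax 0 _.
set a := Rmax 0 (/ INR k - rad q); set b := Rmax 0 (rad q - / INR k) => v1.
have y0 : 0 <= y by exact: Rmax_l.
have a0 : 0 <= a by exact: Rmax_l.
have b0 : 0 <= b by exact: Rmax_l.
have yp : 0 < y by apply: Rnot_le_lt => ?; apply: v1; have -> : y = 0 by [lra]; ring.
have [u1 u2] := Rabs_bounds _ _ m1; have [u3 u4] := Rabs_bounds _ _ m2.
have mq m : - T <= m -> m <= T -> - (T * q.1) <= m * q.1 /\ m * q.1 <= T * q.1.
  by move=> ? ?; split; nra.
have [w1 w2] := mq _ u1 u2; have [w3 w4] := mq _ u3 u4.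
have v2 : (y * T * q.1) ^ 2 <= (y * q.2 + a * (q.2 - mu k * q.1) + b * (q.2 - mu k.-1 * q.1)) ^ 2.
  set v := _ + _ + _; have yT : 0 <= y * T * q.1.
    by apply: Rmult_le_pos; [apply: Rmult_le_pos|]; lra.
  case: absq => hq.
    have h1 : 0 <= a * (q.2 - mu k * q.1) by apply: Rmult_le_pos => //; lra.
    have h2 : 0 <= b * (q.2 - mu k.-1 * q.1) by apply: Rmult_le_pos => //; lra.
    have h3 : y * T * q.1 <= y * q.2 by rewrite Rmult_assoc; apply: Rmult_le_compat_l.
    have : y * T * q.1 <= v by rewrite /v; lra.
    nra.
  have h1 : 0 <= a * - (q.2 - mu k * q.1) by apply: Rmult_le_pos => //; lra.
  have h2 : 0 <= b * - (q.2 - mu k.-1 * q.1) by apply: Rmult_le_pos => //; lra.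
  have h3 : y * T * q.1 <= y * - q.2 by rewrite Rmult_assoc; apply: Rmult_le_compat_l.
  have : y * T * q.1 <= - v by rewrite /v; lra.
  nra.
set v := _ + _ + _ in v2 *.
have s0 : 0 < (y * q.1) ^ 2 by apply: pow_lt; exact: Rmult_lt_0_compat.
have hT : 2 / T ^ 2 * T ^ 2 = 2 by field; lra.
apply: (Rmult_le_reg_r ((y * q.1) ^ 2 + v ^ 2)); first nra.
have -> : 2 * (y * q.1) ^ 2 / ((y * q.1) ^ 2 + v ^ 2) *
    ((y * q.1) ^ 2 + v ^ 2) = 2 * (y * q.1) ^ 2.
  by field; nra.
have e2 : (y * T * q.1) ^ 2 = T ^ 2 * (y * q.1) ^ 2 by ring.
rewrite e2 in v2; nra.
Qed.

Lemma contat_w k p : disc p -> (forall j, (N <= j)%N -> ~ puncture j p) ->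
  contat disc (wA k) p /\ contat disc (wB k) p.
Proof.
move=> dp np; have [->|p0] := disc_cases p dp; last exact: contat_w_far.
have rk : 0 < rho k by case: (k) => [|j]; [lra|have [] := rhoS j.+1 isT;
  have : 0 < / INR j.+2 by [apply/Rinv_0_lt_compat/lt_0_INR/ltP]; lra].
have small e : 0 < e -> exists d, 0 < d /\ forall q, disc q -> near2 d origin q ->
    wA k q < e.
  (* [T] dominates both slopes, and [T >= 1] with [T > 2 / e] gives [2 / T ^ 2 < e]. *)
  move=> e0; pose T := 1 + Rabs (mu k) + Rabs (mu k.-1) + 2 / e.
  have e2 : 0 < 2 / e by apply: Rdiv_lt_0_compat; lra.
  have := Rabs_pos (mu k); have := Rabs_pos (mu k.-1) => m1 m2.
  have T1 : 1 <= T by rewrite /T; lra.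
  exists (2 * rho k / (1 + T ^ 2)); split; first by apply: Rdiv_lt_0_compat; nra.
  move=> q dq [/= h _]; apply: Rle_lt_trans (w_near_origin k T q _ _ _ dq _) _.
  - lra.
  - by rewrite /T; lra.
  - by rewrite /T; lra.
  - rewrite Rabs_minus_sym Rminus_0_r in h; have h' := Rle_lt_trans _ _ _ (Rle_abs _) h.
    have : q.1 * (1 + T ^ 2) < 2 * rho k / (1 + T ^ 2) * (1 + T ^ 2).
      by apply: Rmult_lt_compat_r => //; nra.
    by have -> : 2 * rho k / (1 + T ^ 2) * (1 + T ^ 2) = 2 * rho k by [field; nra].
  - have TT : T <= T ^ 2 by nra.
    have Te : 2 / e < T by rewrite /T; lra.
    apply: (Rmult_lt_reg_r (T ^ 2)); first nra.
    have -> : 2 / T ^ 2 * T ^ 2 = 2 by field; lra.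
    have : 2 / e * e < T * e by apply: Rmult_lt_compat_r.
    have -> : 2 / e * e = 2 by field; lra.
    nra.
split=> e e0.
  have [d [d0 hd]] := small e e0; exists d; split => // q dq pq.
  rewrite wA_origin Rminus_0_l Rabs_Ropp Rabs_pos_eq; first exact: hd.
  by have [] := wedge_range _ _ wedge_wAB k q.
(* On the unit circle [B ^ 2 = A (2 - A) <= 2 A]. *)
have [|d [d0 hd]] := small (e ^ 2 / 2); first nra.
exists d; split => // q dq pq.
rewrite wB_origin Rminus_0_l Rabs_Ropp.
have := hd q dq pq; have := wedge_range _ _ wedge_wAB k q.
have := wedge_wAB.1 k q => c r h.
by apply: Rabs_def1; nra.
Qed.

End Coordinates.
End Geometry.

(** * The harmonic archipelago *)

Section PointSets.
Local Open Scope R_scope.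

Lemma near2_open d (p : pt) : open [set q : pt | near2 d p q].
Proof.
have H (q : R * R) : near2 d p q -> nbhs q [set q : pt | near2 d p q].
  move=> [q1 q2]; apply/nbhs_near2.
  exists (Rmin (d - Rabs (p.1 - q.1)) (d - Rabs (p.2 - q.2))); split.
    by apply: Rmin_pos; lra.
  move=> r qr; have [r1 _] := near2_le _ _ _ _ (Rmin_l _ _) qr.
  have [_ r2] := near2_le _ _ _ _ (Rmin_r _ _) qr; split.
    have -> : p.1 - r.1 = (p.1 - q.1) + (q.1 - r.1) by ring.
    by apply: Rle_lt_trans (Rabs_triang _ _) _; lra.
  have -> : p.2 - r.2 = (p.2 - q.2) + (q.2 - r.2) by ring.
  by apply: Rle_lt_trans (Rabs_triang _ _) _; lra.
by rewrite openE => q; exact: H.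
Qed.

Lemma inv_INR_pos n : (0 < n)%N -> 0 < / INR n.
Proof. by move=> n0; apply/Rinv_0_lt_compat/lt_0_INR/ltP. Qed.

Lemma inv_INR_S n : (0 < n)%N -> / INR n.+1 < / INR n.
Proof.
move=> n0; apply: Rinv_0_lt_contravar; first by apply/lt_0_INR/ltP.
by rewrite S_INR; lra.
Qed.

Lemma circleX_of_rad i p : (0 < i)%N -> 0 < p.1 -> rad p = / INR i -> circleX i p.
Proof.
by move=> i0 p0 h; have := rad_mult p p0; rewrite h /circleX /=; nra.
Qed.

Lemma circleX_origin i : circleX i origin.
Proof. by rewrite /circleX /=; ring. Qed.

Lemma annulus_cases n p : (0 < n)%N -> annulus n p ->
  p = origin \/ 0 < p.1 /\ / INR n.+1 <= rad p <= / INR n.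
Proof.
move=> n0 [h1 h2]; have a0 := inv_INR_pos n n0; have b0 := inv_INR_pos n.+1 isT.
have a1 : / INR n <= 1 by have := inv_INR_le 1 n isT n0; rewrite Rinv_1.
have x0 : 0 <= p.1 by nra.
have dp : disc p by rewrite /disc /=; nra.
have [->|p0] := disc_cases p dp; [by left|right; split => //].
have E := rad_mult p p0; split; apply: (Rmult_le_reg_r (2 * p.1)); nra.
Qed.

Lemma annulus_rad n p : 0 < p.1 -> / INR n.+1 <= rad p <= / INR n -> annulus n p.
Proof.
move=> p0 [h1 h2]; have E := rad_mult p p0.
by split; nra.
Qed.

(** An interior point can be pushed both ways along its ray, which multiplies [rad] by [1 + eta] and
    [1 - eta]. The origin is not interior, as no point of the annulus has negative abscissa. *)
Lemma interior_annulus n p : (0 < n)%N -> interior (annulus n) p ->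
  0 < p.1 /\ / INR n.+1 < rad p < / INR n.
Proof.
move=> n0 /nbhs_near2[d [d0 hd]].
have pA : annulus n p by apply: hd; exact: near2_refl.
have [E|[p0 [h1 h2]]] := annulus_cases n p n0 pA.
  have : annulus n (- (d / 2), 0).
    by apply: hd; rewrite E; split => /=; apply: Rabs_def1; lra.
  by move=> /(annulus_cases n _ n0)[[h]|[/= h _]]; lra.
split => //.
pose m := Rabs p.1 + Rabs p.2 + 1.
have m0 : 1 <= m by rewrite /m; have := Rabs_pos p.1; have := Rabs_pos p.2; lra.
pose eta := Rmin (1 / 2) (d / (2 * m)).
have e0 : 0 < eta by apply: Rmin_pos; [lra|apply: Rdiv_lt_0_compat; lra].
have e2 : eta <= 1 / 2 by exact: Rmin_l.
have em : eta * m < d.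
  have : eta * m <= d / (2 * m) * m by apply: Rmult_le_compat_r; [lra|exact: Rmin_r].
  have -> : d / (2 * m) * m = d / 2 by field; lra.
  lra.
have scale k : Rabs (1 - k) = eta -> 0 < k -> / INR n.+1 <= k * rad p <= / INR n.
  move=> hk k0; rewrite -rad_scale //; last lra.
  have : annulus n (k * p.1, k * p.2).
    apply: hd; split => /=.
      have -> : p.1 - k * p.1 = (1 - k) * p.1 by ring.
      rewrite Rabs_mult hk; have := Rabs_pos p.2; rewrite /m in em.
      have := Rabs_pos p.1; nra.
    have -> : p.2 - k * p.2 = (1 - k) * p.2 by ring.
    rewrite Rabs_mult hk; have := Rabs_pos p.2; rewrite /m in em.
    have := Rabs_pos p.1; nra.
  move=> /(annulus_cases n _ n0)[[E _]|[_ //]].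
  by exfalso; have := Rmult_lt_0_compat _ _ k0 p0; rewrite E; exact: Rlt_irrefl.
have r0 : 0 < rad p by have := inv_INR_pos n.+1 isT; lra.
have [||_ s1] := scale (1 + eta); [|lra|].
  by have -> : 1 - (1 + eta) = - eta by [ring]; rewrite Rabs_Ropp Rabs_pos_eq; lra.
have [||s2 _] := scale (1 - eta); [|lra|].
  by have -> : 1 - (1 - eta) = eta by [ring]; rewrite Rabs_pos_eq; lra.
by split; nra.
Qed.

Lemma rad_interior_annulus n p : 0 < p.1 -> / INR n.+1 < rad p < / INR n ->
  interior (annulus n) p.
Proof.
move=> p0 [h1 h2]; have E := rad_mult p p0.
have sq : contat setT (fun q : pt => q.1 ^ 2 + q.2 ^ 2) p.
  by rewrite /=; apply: contat_plus; do ?[apply: contat_mult|exact: contat_cst|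
    exact: contat_fst|exact: contat_snd].
have lin c : contat setT (fun q : pt => c * q.1) p.
  by apply: contat_mult; [exact: contat_cst|exact: contat_fst].
have [|d [d0 hd]] := contat_lt _ _ 0 p (contat_minus _ _ _ _ sq (lin (2 * / INR n))).
  by nra.
have [|d' [d'0 hd']] := contat_gt _ _ 0 p (contat_minus _ _ _ _ sq (lin (2 * / INR n.+1))).
  by nra.
apply/nbhs_near2; exists (Rmin d d'); split; first exact: Rmin_pos.
move=> q pq.
have := hd q I (near2_le _ _ _ _ (Rmin_l _ _) pq).
have := hd' q I (near2_le _ _ _ _ (Rmin_r _ _) pq).
by move=> *; split; nra.
Qed.

Lemma Yearr_disc p : Yearr 1 p -> disc p.
Proof. by move=> [i [i0 hp]]; exact: circleX_disc hp. Qed.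

Lemma HAset_disc p : HAset p -> disc p.
Proof.
move=> [n [/Yearr_disc//|[k [/andP[k0 _] hp]]]].
have a1 : / INR k <= 1 by have := inv_INR_le 1 k isT k0; rewrite Rinv_1.
have [->|[p0 [_ h]]] := annulus_cases k p k0 hp; first by rewrite /disc /=; lra.
by have E := rad_mult p p0; rewrite /disc /= in E *; nra.
Qed.

Lemma Yup_mono m n : (m <= n)%N -> Yup m `<=` Yup n.
Proof.
move=> mn p [|[k [/andP[k0 km] hp]]]; first by left.
by right; exists k; rewrite k0 (leq_trans km mn).
Qed.

(** All circles belong to [Y_1], so what [Y^M] misses lies in open annuli of index above [M]. *)
Lemma not_Yup M p : HAset p -> ~ Yup M p -> exists k,
  [/\ (M < k.+1)%N, interior (annulus k.+1) p & 0 < p.1 /\ rad p <= / INR k.+1].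
Proof.
move=> [n [hp|[k [/andP[k0 kn] hp]]]] nY; first by case: nY; left.
have nX i : (0 < i)%N -> ~ circleX i p.
  by move=> i0 hi; apply: nY; left; exists i.
have Mk : (M < k)%N.
  by rewrite ltnNge; apply/negP => kM; apply: nY; right; exists k; rewrite k0.
have [p0|[p0 [h1 h2]]] := annulus_cases k p k0 hp.
  by case: (nX 1%N isT); rewrite p0; exact: circleX_origin.
exists k.-1; rewrite prednK //; split => //.
have n1 : rad p <> / INR k by move=> h; apply: (nX k k0); exact: circleX_of_rad.
have n2 : rad p <> / INR k.+1 by move=> h; apply: (nX k.+1 isT); exact: circleX_of_rad.
by apply: rad_interior_annulus => //; lra.
Qed.

Lemma rad_small p c : disc p -> 0 < p.1 -> rad p <= c ->
  Rabs p.1 <= 2 * c /\ Rabs p.2 <= 2 * c.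
Proof.
move=> dp p0 h; have E := rad_mult p p0; have [r0 _] := rad_disc p dp p0.
have p1 : p.1 <= 2 * rad p by nra.
by split; apply: Rabs_le; nra.
Qed.

Lemma disc_Yup N p : 0 < p.1 -> / INR N <= rad p <= 1 -> (0 < N)%N -> Yup N p.
Proof.
move=> p0; elim: N => // N IH [h1 h2] _.
have [N0|N0] := posnP N.
  left; exists 1%N; split => //; apply: circleX_of_rad => //.
  by move: h1; rewrite N0 Rinv_1; lra.
have [h|h] := Rle_lt_dec (/ INR N) (rad p).
  by apply: (@Yup_mono N) => //; apply: IH.
by right; exists N; rewrite N0 leqnSn; split => //; apply: annulus_rad => //; lra.
Qed.

(** Hence missing the point [z_n] is the same as missing the puncture with its radius and slope. *)
Lemma rad_slope_inj (p q : pt) m : 0 < p.1 -> 0 < q.1 -> rad p = rad q ->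
  p.2 = m * p.1 -> q.2 = m * q.1 -> p = q.
Proof.
move=> p0 q0 r hp hq; have Ep := rad_mult p p0; have Eq := rad_mult q q0.
have E1 : p.1 = q.1.
  have m2 : 0 < 1 + m ^ 2 by nra.
  have e1 : 2 * rad p = p.1 * (1 + m ^ 2).
    by apply: (Rmult_eq_reg_r p.1); [rewrite hp in Ep; nra|lra].
  have e2 : 2 * rad q = q.1 * (1 + m ^ 2).
    by apply: (Rmult_eq_reg_r q.1); [rewrite hq in Eq; nra|lra].
  by apply: (Rmult_eq_reg_r (1 + m ^ 2)); [rewrite -e1 -e2 r|lra].
by rewrite (surjective_pairing p) (surjective_pairing q) hp hq E1.
Qed.

Lemma subsequence (X : Type) (Q : nat -> nat -> X -> Prop) :
  (forall M j, exists k y, (M < k)%N /\ Q j k y) ->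
  exists (phi : nat -> nat) (y : nat -> X),
    (forall m, (phi m < phi m.+1)%N) /\ forall j, Q j (phi j) (y j).
Proof.
move=> hQ.
have /choice[f hf] : forall Mj : nat * nat, exists ky : nat * X,
    (Mj.1 < ky.1)%N /\ Q Mj.2 ky.1 ky.2.
  by move=> [M j]; have [k [y h]] := hQ M j; exists (k, y).
pose s := fix s j := if j is i.+1 then f ((s i).1, j) else f (0%N, 0%N).
exists (fun j => (s j).1), (fun j => (s j).2); split.
  by move=> m; have [] := hf ((s m).1, m.+1).
by case=> [|j]; [have [] := hf (0%N, 0%N)|have [] := hf ((s j).1, j.+1)].
Qed.

Lemma strict_mono_inj (phi : nat -> nat) : (forall m, (phi m < phi m.+1)%N) ->
  injective phi.
Proof.
move=> h; have lt i j : (i < j)%N -> (phi i < phi j)%N.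
  elim: j => // j IH; rewrite ltnS leq_eqVlt => /orP[/eqP-> //|/IH ij].
  exact: ltn_trans ij (h j).
by move=> i j E; case: (ltngtP i j) => // /lt; rewrite E ltnn.
Qed.

Lemma within_conton (S : set (R * R)) (f : R * R -> pt) :
  {within S, continuous f} ->
  conton S (fun x => (f x).1) /\ conton S (fun x => (f x).2).
Proof.
move=> /subspace_continuousP fc.
have H x e : S x -> 0 < e -> exists d, 0 < d /\ forall y, S y -> near2 d x y ->
    near2 e (f x) (f y).
  move=> Sx e0; have hn : nbhs (f x) [set q | near2 e (f x) q].
    by apply/nbhs_near2; exists e.
  have /nbhs_near2[d [d0 hd]] := fc x Sx _ hn.
  by exists d; split => // y Sy xy; exact: hd.
by split=> x Sx e e0; have [d [d0 hd]] := H x e Sx e0;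
  exists d; split => // y Sy xy; have [] := hd y Sy xy.
Qed.

Lemma within_contI (f : R -> pt) : {within unitI, continuous f} ->
  contI (fun s => (f s).1) /\ contI (fun s => (f s).2).
Proof.
move=> /subspace_continuousP fc.
have H x e : unitI x -> 0 < e -> exists d, 0 < d /\ forall y, unitI y ->
    Rabs (x - y) < d -> near2 e (f x) (f y).
  move=> Sx e0; have hn : nbhs (f x) [set q | near2 e (f x) q].
    by apply/nbhs_near2; exists e.
  have /nbhs_Rabs[d [d0 hd]] := fc x Sx _ hn.
  by exists d; split => // y Sy xy; exact: hd.
by split=> x Sx e e0; have [d [d0 hd]] := H x e Sx e0;
  exists d; split => // y Sy xy; have [] := hd y Sy xy.
Qed.

Lemma conton_comp (S : set pt) (f : pt -> R) (g : R * R -> pt) :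
  conton unitSq (fun x => (g x).1) -> conton unitSq (fun x => (g x).2) ->
  (forall x, unitSq x -> S (g x)) -> (forall x, unitSq x -> contat S f (g x)) ->
  conton unitSq (fun x => f (g x)).
Proof.
move=> g1 g2 gS fc x Sx e e0; have [d [d0 hd]] := fc x Sx e e0.
have [d1 [d10 hd1]] := g1 x Sx d d0; have [d2 [d20 hd2]] := g2 x Sx d d0.
exists (Rmin d1 d2); split; first exact: Rmin_pos.
move=> y Sy xy; apply: hd; first exact: gS.
split; [apply: hd1|apply: hd2] => //; apply: near2_le xy.
  exact: Rmin_l.
exact: Rmin_r.
Qed.

Lemma contI_conton (f : R -> R) : contI f -> conton unitSq (fun x => f x.1).
Proof.
move=> fc x [Sx _] e e0; have [d [d0 hd]] := fc _ Sx _ e0.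
by exists d; split => // y [Sy _] [h _]; exact: hd.
Qed.

Lemma contI_comp (S : set pt) (f : pt -> R) (g : R -> pt) :
  contI (fun x => (g x).1) -> contI (fun x => (g x).2) ->
  (forall x, unitI x -> S (g x)) -> (forall x, unitI x -> contat S f (g x)) ->
  contI (fun x => f (g x)).
Proof.
move=> g1 g2 gS fc; have I0 : unitI 0 by rewrite /unitI /=; lra.
apply: (conton_contI (fun x => f (g x.1)) 0) => //.
apply: (conton_comp S f (fun x => g x.1)).
- exact: (contI_conton (fun x => (g x).1)).
- exact: (contI_conton (fun x => (g x).2)).
- by move=> x [Sx _]; exact: gS.
- by move=> x [Sx _]; exact: fc.
Qed.

End PointSets.

(** * Comparison of the archipelago topology with the Euclidean one *)

Section Archipelago.
Local Open Scope R_scope.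
Variables (T : topologicalType) (e : T -> pt).
Hypotheses (e_inj : injective e) (e_range : range e = HAset).
Hypothesis top_Yup : forall n : nat, (1 <= n)%N -> forall A : set pt, A `<=` Yup n ->
      ((exists U : set pt, open U /\ A = U `&` Yup n) <->
       (exists V : set T, open V /\ e @^-1` A = V `&` e @^-1` Yup n)).

Lemma e_HAset x : HAset (e x).
Proof. by rewrite -e_range; exists x. Qed.

Lemma square_cvg (H : R * R -> T) (x : R * R) (y : nat -> R * R) :
  {within unitSq, continuous H} -> unitSq x ->
  (forall j, unitSq (y j) /\ near2 (1 / INR j.+1) x (y j)) ->
  (fun j => H (y j)) @ \oo --> H x.
Proof.
move=> /subspace_continuousP Hc Sx hy A /(Hc x Sx) /nbhs_near2[d [d0 hd]].
have [m [m0 hm]] := archi_inv d d0.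
exists m => // j /= mj; have [Sy xy] := hy j.
apply: hd => //; apply: near2_le xy.
have : / INR j.+1 <= / INR m.
  by apply: Rinv_le_contravar => //; apply: le_INR; apply/leP; exact: leqW.
by rewrite /Rdiv !Rmult_1_l in hm *; lra.
Qed.

(** Otherwise preimages of [z_k] for arbitrarily large [k] accumulate at a point of the square, and
    [H] turns them into a convergent subsequence of [z]. *)
Lemma square_avoids (H : R * R -> T) (z : nat -> T) :
  {within unitSq, continuous H} ->
  ~ (exists (p : T) (phi : nat -> nat),
       (forall m, (phi m < phi m.+1)%N) /\ (z \o phi) @ \oo --> p) ->
  exists N, forall k x, (N <= k)%N -> unitSq x -> H x <> z k.
Proof.
move=> Hc hz.
have [||d [d0 hd]] := unitSq_cover (fun d x => forall k, 1 / d < INR k -> H x <> z k).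
- move=> d d' x d0 dd' h k hk; apply: h; apply: Rle_lt_trans hk.
  by rewrite /Rdiv !Rmult_1_l; apply: Rinv_le_contravar.
- move=> x Sx; apply: contrapT => hn; apply: hz.
  have [M j|phi [y [phim hy]]] := subsequence _
    (fun j k y => unitSq y /\ near2 (1 / INR j.+1) x y /\ H y = z k).
    apply: contrapT => hn'; apply: hn.
    pose d := Rmin (1 / INR j.+1) (1 / (INR M + 1)).
    have j0 : 0 < 1 / INR j.+1 by apply: Rdiv_lt_0_compat; [lra|apply: lt_0_INR; exact/ltP].
    have M0 : 0 < 1 / (INR M + 1) by apply: Rdiv_lt_0_compat; [lra|have := pos_INR M; lra].
    exists d; split; first exact: Rmin_pos.
    move=> y Sy xy k hk Hy; apply: hn'; exists k, y; split; last first.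
      by split => //; split => //; apply: near2_le xy; exact: Rmin_l.
    apply/ltP/INR_lt; apply: Rlt_trans hk.
    have : INR M + 1 <= 1 / d; last lra.
    have := Rinv_le_contravar _ _ (Rmin_pos _ _ j0 M0) (Rmin_r (1 / INR j.+1) (1 / (INR M + 1))).
    by rewrite -/d /Rdiv !Rmult_1_l Rinv_inv.
  exists (H x), phi; split => //.
  have -> : z \o phi = (fun j => H (y j)).
    by apply/funext => j /=; have [_ [_ ->]] := hy j.
  by apply: square_cvg => // j; have [? [? _]] := hy j.
have [N hN] : exists N : nat, 1 / d < INR N.
  have [N [N0 hN]] := archi_inv d d0; exists N.
  have dN : 0 < d * INR N by exact: Rmult_lt_0_compat.
  apply: (Rmult_lt_reg_r d) => //.
  have -> : 1 / d * d = 1 by field; lra.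
  have : 1 / INR N * INR N < d * INR N by apply: Rmult_lt_compat_r.
  have -> : 1 / INR N * INR N = 1 by field; lra.
  lra.
exists N => k x Nk Sx; apply: hd => //; apply: Rlt_le_trans hN _.
by apply: le_INR; apply/leP.
Qed.

(* The identification of the archipelago with the plane disc is sequentially
   continuous: a sequence leaving every [Y^M] tends to the origin in the plane,
   and can only tend to the origin in the archipelago. *)
Lemma square_euclidean (H : R * R -> T) (z : nat -> T) :
  {within unitSq, continuous H} ->
  (forall n : nat, interior (annulus n.+1) (e (z n))) ->
  (forall y : nat -> T,
      (forall n : nat, interior (annulus n.+1) (e (y n))) ->
      forall (p : T) (phi : nat -> nat),
        (forall m, (phi m < phi m.+1)%N) -> (y \o phi) @ \oo --> p ->
        e p = origin) ->
  conton unitSq (fun x => (e (H x)).1) /\ conton unitSq (fun x => (e (H x)).2).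
Proof.
move=> Hc hz cond2.
suff Hs x : unitSq x -> forall eps, 0 < eps -> exists d, 0 < d /\ forall y, unitSq y ->
    near2 d x y -> near2 eps (e (H x)) (e (H y)).
  by split=> x Sx eps eps0; have [d [d0 hd]] := Hs x Sx eps eps0;
    exists d; split => // y Sy xy; have [] := hd y Sy xy.
move=> Sx eps eps0; apply: contrapT => hn.
have hfar j : exists y, unitSq y /\ near2 (1 / INR j.+1) x y /\
    ~ near2 eps (e (H x)) (e (H y)).
  apply: contrapT => hn'; apply: hn; exists (1 / INR j.+1); split.
    by apply: Rdiv_lt_0_compat; [lra|apply: lt_0_INR; exact/ltP].
  move=> y Sy xy; apply: contrapT => hh; apply: hn'; by exists y.
(* On a single [Y^M'] containing both images the two topologies agree, so images that stay far from
   [e (H x)] must leave every [Y^M]. *)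
have escape M : exists d, 0 < d /\ forall y, unitSq y -> near2 d x y ->
    ~ near2 eps (e (H x)) (e (H y)) -> ~ Yup M (e (H y)).
  have [M0 hM0] := e_HAset (H x).
  pose M' := (M + M0).+1.
  pose A : set pt := [set q | near2 eps (e (H x)) q] `&` Yup M'.
  have Aopen : exists U : set pt, open U /\ A = U `&` Yup M'.
    exists [set q | near2 eps (e (H x)) q]; split => //.
    exact: near2_open.
  have [V [oV EV]] : exists V : set T, open V /\ e @^-1` A = V `&` e @^-1` Yup M'.
    by apply/top_Yup => // q [].
  have Vx : V (H x).
    have : (e @^-1` A) (H x).
      split; first exact: near2_refl.
      by apply: (@Yup_mono M0) hM0; rewrite /M' leqW // leq_addl.
    by rewrite EV => -[].
  move: Hc => /subspace_continuousP /(_ x Sx V (open_nbhs_nbhs (conj oV Vx))).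
  move=> /nbhs_near2[d [d0 hd]]; exists d; split => // y Sy xy far hY.
  have : (V `&` e @^-1` Yup M') (H y).
    split; first exact: hd.
    by apply: (@Yup_mono M) hY; rewrite /M' leqW // leq_addr.
  by rewrite -EV => -[].
have near_le j d : 0 < d -> exists i, (j <= i)%N /\ 1 / INR i.+1 <= d.
  move=> d0; have [m [m0 hm]] := archi_inv d d0.
  exists (m + j)%N; split; first exact: leq_addl.
  have : / INR (m + j).+1 <= / INR m.
    by apply: Rinv_le_contravar => //; apply: le_INR; apply/leP; rewrite leqW // leq_addr.
  by rewrite /Rdiv !Rmult_1_l in hm *; lra.
have [M j|phi [y [phim hy]]] := subsequence _ (fun j k y =>
    [/\ unitSq y, near2 (1 / INR j.+1) x y, ~ near2 eps (e (H x)) (e (H y)),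
        interior (annulus k.+1) (e (H y)) &
        0 < (e (H y)).1 /\ rad (e (H y)) <= / INR k.+1]).
  have [d [d0 hd]] := escape M.+1; have [i [ji hi]] := near_le j d d0.
  have [y [Sy [xy far]]] := hfar i.
  have nY := hd y Sy (near2_le _ _ _ _ hi xy) far.
  have [k [Mk hk1 hk2]] := not_Yup _ _ (e_HAset _) nY.
  exists k, y; split => //; split => //; apply: near2_le xy.
  rewrite /Rdiv !Rmult_1_l; apply: Rinv_le_contravar; first by apply: lt_0_INR; exact/ltP.
  by apply: le_INR; apply/leP.
have phi_inj := strict_mono_inj _ phim.
(* Condition (2) concerns sequences with a point in every annulus: the gaps of the subsequence are
   filled with [z]. *)
have /choice[y' hy'] : forall k, exists t : T, interior (annulus k.+1) (e t) /\
    forall j, phi j = k -> t = H (y j).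
  move=> k; have [[j jk]|nj] := pselect (exists j, phi j = k).
    exists (H (y j)); split; first by have [_ _ _ + _] := hy j; rewrite jk.
    by move=> i ik; congr (H (y _)); apply: phi_inj; rewrite jk ik.
  by exists (z k); split => // j jk; case: nj; exists j.
have Hx0 : e (H x) = origin.
  apply: (cond2 y' _ _ phi phim) => [k|]; first by have [] := hy' k.
  have -> : y' \o phi = (fun j => H (y j)).
    by apply/funext => j /=; have [_ h] := hy' (phi j); exact: h.
  by apply: square_cvg => // j; have [? ? _ _ _] := hy j.
have [m [m0 hm]] := archi_inv (eps / 2) ltac:(lra).
have [_ _ far _ [p0 rp]] := hy m; apply: far; rewrite Hx0.
have phige j : (j <= phi j)%N.
  by elim: j => // j IH; exact: leq_ltn_trans IH (phim j).
have hr : rad (e (H (y m))) <= 1 / INR m.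
  apply: Rle_trans rp _; rewrite /Rdiv Rmult_1_l; apply: Rinv_le_contravar => //.
  by apply: le_INR; apply/leP; exact: leqW.
have [a1 a2] := rad_small _ _ (HAset_disc _ (e_HAset _)) p0 hr.
by split => /=; rewrite Rminus_0_l Rabs_Ropp; lra.
Qed.

(** A Euclidean map whose image lies in one [Y^n] is continuous into the archipelago, since [Y^n]
    carries its usual topology; this is why the contraction is kept within [Y^N]. *)
Lemma square_lift (n : nat) (F : R * R -> pt) (b : T) : (1 <= n)%N ->
  conton unitSq (fun x => (F x).1) -> conton unitSq (fun x => (F x).2) ->
  (forall x, unitSq x -> Yup n (F x)) ->
  exists H : R * R -> T, {within unitSq, continuous H} /\
    forall x, unitSq x -> e (H x) = F x.
Proof.
move=> n1 F1 F2 FY.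
have /choice[H hH] : forall x, exists t : T, unitSq x -> e t = F x.
  move=> x; have [Sx|nS] := pselect (unitSq x); last by exists b => /nS.
  have : HAset (F x) by exists n; exact: FY.
  by rewrite -e_range => -[t _ et]; exists t.
exists H; split => //; apply/subspace_continuousP => x Sx W.
rewrite nbhsE => -[V [oV Vx] VW].
pose A : set pt := e @` V `&` Yup n.
have EA : e @^-1` A = V `&` e @^-1` Yup n.
  apply/seteqP; split=> t /=.
    by move=> [[s Vs /e_inj <-]].
  by move=> [Vt Yt]; split => //; exists t.
have [U [oU EU]] : exists U : set pt, open U /\ A = U `&` Yup n.
  by apply/top_Yup => //; [move=> q []|exists V].
have UF y : unitSq y -> U (F y) -> W (H y).
  move=> Sy Uy; apply: VW; have : A (F y) by rewrite EU; split => //; exact: FY.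
  by rewrite -hH // => -[[s Vs /e_inj <-]].
have Ux : U (F x).
  have : A (F x) by rewrite -hH //; split; [exists (H x)|rewrite hH //; exact: FY].
  by rewrite EU => -[].
have /nbhs_near2[d [d0 hd]] : nbhs (F x) U by apply: open_nbhs_nbhs.
have [d1 [d10 hd1]] := F1 x Sx d d0; have [d2 [d20 hd2]] := F2 x Sx d d0.
apply/nbhs_near2; exists (Rmin d1 d2); split; first exact: Rmin_pos.
move=> y xy Sy; apply: UF => //; apply: hd; split; [apply: hd1|apply: hd2] => //.
  by apply: near2_le xy; exact: Rmin_l.
by apply: near2_le xy; exact: Rmin_r.
Qed.

End Archipelago.

(** * The kernel *)

Section KernelWords.
Local Open Scope R_scope.

Lemma wedge_comp {X Y : Type} (A B : nat -> Y -> R) (g : X -> Y) : wedge A B ->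
  wedge (fun i x => A i (g x)) (fun i x => B i (g x)).
Proof. by move=> [h1 h2]; split=> [i x|i j x]; [exact: h1|exact: h2]. Qed.

Lemma developing_ext A B A' B' D :
  (forall i s, unitI s -> A i s = A' i s /\ B i s = B' i s) ->
  developing A B D -> developing A' B' D.
Proof.
move=> h [d [d0 hd]]; exists d; split => // s t Is It st.
have E (C C' : nat -> R -> R) r : (forall i, C i r = C' i r) -> C^~ r = C'^~ r.
  by move=> hC; apply/funext => i; exact: hC.
have := hd s t Is It st; rewrite /cross /side_cross.
have EAs i : A i s = A' i s by have [] := h i s Is.
have EAt i : A i t = A' i t by have [] := h i t It.
have EBs i : B i s = B' i s by have [] := h i s Is.
have EBt i : B i t = B' i t by have [] := h i t It.
have -> : [set i | 1 < A i s] = [set i | 1 < A' i s].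
  by apply/seteqP; split=> i /=; rewrite EAs.
by rewrite EAs EAt EBs EBt.
Qed.

Section Radii.
Variables (N : nat) (rho mu : nat -> R).
Hypothesis N0 : (0 < N)%N.
Hypothesis rho0 : 1 < rho 0%N.
Hypothesis rhoS : forall k, (0 < k)%N -> / INR k.+1 < rho k < / INR k.

Lemma circleX_not_puncture i p j : (0 < i)%N -> circleX i p -> (N <= j)%N ->
  ~ puncture rho mu j p.
Proof.
move=> i0 hp Nj [p0 hr _]; have rp := circleX_rad i p i0 hp p0.
have [ij|ji] := leqP i j.
  by have := rho_lt rho rhoS j i i0 ij; lra.
by have := rho_gt rho rho0 rhoS j i i0 ji; lra.
Qed.

Let wA := wA N rho mu.
Let wB := wB N rho mu.

Lemma circ_circleX i u : (0 < i)%N -> circleX i (circ i u).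
Proof.
move=> i0; rewrite /circleX circE /=.
have := sin2_cos2 (2 * PI * u); rewrite /Rsqr => E.
set c := Rtrigo_def.cos _ in E *; set s := Rtrigo_def.sin _ in E *.
have -> : (/ INR i - / INR i * c - / INR i) * ((/ INR i - / INR i * c - / INR i) * 1)
  + / INR i * s * (/ INR i * s * 1) = / INR i * / INR i * (s * s + c * c) by ring.
by rewrite E; ring.
Qed.

(** The coordinates turn the letters of [wordloop] into those of [substN N w], and the homotopy,
    which runs in circles and so meets no puncture, transports this holonomy to [g]. At level [n] a
    loop and its retraction have the same coordinates. *)
Lemma loop_word (g : R -> pt) (w : seq letter) (n : nat) :
  (N <= n)%N -> (forall t, unitI t -> Yearr 1 (g t)) ->
  all (fun a : letter => (1 <= a.1 <= n)%N) w ->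
  homotopic_in (Wfin n) (retract n \o g) (wordloop w) ->
  exists D : R -> seq letter,
    [/\ developing (level n (fun i s => wA i (g s))) (level n (fun i s => wB i (g s))) D,
        eqw (D 1) [::] & eqw (D 0) (substN N w)].
Proof.
move=> Nn gY wl [H [/within_conton[H1 H2] [HW [Hbt Hlr]]]].
have I0 : unitI 0 by rewrite /unitI /=; lra.
have I1 : unitI 1 by rewrite /unitI /=; lra.
have wAB : wedge wA wB by exact: wedge_wAB.
have Wd p : Wfin n p -> disc p.
  by move=> [i [/andP[i0 _] hp]]; exact: circleX_disc hp.
have Hw k x : unitSq x -> contat disc (wA k) (H x) /\ contat disc (wB k) (H x).
  move=> Sx; have Wx := HW x Sx; apply: contat_w => //; first exact: Wd.
  by move=> j; have [i [/andP[i0 _] hp]] := Wx; exact: circleX_not_puncture hp.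
have [||||D0 [D1 [dev0 dev1 D01 D11 D00]]] :=
    square_develop n (fun i x => wA i (H x)) (fun i x => wB i (H x)).
- exact: wedge_comp.
- move=> i; apply: (conton_comp disc (wA i) H) => // x Sx; first exact: (Wd _ (HW x Sx)).
  by have [] := Hw i x Sx.
- move=> i; apply: (conton_comp disc (wB i) H) => // x Sx; first exact: (Wd _ (HW x Sx)).
  by have [] := Hw i x Sx.
- by move=> i t It; rewrite (Hlr t It).1 (Hlr t It).2 /wA wA_origin.
exists D0; split => //.
  apply: developing_ext dev0 => i s Is.
  rewrite /level (Hbt s Is).1 /= /retract; case: pselect => // nW.
  case: ifP => // iN.
  have [j [j0 hj]] := gY s Is.
  have nj : (n < j)%N.
    by rewrite ltnNge; apply/negP => jn; apply: nW; exists j; rewrite j0 jn.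
  have [_ _ hz] := w_circleX N N0 rho mu rho0 rhoS j (g s) j0 hj.
  have A0 : wA i (g s) = 0.
    apply: hz => ij; move: iN; rewrite ij geq_max => /andP[jn _].
    by move: nj; rewrite ltnNge jn.
  rewrite A0 (wedge_B0 _ _ wAB i (g s) A0).
  by rewrite /wA /wB wA_origin wB_origin.
apply: (eq_trans D00).
have wD1 : wedge (level n (fun i s => wA i (H (s, 1)))) (level n (fun i s => wB i (H (s, 1)))).
  exact/wedge_level/(wedge_comp _ _ (fun s => H (s, 1))).
have [w0|w0] := posnP (size w).
  have E : w = [::] by apply: size0nil.
  rewrite E; apply: eq_trans D11; apply: (developing_const _ _ _ wD1 dev1) => //; first lra.
  move=> i r hr; have Ir : unitI r by rewrite /unitI /=; lra.
  rewrite /level (Hbt r Ir).2 E /wordloop /= /wA wA_origin.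
  by case: ifP => _; lra.
have szE : size (substN N w) = size w by rewrite /substN size_map.
have L0 : 0 < INR (size w) by apply: lt_0_INR; apply/ltP.
apply: (eq_trans (spelled_develop _ _ D1 (substN N w) wD1 dev1 _ _ _)); last first.
- by rewrite -[in RHS](cats0 (substN N w)); exact: eqw_catr.
- by rewrite szE.
- move=> k u; rewrite szE => kw hu a t.
  have It : unitI t.
    have kL : INR k + 1 <= INR (size w) by rewrite -S_INR; apply: le_INR; apply/leP.
    have k0 := pos_INR k.
    rewrite /t /unitI /=; split.
      by apply: Rmult_le_pos; [lra|exact/Rlt_le/Rinv_0_lt_compat].
    by apply: (Rmult_le_reg_r (INR (size w))) => //; rewrite /Rdiv Rmult_assoc Rinv_l; lra.
  have [_ Ht] := Hbt t It.
  have := wordloopE w k u kw hu; rewrite /= -/t -Ht => {}Ht.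
  set c := nth (0%N, true) w k in Ht.
  have /andP[c0 cn] : (1 <= c.1 <= n)%N.
    by apply: (allP wl); rewrite mem_nth.
  have aE : a = (maxn c.1 N, c.2).
    rewrite /a /substN (nth_map (0%N, true)) // -/c.
    case: leqP => cN; last by case: (c).
    by [].
  set v := (if c.2 then u else 1 - u) in Ht.
  have [wa wb wz] := w_circleX N N0 rho mu rho0 rhoS c.1 (circ c.1 v) c0 (circ_circleX _ v c0).
  have mn : (maxn c.1 N <= n)%N by rewrite geq_max cn.
  have ic : INR c.1 <> 0 by apply: not_0_INR; case: (c.1) c0.
  have cv : Rtrigo_def.cos (2 * PI * v) = Rtrigo_def.cos (2 * PI * u) /\
      Rtrigo_def.sin (2 * PI * v) = (if c.2 then 1 else -1) * Rtrigo_def.sin (2 * PI * u).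
    rewrite /v; case: (c.2); first by rewrite Rmult_1_l.
    have -> : 2 * PI * (1 - u) = - (2 * PI * u) + 2 * INR 1 * PI by rewrite /=; ring.
    by rewrite cos_period sin_period cos_neg sin_antisym; split => //; ring.
  rewrite aE /level /= mn Ht; split.
  + by rewrite /wA wa circE /= cv.1; field.
  + by rewrite /wB wb circE /= cv.2; field.
  + by move=> j jm; case: ifP => // _; exact: wz.
- move=> i; apply: contI_level.
  apply: (conton_contI (fun x => wB i (H x)) 1) => //.
  apply: (conton_comp disc (wB i) H) => // x Sx; first exact: (Wd _ (HW x Sx)).
  by have [] := Hw i x Sx.
Qed.

End Radii.

Section Main.
Variables (T : topologicalType) (e : T -> pt) (b : T).
Hypotheses (e_inj : injective e) (e_range : range e = HAset) (e_b : e b = origin).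
Hypothesis top_Yup : forall n : nat, (1 <= n)%N -> forall A : set pt, A `<=` Yup n ->
      ((exists U : set pt, open U /\ A = U `&` Yup n) <->
       (exists V : set T, open V /\ e @^-1` A = V `&` e @^-1` Yup n)).

Lemma null_words (z : nat -> T) (gamma : R -> pt) (w : nat -> seq letter) :
  (forall n : nat, interior (annulus n.+1) (e (z n))) ->
  ~ (exists (p : T) (phi : nat -> nat),
       (forall m, (phi m < phi m.+1)%N) /\ (z \o phi) @ \oo --> p) ->
  (forall y : nat -> T,
      (forall n : nat, interior (annulus n.+1) (e (y n))) ->
      forall (p : T) (phi : nat -> nat),
        (forall m, (phi m < phi m.+1)%N) -> (y \o phi) @ \oo --> p ->
        e p = origin) ->
  (forall t, unitI t -> Yearr 1 (gamma t)) ->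
  (forall n : nat, (1 <= n)%N ->
      all (fun a : letter => (1 <= a.1 <= n)%N) (w n)) ->
  (forall n : nat, (1 <= n)%N ->
      homotopic_in (Wfin n) (retract n \o gamma) (wordloop (w n))) ->
  nullhomotopic_HA e b gamma ->
  exists N : nat, (1 <= N)%N /\
    forall n : nat, (N <= n)%N -> freered (substN N (w n)) = [::].
Proof.
move=> hz z_disc cond2 gY wl w_rep [H [Hc [Hbt Hlr]]].
have I0 : unitI 0 by rewrite /unitI /=; lra.
have I1 : unitI 1 by rewrite /unitI /=; lra.
have [N1 hN1] := square_avoids T H z Hc z_disc.
have [H1 H2] := square_euclidean T e e_range top_Yup H z Hc hz cond2.
(* [z k] lies in the annulus of index [k.+1], whence the shift. *)
pose N := N1.+1; exists N; split => // n Nn.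
pose rho k := if k is j.+1 then rad (e (z j)) else 2.
pose mu k := if k is j.+1 then (e (z j)).2 / (e (z j)).1 else 0.
have rho0 : 1 < rho 0%N by rewrite /rho; lra.
have rhoS k : (0 < k)%N -> / INR k.+1 < rho k < / INR k.
  by case: k => // k _; have [] := interior_annulus k.+1 _ isT (hz k).
have Hd x : disc (e (H x)) by exact/HAset_disc/e_HAset.
have np x j : unitSq x -> (N <= j)%N -> ~ puncture rho mu j (e (H x)).
  case: j => // j Sx Nj [p0 hr hs].
  have [z0 _] := interior_annulus j.+1 _ isT (hz j).
  apply: (hN1 j x Nj Sx); apply: e_inj.
  apply: (rad_slope_inj _ _ (mu j.+1)) => //.
  by rewrite /mu /= /Rdiv Rmult_assoc Rinv_l ?Rmult_1_r //; exact: Rgt_not_eq.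
have wAB : wedge (wA N rho mu) (wB N rho mu) by exact: wedge_wAB.
have Hw k x : unitSq x -> contat disc (wA N rho mu k) (e (H x)) /\
    contat disc (wB N rho mu k) (e (H x)).
  by move=> Sx; apply: contat_w => // j Nj; exact: np.
have [||||D0 [D1 [dev0 dev1 D01 D11 D00]]] := square_develop n
    (fun i x => wA N rho mu i (e (H x))) (fun i x => wB N rho mu i (e (H x))).
- exact: (wedge_comp _ _ (fun x => e (H x))).
- move=> i; apply: (conton_comp disc (wA N rho mu i) (fun x => e (H x))) => // x Sx.
  by have [] := Hw i x Sx.
- move=> i; apply: (conton_comp disc (wB N rho mu i) (fun x => e (H x))) => // x Sx.
  by have [] := Hw i x Sx.
- by move=> i t It; rewrite (Hlr t It).1 (Hlr t It).2 e_b wA_origin.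
have [||E [devE E1 E0]] := loop_word N rho mu isT rho0 rhoS gamma (w n) n Nn gY.
- by apply: wl; apply: leq_trans Nn.
- by apply: w_rep; apply: leq_trans Nn.
have dev0' : developing (level n (fun i s => wA N rho mu i (gamma s)))
    (level n (fun i s => wB N rho mu i (gamma s))) D0.
  by apply: developing_ext dev0 => i s Is; rewrite /level (Hbt s Is).1.
(* Both maps develop the coordinates of [gamma], one from the word, the other from the homotopy in
   the archipelago, and both are trivial at 1. *)
have EE : eqw (E 0) (D0 0).
  apply: (developing_unique _ _ _ _ devE dev0') => //.
  exact: eq_trans E1 (esym D01).
have top : eqw (D1 0) (D1 1).
  apply: (developing_const _ _ _ _ dev1) => //; first last.
  - move=> i r hr; have Ir : unitI r by rewrite /unitI /=; lra.
    by rewrite /level (Hbt r Ir).2 e_b wA_origin; case: ifP => _; lra.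
  - lra.
  - exact/wedge_level/(wedge_comp _ _ (fun s => e (H (s, 1)))).
by rewrite -[RHS]D11 -[RHS]top -[RHS]D00 -[RHS]EE E0.
Qed.

End Main.
End KernelWords.

(** * From trivial words to a contraction *)

Section Converse.
Local Open Scope R_scope.

(** For [i <= N] the segment from a point of [X_i] to its squeezed image stays between [X_i] and
    [X_N], hence in [Y^N]; for larger [i] it is a single point. *)
Lemma Yup_scale N i c p : (0 < N)%N -> (0 < i)%N -> circleX i p ->
  (0 < p.1 -> squeeze N p <= c <= 1) -> Yup N (c * p.1, c * p.2).
Proof.
move=> N0 i0 hp hc; have dp := circleX_disc i p i0 hp.
have [E|p0] := disc_cases p dp.
  left; exists 1%N; split => //; rewrite E /= !Rmult_0_r; exact: circleX_origin.
have {hc} [c1 c2] := hc p0.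
have sE := squeeze_circleX N N0 i p i0 hp p0.
have [iN|Ni] := leqP i N; last first.
  rewrite (maxn_idPl (ltnW Ni)) /Rdiv Rinv_r in sE; last by apply: not_0_INR; case: (i) i0.
  have -> : c = 1 by lra.
  left; exists i; split => //.
  by rewrite !Rmult_1_l -surjective_pairing.
rewrite (maxn_idPr iN) in sE.
have rp := circleX_rad i p i0 hp p0.
have Ii : 0 < INR i by apply/lt_0_INR/ltP.
have IN : 0 < INR N by apply/lt_0_INR/ltP.
have cp : 0 < c by apply: Rlt_le_trans c1; rewrite sE; exact: Rdiv_lt_0_compat.
apply: disc_Yup => //=; first exact: Rmult_lt_0_compat.
rewrite rad_scale ?rp //; last lra.
have i1 := inv_INR_le 1 i isT i0; rewrite Rinv_1 in i1.
have ii := Rinv_0_lt_compat _ Ii.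
split; last by nra.
have : squeeze N p * / INR i <= c * / INR i by apply: Rmult_le_compat_r; lra.
have -> // : squeeze N p * / INR i = / INR N by rewrite sE; field; lra.
Qed.

Lemma conton_reparam f (phi : R -> R) : conton unitSq f ->
  (forall t, unitI t -> unitI (phi t)) ->
  (forall s t, Rabs (phi s - phi t) <= 2 * Rabs (s - t)) ->
  conton unitSq (fun x => f (x.1, phi x.2)).
Proof.
move=> fc phiI phil x [Sx1 Sx2] e e0.
have [|d [d0 hd]] := fc (x.1, phi x.2) _ e e0; first by split => //; exact: phiI.
exists (d / 2); split; first lra.
move=> y [Sy1 Sy2] [h1 h2]; apply: hd; first by split => //; exact: phiI.
by split=> /=; [lra|have := phil x.2 y.2; lra].
Qed.

(** Only one component is off the base point, and dividing by its index undoes the rescaling. So the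
    squeezed loop is a function of its wedge coordinates, which makes it compatible with the
    tree. *)
Lemma sigma_coords N rho mu p q : (0 < N)%N -> 1 < rho 0%N ->
  (forall k, (0 < k)%N -> / INR k.+1 < rho k < / INR k) ->
  Yearr 1 p -> Yearr 1 q ->
  (forall i, wA N rho mu i p = wA N rho mu i q /\ wB N rho mu i p = wB N rho mu i q) ->
  sigma N p = sigma N q.
Proof.
move=> N0 rho0 rhoS.
have wAB := wedge_wAB N rho mu rho0 rhoS.
have H r : Yearr 1 r -> exists k, sigma N r =
    (wA N rho mu k r / INR k, wB N rho mu k r / INR k) /\
    forall j, j <> k -> wA N rho mu j r = 0.
  move=> [i [i0 hr]]; have [wa wb wz] := w_circleX N N0 rho mu rho0 rhoS i r i0 hr.
  exists (maxn i N); split => //; rewrite wa wb.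
  have [->|r0] := disc_cases r (circleX_disc i r i0 hr).
    by rewrite sigma_origin /origin /= !Rmult_0_r /Rdiv !Rmult_0_l.
  by rewrite /sigma (squeeze_circleX N N0 i r i0 hr r0); congr (_, _); rewrite /Rdiv; ring.
move=> /H[k [-> hk]] /H[l [-> hl]] hpq.
have [->|/eqP kl] := eqVneq k l; first by have [-> ->] := hpq l.
have A1 : wA N rho mu k p = 0 by rewrite (hpq k).1; exact: hl.
have A2 : wA N rho mu l q = 0 by rewrite -(hpq l).1; apply: hk; exact/nesym.
rewrite A1 A2 (wedge_B0 _ _ wAB k p A1) (wedge_B0 _ _ wAB l q A2).
by rewrite /Rdiv !Rmult_0_l.
Qed.

Section Main.
Variables (T : topologicalType) (e : T -> pt) (b : T).
Hypotheses (e_inj : injective e) (e_range : range e = HAset) (e_b : e b = origin).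
Hypothesis top_Yup : forall n : nat, (1 <= n)%N -> forall A : set pt, A `<=` Yup n ->
      ((exists U : set pt, open U /\ A = U `&` Yup n) <->
       (exists V : set T, open V /\ e @^-1` A = V `&` e @^-1` Yup n)).

Lemma words_null (gamma : R -> pt) (w : nat -> seq letter) (N : nat) :
  {within unitI, continuous gamma} ->
  (forall t, unitI t -> Yearr 1 (gamma t)) ->
  gamma 0 = origin -> gamma 1 = origin ->
  (forall n : nat, (1 <= n)%N ->
      all (fun a : letter => (1 <= a.1 <= n)%N) (w n)) ->
  (forall n : nat, (1 <= n)%N ->
      homotopic_in (Wfin n) (retract n \o gamma) (wordloop (w n))) ->
  (1 <= N)%N -> (forall n : nat, (N <= n)%N -> freered (substN N (w n)) = [::]) ->
  nullhomotopic_HA e b gamma.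
Proof.
move=> /within_contI[g1 g2] gY gam0 gam1 wl w_rep N0 wN.
have I0 : unitI 0 by rewrite /unitI /=; lra.
have I1 : unitI 1 by rewrite /unitI /=; lra.
(* The loop stays on the circles, so any punctures off them will do: here of radius midway between
   consecutive circles, on the horizontal axis. *)
pose rho (k : nat) := if k is 0%N then 2 else (/ INR k + / INR k.+1) / 2.
pose mu (k : nat) := 0.
have rho0 : 1 < rho 0%N by rewrite /rho; lra.
have rhoS k : (0 < k)%N -> / INR k.+1 < rho k < / INR k.
  move=> k0; have := inv_INR_S k k0; rewrite /rho; case: (k) k0 => // j _; lra.
have gd s : unitI s -> disc (gamma s) by move=> Is; exact/Yearr_disc/gY.
have wc i s : unitI s -> contat disc (wA N rho mu i) (gamma s) /\
    contat disc (wB N rho mu i) (gamma s).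
  move=> Is; apply: contat_w => // [|j]; first exact: gd.
  have [k [k0 hk]] := gY s Is.
  exact: (circleX_not_puncture N rho mu rho0 rhoS k).
pose A i s := wA N rho mu i (gamma s).
pose B i s := wB N rho mu i (gamma s).
have /choice[D hD] : forall n, exists D, (N <= n)%N ->
    [/\ developing (level n A) (level n B) D, eqw (D 0) [::] & eqw (D 1) [::]].
  move=> n; have [Nn|nN] := leqP N n; last by exists (fun=> [::]).
  have n1 : (1 <= n)%N by exact: leq_trans Nn.
  have [D [dev D1 D0]] := loop_word N rho mu N0 rho0 rhoS gamma (w n) n Nn gY
    (wl n n1) (w_rep n n1).
  by exists D => _; split => //; rewrite /eqw D0; exact: wN.
have wAB : wedge A B.
  exact: (wedge_comp _ _ gamma (wedge_wAB N rho mu rho0 rhoS)).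
have Ac i : contI (A i).
  by apply: (contI_comp disc (wA N rho mu i) gamma) => // s Is; have [] := wc i s Is.
have Bc i : contI (B i).
  by apply: (contI_comp disc (wB N rho mu i) gamma) => // s Is; have [] := wc i s Is.
have A01 i : A i 0 = 0 /\ A i 1 = 0 by rewrite /A gam0 gam1 wA_origin.
have [h [hc hpos h0 h1 htree]] := excursion A B D N wAB Ac Bc hD A01.
have [st [stI hst]] := tree_contraction h hc hpos h0 h1.
pose f1 s := (sigma N (gamma s)).1.
pose f2 s := (sigma N (gamma s)).2.
have fE s t : unitI s -> unitI t ->
    (forall i, A i s = A i t /\ B i s = B i t) -> sigma N (gamma s) = sigma N (gamma t).
  by move=> Is It; apply: sigma_coords => //; exact: gY.
have f1c : contI f1.
  apply: (contI_comp disc (fun p => (sigma N p).1) gamma) => // s Is.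
  by have [] := contat_sigma N N0 (gamma s) (gd s Is).
have f2c : contI f2.
  apply: (contI_comp disc (fun p => (sigma N p).2) gamma) => // s Is.
  by have [] := contat_sigma N N0 (gamma s) (gd s Is).
have [L1c [L1b L1s]] : conton unitSq (fun x => f1 (st x)) /\
    (forall s, unitI s -> f1 (st (s, 0)) = f1 s /\ f1 (st (s, 1)) = f1 0) /\
    (forall t, unitI t -> f1 (st (0, t)) = f1 0 /\ f1 (st (1, t)) = f1 0).
  by apply: hst => //; apply: htree => s t Is It hAB; rewrite /f1 (fE s t).
have [L2c [L2b L2s]] : conton unitSq (fun x => f2 (st x)) /\
    (forall s, unitI s -> f2 (st (s, 0)) = f2 s /\ f2 (st (s, 1)) = f2 0) /\
    (forall t, unitI t -> f2 (st (0, t)) = f2 0 /\ f2 (st (1, t)) = f2 0).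
  by apply: hst => //; apply: htree => s t Is It hAB; rewrite /f2 (fE s t).
have f10 : f1 0 = 0 /\ f1 1 = 0 by rewrite /f1 gam0 gam1 sigma_origin.
have f20 : f2 0 = 0 /\ f2 1 = 0 by rewrite /f2 gam0 gam1 sigma_origin.
(* First squeeze the loop into [Y_N] along the rays from the origin, then
   contract it along the tree; the two homotopies are glued by the formula
   [K (min 1 (2 t)) + L (max 0 (2 t - 1)) - (K 1 = L 0)]. *)
pose K (g f : R -> R) (x : R * R) := (1 - x.2) * g x.1 + x.2 * f x.1.
pose lo (t : R) := Rmin 1 (2 * t).
pose hi (t : R) := Rmax 0 (2 * t - 1).
have loI t : unitI t -> unitI (lo t).
  by rewrite /unitI /lo /= /Rmin; case: Rle_dec; lra.
have hiI t : unitI t -> unitI (hi t).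
  by rewrite /unitI /hi /= /Rmax; case: Rle_dec; lra.
have loL s t : Rabs (lo s - lo t) <= 2 * Rabs (s - t).
  rewrite -[X in X * Rabs _]Rabs_pos_eq; last lra.
  rewrite -Rabs_mult /lo /Rmin; case: Rle_dec; case: Rle_dec => ? ?;
    by rewrite /Rabs; case: Rcase_abs => ?; case: Rcase_abs => ?; lra.
have hiL s t : Rabs (hi s - hi t) <= 2 * Rabs (s - t).
  rewrite -[X in X * Rabs _]Rabs_pos_eq; last lra.
  rewrite -Rabs_mult /hi /Rmax; case: Rle_dec; case: Rle_dec => ? ?;
    by rewrite /Rabs; case: Rcase_abs => ?; case: Rcase_abs => ?; lra.
pose M (g f : R -> R) (x : R * R) := K g f (x.1, lo x.2) + f (st (x.1, hi x.2)) - f x.1.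
have Mc g f : contI g -> contI f -> conton unitSq (fun x => f (st x)) ->
    conton unitSq (M g f).
  move=> gc fc Lc.
  have Kc : conton unitSq (K g f).
    move=> x Sx; apply: contat_plus; apply: contat_mult.
    - by apply: contat_minus; [exact: contat_cst|exact: contat_snd].
    - exact: (contI_conton _ gc).
    - exact: contat_snd.
    - exact: (contI_conton _ fc).
  move=> x Sx; apply: contat_minus; last exact: (contI_conton _ fc).
  apply: contat_plus; first exact: (conton_reparam (K g f) lo).
  exact: (conton_reparam (fun x => f (st x)) hi).
have Mlow g f x : (forall s, unitI s -> f (st (s, 0)) = f s) -> unitSq x ->
    x.2 <= 1 / 2 -> M g f x = K g f (x.1, 2 * x.2).
  move=> fb [Sx _] hx; rewrite /M /lo /hi Rmin_right; last lra.
  by rewrite Rmax_left ?fb //; lra.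
have Mhigh g f x : 1 / 2 <= x.2 -> M g f x = f (st (x.1, 2 * x.2 - 1)).
  move=> hx; rewrite /M /lo /hi Rmin_left; last lra.
  by rewrite Rmax_right /K /=; lra.
have sigY s : unitI s -> Yup N (sigma N (gamma s)).
  move=> Is; have [i [i0 hi']] := gY s Is; apply: (Yup_scale N i) => // p0.
  by have [_ ?] := squeeze_range N N0 _ (gd s Is) p0; lra.
pose F x : pt := (M (fun s => (gamma s).1) f1 x, M (fun s => (gamma s).2) f2 x).
have FY x : unitSq x -> Yup N (F x).
  move=> Sx; rewrite /F; have [hx|hx] := Rle_lt_dec x.2 (1 / 2).
    rewrite !Mlow //; first last.
    - by move=> s /L1b[].
    - by move=> s /L2b[].
    have [i [i0 hi']] := gY x.1 Sx.1.
    pose c := (1 - 2 * x.2) + 2 * x.2 * squeeze N (gamma x.1).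
    have -> : K (fun s => (gamma s).1) f1 (x.1, 2 * x.2) = c * (gamma x.1).1.
      by rewrite /K /f1 /sigma /c /=; ring.
    have -> : K (fun s => (gamma s).2) f2 (x.1, 2 * x.2) = c * (gamma x.1).2.
      by rewrite /K /f2 /sigma /c /=; ring.
    apply: (Yup_scale N i) => // p0.
    have [s0 s1] := squeeze_range N N0 _ (gd _ Sx.1) p0.
    by have := Sx.2; rewrite /c /unitI /=; nra.
  rewrite !Mhigh; [|lra|lra].
  have Sx' : unitSq (x.1, 2 * x.2 - 1).
    by split; [exact: Sx.1|have := Sx.2; rewrite /unitI /=; lra].
  have := sigY _ (stI _ Sx').
  by rewrite (surjective_pairing (sigma N _)).
have [H [Hc HF]] := square_lift T e e_inj e_range top_Yup N F b N0
  (Mc _ _ g1 f1c L1c) (Mc _ _ g2 f2c L2c) FY.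
have toB x : unitSq x -> F x = origin -> H x = b.
  by move=> Sx E; apply: e_inj; rewrite HF // E e_b.
exists H; split => //; split.
  move=> s Is; split.
    rewrite HF // /F !Mlow //; try (by move=> ? /L1b[]); try (by move=> ? /L2b[]);
      try (by rewrite /=; lra).
    rewrite /K /= !Rmult_0_r !Rmult_0_l !Rminus_0_r !Rmult_1_l !Rplus_0_r.
    by rewrite -surjective_pairing.
  apply: toB => //; rewrite /F !Mhigh /=; try lra.
  have -> : 2 * 1 - 1 = 1 by ring.
  by rewrite (L1b s Is).2 (L2b s Is).2 f10.1 f20.1.
move=> t It.
have side r : unitI r -> gamma r = origin -> f1 r = 0 -> f2 r = 0 ->
    (forall u, unitI u -> f1 (st (r, u)) = 0 /\ f2 (st (r, u)) = 0) -> H (r, t) = b.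
  move=> Ir gr fr1 fr2 fst0; apply: toB => //.
  have [e1 e2] := fst0 _ (hiI t It).
  by rewrite /F /M /K /= e1 e2 fr1 fr2 gr /origin /=; congr (_, _); ring.
split; apply: side => //.
- exact: f10.1.
- exact: f20.1.
- by move=> u Iu; rewrite (L1s u Iu).1 (L2s u Iu).1 f10.1 f20.1.
- exact: f10.2.
- exact: f20.2.
- by move=> u Iu; rewrite (L1s u Iu).2 (L2s u Iu).2 f10.1 f20.1.
Qed.

End Main.
End Converse.

Theorem theorem7
  (* the harmonic archipelago: a topological space T whose points are
     identified (via the bijection e) with HAset *)
  (T : topologicalType) (e : T -> pt) (b : T)
  (e_inj : injective e) (e_range : range e = HAset) (e_b : e b = origin)
  (* each Y^n inherits its usual (Euclidean) topology *)
  (top_Yup : forall n : nat, (1 <= n)%N -> forall A : set pt, A `<=` Yup n ->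
      ((exists U : set pt, open U /\ A = U `&` Yup n) <->
       (exists V : set T, open V /\ e @^-1` A = V `&` e @^-1` Yup n)))
  (* condition (1) *)
  (cond1 : exists z : nat -> T,
      (forall n : nat, interior (annulus n.+1) (e (z n))) /\
      ~ (exists (p : T) (phi : nat -> nat),
           (forall m, (phi m < phi m.+1)%N) /\ (z \o phi) @ \oo --> p))
  (* condition (2) *)
  (cond2 : forall y : nat -> T,
      (forall n : nat, interior (annulus n.+1) (e (y n))) ->
      forall (p : T) (phi : nat -> nat),
        (forall m, (phi m < phi m.+1)%N) -> (y \o phi) @ \oo --> p ->
        e p = origin)
  (* a loop gamma in the Hawaiian earring Y_1 based at (0,0) ... *)
  (gamma : R -> pt) (gamma_cont : {within unitI, continuous gamma})
  (gamma_Y : forall t, unitI t -> Yearr 1 (gamma t))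
  (gamma0 : gamma 0%R = origin) (gamma1 : gamma 1%R = origin)
  (* ... whose image under psi_1 is the canonical sequence (w_1, w_2, ...):
     w_n is a reduced word on x_1, ..., x_n representing the class of
     r_{1,n} o gamma in pi_1(X_1 u ... u X_n, (0,0)) *)
  (w : nat -> seq letter)
  (w_red : forall n : nat, (1 <= n)%N -> reduced (w n))
  (w_letters : forall n : nat, (1 <= n)%N ->
      all (fun a : letter => (1 <= a.1 <= n)%N) (w n))
  (w_rep : forall n : nat, (1 <= n)%N ->
      homotopic_in (Wfin n) (retract n \o gamma) (wordloop (w n))) :
  (* (w_1, w_2, ...) is in K = ker j^*  iff ... *)
  nullhomotopic_HA e b gamma <->
  exists N : nat, (1 <= N)%N /\
    forall n : nat, (N <= n)%N -> freered (substN N (w n)) = [::].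
Proof.
have [z [hz z_disc]] := cond1; split.
  exact: (null_words T e b e_inj e_range e_b top_Yup z).
case=> N [N1 wN].
exact: (words_null T e b e_inj e_range e_b top_Yup gamma w N).
Qed.
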